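(* Let $E$ be the elliptic curve over $\mathbb{Q}$ given by $y^2 = x^3 - x$ and let $n \geq 2$ be an integer. Then $\mathbb{Q}(E[n])$ is a constructible field if and only if $\varphi(n) = 2^k$ for some integer $k$.
   Context: $\varphi$ is Euler's totient function. For an elliptic curve $E/\mathbb{Q}$, $E[n]=\{P\in E(\overline{\mathbb{Q}}) : nP=\mathcal{O}\}$, and $\mathbb{Q}(E[n])$ is the field generated over $\mathbb{Q}$ by the coordinates of the points of $E[n]$. A complex number is constructible if it can be constructed with straightedge and compass in the complex plane (starting from $0$ and $1$); equivalently, $\alpha\in\mathbb{C}$ is constructible if and only if there is a chain of fields $\mathbb{Q}=K_0\subseteq K_1\subseteq\dots\subseteq K_j$ with $\alpha\in K_j$ and $[K_i:K_{i-1}]=2$ for all $i$. A subfield of $\mathbb{C}$ is constructible if all of its elements are constructible; $\overline{\mathbb{Q}}$ is regarded as a subfield of $\mathbb{C}$. *)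

(* Defs.v *)
From HB Require Import structures.
From mathcomp Require Import all_boot all_order all_algebra.
From mathcomp Require Import complex.
From mathcomp Require Import reals.

Set Implicit Arguments.
Unset Strict Implicit.
Unset Printing Implicit Defensive.

Import Order.TTheory GRing.Theory Num.Theory.

Local Open Scope ring_scope.
Local Open Scope complex_scope.

(* Points of the projective closure of y^2 = x^3 + a x + b. *)
Inductive point (K : Type) : Type :=
| Infinity
| Affine (x y : K).

Arguments Infinity {K}.

Section WeierstrassGroupLaw.
Variables (K : fieldType) (a b : K).

Definition on_curve (P : point K) : Prop :=
  match P with
  | Infinity => True
  | Affine x y => y ^+ 2 = x ^+ 3 + a * x + b
  end.

(* Third intersection point of the curve with the line of slope l through
   (x1, y1) and a point of abscissa x2, reflected in the x-axis. *)
Definition chord_point (l x1 y1 x2 : K) : point K :=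
  let x3 := l ^+ 2 - x1 - x2 in Affine x3 (l * (x1 - x3) - y1).

(* Meaningful for points of the curve only: there x1 = x2 forces
   y2 = y1 or y2 = - y1. *)
Definition ec_add (P Q : point K) : point K :=
  match P, Q with
  | Infinity, _ => Q
  | _, Infinity => P
  | Affine x1 y1, Affine x2 y2 =>
      if x1 == x2 then
        if y1 == - y2 then Infinity
        else chord_point ((3 * x1 ^+ 2 + a) / (2 * y1)) x1 y1 x2
      else chord_point ((y2 - y1) / (x2 - x1)) x1 y1 x2
  end.

Definition ec_mul (n : nat) (P : point K) : point K :=
  iter n (ec_add P) Infinity.

End WeierstrassGroupLaw.

Section ComplexNumbers.
Variable R : realType.

(* The algebraic closure of the rationals inside the complex numbers. *)
Definition Qbar (z : R[i]) : Prop := algebraicOver (ratr : rat -> R[i]) z.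

Definition Qbar_point (P : point R[i]) : Prop :=
  match P with
  | Infinity => True
  | Affine x y => Qbar x /\ Qbar y
  end.

(* E[n] for E : y^2 = x^3 + a x + b over the rationals. *)
Definition torsion (a b : rat) (n : nat) (P : point R[i]) : Prop :=
  [/\ on_curve (ratr a) (ratr b) P, Qbar_point P
    & ec_mul (ratr a) n P = Infinity].

Definition coordinate (S : point R[i] -> Prop) (z : R[i]) : Prop :=
  exists x y : R[i], S (Affine x y) /\ (z = x \/ z = y).

(* Q(S), as the smallest subfield containing S: every subfield of the complex
   numbers contains the rationals. *)
Definition field_generated (S : R[i] -> Prop) (z : R[i]) : Prop :=
  forall F : {pred R[i]},
    divring_closed F -> (forall s, S s -> s \in F) -> z \in F.

Definition torsion_field (a b : rat) (n : nat) : R[i] -> Prop :=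
  field_generated (coordinate (torsion a b n)).

(* A line when p != q. *)
Definition on_line (p q z : R[i]) : Prop :=
  exists t : R, z = p + t%:C * (q - p).

(* The circle with centre c and radius the distance from p to q. *)
Definition on_circle (c p q z : R[i]) : Prop := `|z - c| = `|p - q|.

(* The side conditions say that two intersecting lines are distinct, and that
   two intersecting circles are distinct (distinct concentric circles do not
   meet). *)
Inductive constructible : R[i] -> Prop :=
| constructible0 : constructible 0
| constructible1 : constructible 1
| constructible_line_line (p q r s z : R[i]) :
    constructible p -> constructible q ->
    constructible r -> constructible s ->
    p != q -> r != s -> ~ (on_line p q r /\ on_line p q s) ->
    on_line p q z -> on_line r s z -> constructible z
| constructible_line_circle (p q c r s z : R[i]) :
    constructible p -> constructible q ->
    constructible c -> constructible r -> constructible s ->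
    p != q ->
    on_line p q z -> on_circle c r s z -> constructible z
| constructible_circle_circle (c p q d r s z : R[i]) :
    constructible c -> constructible p -> constructible q ->
    constructible d -> constructible r -> constructible s ->
    c != d ->
    on_circle c p q z -> on_circle d r s z -> constructible z.

Definition constructible_field (F : R[i] -> Prop) : Prop :=
  forall z, F z -> constructible z.

End ComplexNumbers.

(* Main.v *)
From HB Require Import structures.
Require Import Defs.
From mathcomp Require Import all_boot all_order all_algebra.
From mathcomp Require Import all_fingroup all_solvable all_field.
From mathcomp Require Import ring zify.
From mathcomp Require Import complex.
From mathcomp Require Import reals boolp.
From mathcomp Require classical_sets.

(** Constructible numbers form the smallest subfield of the complex numbers that
    is closed under square roots and conjugation ([constructible_sub],
    [constructible_sqrt]); hence each of them lies at the top of a tower of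
    quadratic extensions of the rationals.  On the other side the curve E is
    handled through its group law (associativity is [ec_addA]) and through the
    birational map over Q(i) to the Edwards curve s^2 + c^2 + s^2 c^2 = 1 given by
    s = (1 + i) x / y and c = (x - i) / (x + i), the lemniscate sine and cosine.

    Suppose that the n-torsion is constructible and let p be an odd prime factor
    of n.  Take a valuation v of the complex numbers above p
    ([valuation_ring_exists]).  In a tower of m quadratic extensions the values
    lie in 2^-m Z v(p) ([tower_valuation]).  On the kernel of reduction,
    multiplication by p reads s |-> N(s) / B(s^2) with N and B integral, N(s) =
    p s + ..., B(0) = 1.  Let q be the first exponent at which the coefficient of
    N is prime to p: it is odd and greater than 1.  The Newton polygon
    ([small_root]) gives a point of order p with v(s) = v(p) / (q - 1) and a point
    of order p^2 with v(s) = v(p) / (q (q - 1)).  So q - 1 is a power of 2, and p^2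
    does not divide n because an odd q > 1 divides no power of 2.  Finally
    multiplication by p commutes with multiplication by k, and comparing leading
    terms modulo p yields k^q = k for all k ([index_congruence]); therefore p - 1
    divides q - 1 and is a power of 2.  As this holds for every odd p, the
    totient of n is a power of 2.

    Conversely let the totient of n be a power of 2, so that n is a power of 2
    times distinct Fermat primes.  By Bezout every n-torsion point is a
    combination of points killed by the factors, and constructible points form a
    group.  Halving a point solves quadratic equations ([halving]), and so does
    finding the points of order 3 ([three_torsion]).  Any other Fermat prime is
    p = 2^m + 1 = j^2 + 1, and the p-torsion is the sum of the kernels of i - j and
    i + j.  These are exchanged by complex conjugation, and the points with
    2^m P = - P are few, so each kernel is cyclic ([eig_cyclic]).  The square of an
    automorphism of a normal number field fixes i, so it acts on the kernel of
    i - j as an integer k modulo p, and its (p - 1)-th power acts trivially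
    ([eig_point_over]).  As p - 1 is a power of 2, climbing through subgroups of
    2-power index ([gal_two_power]) expresses the coordinates by square roots. *)

Set Implicit Arguments.
Unset Strict Implicit.
Unset Printing Implicit Defensive.

Import Order.TTheory GRing.Theory Num.Theory.

Local Open Scope ring_scope.

(** * Subfields and constructible numbers *)

(** Stated for predicates in Prop, which constructibility and membership in a
    tower of extensions naturally are. *)
Record is_subfield (F : fieldType) (K : F -> Prop) : Prop := IsSubfield {
  subfield1 : K 1;
  subfieldB : forall x y, K x -> K y -> K (x - y);
  subfield_div : forall x y, K x -> K y -> K (x / y) }.

Section Subfield.
Variables (F : fieldType) (K : F -> Prop).
Hypothesis hK : is_subfield K.
Lemma subfield0 : K 0.
Proof. by rewrite -(subrr 1); apply: subfieldB => //; apply: subfield1. Qed.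
Lemma subfieldN x : K x -> K (- x).
Proof. by rewrite -sub0r => hx; apply: subfieldB => //; apply: subfield0. Qed.
Lemma subfieldD x y : K x -> K y -> K (x + y).
Proof. by move=> hx /subfieldN hy; rewrite -[y]opprK; apply: subfieldB. Qed.
Lemma subfieldV x : K x -> K x^-1.
Proof. by rewrite -div1r => hx; apply: subfield_div => //; apply: subfield1. Qed.
Lemma subfieldM x y : K x -> K y -> K (x * y).
Proof. by move=> hx /subfieldV hy; rewrite -[y]invrK; apply: subfield_div. Qed.
Lemma subfieldX x n : K x -> K (x ^+ n).
Proof.
move=> hx; elim: n => [|n IHn]; first exact: subfield1.
by rewrite exprS; apply: subfieldM.
Qed.
Lemma subfield_nat n : K n%:R.
Proof.
elim: n => [|n IHn]; first exact: subfield0.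
by rewrite -natr1; apply: subfieldD => //; apply: subfield1.
Qed.
End Subfield.

Ltac subfield_closed hK := repeat first
  [ assumption | exact: (subfield1 hK) | exact: (subfield0 hK)
  | exact: (subfield_nat hK) | apply: (subfieldN hK) | apply: (subfieldV hK)
  | apply: (subfieldX hK) | apply: (subfieldD hK) | apply: (subfieldM hK) ].

Definition sqrt_closed (F : fieldType) (K : F -> Prop) := forall x, K (x ^+ 2) -> K x.

(** Completing the square. *)
Lemma sqrt_closed_quadratic (F : fieldType) (K : F -> Prop) (a b c x : F) :
  2 != 0 :> F -> is_subfield K -> sqrt_closed K -> K a -> K b -> K c -> a != 0 ->
  a * x ^+ 2 + b * x + c = 0 -> K x.
Proof.
move=> n2 hK sK ha hb hc a0 hx.
have h : K (2 * a * x + b).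
  apply: sK; have -> : (2 * a * x + b) ^+ 2 = b ^+ 2 - 4 * a * c + 4 * a * (a * x ^+ 2 + b * x + c) by ring.
  by rewrite hx mulr0 addr0; subfield_closed hK.
have -> : x = ((2 * a * x + b) - b) / (2 * a) by field; rewrite a0 n2.
by subfield_closed hK.
Qed.

Section ConjClosed.
Variables (F : numClosedFieldType) (K : F -> Prop).
Hypotheses (hK : is_subfield K) (sK : sqrt_closed K).
Hypothesis cK : forall z, K z -> K z^*.

(** The parameter t is eliminated by conjugation, since it is real. *)
Lemma line_eq (p q z t : F) : t \is Num.real -> z = p + t * (q - p) ->
  (z - p) * (q - p)^* = (z - p)^* * (q - p).
Proof.
by move=> tr ->; rewrite addrAC subrr add0r rmorphM /= (CrealP tr); ring.
Qed.

(** Two lines give two linear equations in z and its conjugate.  When their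
    determinant D vanishes the lines are parallel, hence equal as they meet. *)
Lemma line_line_closed (p q r s z t t' : F) :
  K p -> K q -> K r -> K s -> p != q -> r != s ->
  t \is Num.real -> t' \is Num.real ->
  z = p + t * (q - p) -> z = r + t' * (s - r) ->
  ~ ((exists2 u, u \is Num.real & r = p + u * (q - p)) /\
     (exists2 u, u \is Num.real & s = p + u * (q - p))) -> K z.
Proof.
move=> hp hq hr hs npq nrs tr t'r e e' ndeg.
have dqp : q - p != 0 by rewrite subr_eq0 eq_sym.
have dsr : s - r != 0 by rewrite subr_eq0 eq_sym.
have := line_eq tr e; have := line_eq t'r e'.
rewrite !rmorphB /= => h' h; set D := (q - p) * (s - r)^* - (s - r) * (q - p)^*.
have [D0|D0] := eqVneq D 0.
  exfalso; apply: ndeg; set k := (s - r) / (q - p).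
  have kr : k \is Num.real.
    apply/CrealP; rewrite /k fmorph_div.
    apply: (mulIf dqp); rewrite divfK //.
    have dc : (q - p)^* != 0 by rewrite fmorph_eq0.
    apply: (mulIf dc); rewrite mulrAC divfK //.
    by rewrite mulrC; apply: subr0_eq D0.
  have sr : s - r = k * (q - p) by rewrite /k divfK.
  have er : r = p + (t - t' * k) * (q - p).
    by rewrite mulrBl addrA -e e' -mulrA -sr addrK.
  have ur : t - t' * k \is Num.real by apply: rpredB => //; apply: rpredM.
  split; first by exists (t - t' * k).
  exists (t - t' * k + k); first exact: realD.
  by rewrite mulrDl addrA -er -sr addrC subrK.
have -> : z = ((q - p) * (s^* - r^*) * r - (s - r) * (q^* - p^*) * p
    - (q - p) * (s - r) * (r^* - p^*)) / D.
  apply: (mulIf D0); rewrite divfK // /D !rmorphB.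
  set lhs := LHS; set rhs := RHS.
  apply/eqP; rewrite -subr_eq0; apply/eqP.
  transitivity ((q - p) * ((z - r) * (s^* - r^*) - (z^* - r^*) * (s - r))
    - (s - r) * ((z - p) * (q^* - p^*) - (z^* - p^*) * (q - p))).
    by rewrite /lhs /rhs; ring.
  by rewrite h h' !subrr !mulr0 subrr.
rewrite /D !rmorphB; subfield_closed hK; exact: cK.
Qed.

Lemma circle_eq (c p q z : F) : `|z - c| = `|p - q| ->
  (z - c) * (z^* - c^*) = (p - q) * (p^* - q^*).
Proof. by move=> h; rewrite -!(rmorphB Num.conj) -!normCK h. Qed.

(** The equation of the circle is quadratic in the parameter t along the line,
    with coefficients invariant under conjugation. *)
Lemma line_circle_closed (p q c r s z t : F) :
  K p -> K q -> K c -> K r -> K s -> p != q -> t \is Num.real ->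
  z = p + t * (q - p) -> `|z - c| = `|r - s| -> K z.
Proof.
move=> hp hq hc hr hs npq tr e /circle_eq; have kc := cK.
have dqp : q - p != 0 by rewrite subr_eq0 eq_sym.
rewrite e rmorphD rmorphM rmorphB /= (CrealP tr) => h.
suff kt : K t by subfield_closed hK.
apply: (@sqrt_closed_quadratic _ K ((q - p) * (q^* - p^*))
  ((q - p) * (p^* - c^*) + (p - c) * (q^* - p^*))
  ((p - c) * (p^* - c^*) - (r - s) * (r^* - s^*))) => //.
- by rewrite pnatr_eq0.
- by subfield_closed hK; apply: cK.
- by subfield_closed hK; apply: cK.
- by subfield_closed hK; apply: cK.
- by rewrite mulf_neq0 // -rmorphB fmorph_eq0.
- by rewrite -h; ring.
Qed.

(** The difference of two circle equations is linear in the conjugate of z;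
    substituting it back leaves a quadratic equation in z. *)
Lemma circle_circle_closed (c p q d r s z : F) :
  K c -> K p -> K q -> K d -> K r -> K s -> c != d ->
  `|z - c| = `|p - q| -> `|z - d| = `|r - s| -> K z.
Proof.
move=> hc hp hq hd hr hs ncd /circle_eq h1 /circle_eq h2.
have d0 : d - c != 0 by rewrite subr_eq0 eq_sym.
set N1 := (p - q) * _ in h1; set N2 := (r - s) * _ in h2.
have kN1 : K N1 by rewrite /N1; subfield_closed hK; apply: cK.
have kN2 : K N2 by rewrite /N2; subfield_closed hK; apply: cK.
pose m := N1 - N2 - c * c^* + d * d^*.
have hm : z^* = (m - z * (d^* - c^*)) / (d - c).
  apply: (mulIf d0); rewrite divfK // /m -h1 -h2; ring.
have km : K m by rewrite /m; subfield_closed hK; apply: cK.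
apply: (@sqrt_closed_quadratic _ K (- (d^* - c^*))
  (m - c^* * (d - c) + c * (d^* - c^*))
  (- c * (m - c^* * (d - c)) - N1 * (d - c))) => //.
- by rewrite pnatr_eq0.
- by subfield_closed hK; apply: cK.
- by subfield_closed hK; apply: cK.
- by subfield_closed hK; apply: cK.
- by rewrite oppr_eq0 -rmorphB fmorph_eq0.
- by rewrite -h1 hm; field.
Qed.

End ConjClosed.

Section Geometry.
Variable R : realType.
Local Notation C := (R[i] : numClosedFieldType).
Local Notation cstr := (@constructible R).

Lemma real_complex_real (t : R) : t%:C%C \is @Num.real C.
Proof. by apply/CrealP; apply: conjc_real. Qed.

Lemma real_complexP (z : C) : z \is Num.real -> exists t : R, z = t%:C%C.
Proof.
move/CrealP; case: z => x y [] /eqP.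
rewrite eq_sym -subr_eq0 opprK -mulr2n mulrn_eq0 /= => /eqP->.
by exists x.
Qed.

Lemma on_lineP (p q z : C) :
  on_line p q z <-> exists2 t : C, t \is Num.real & z = p + t * (q - p).
Proof.
split=> [[t ->]|[_ /real_complexP[t ->] ->]]; last by exists t.
by exists t%:C%C => //; apply: real_complex_real.
Qed.

(** Intersecting lines and circles means solving linear and quadratic equations
    in a coordinate and its conjugate. *)
Lemma constructible_sub (K : C -> Prop) :
  is_subfield K -> sqrt_closed K -> (forall z, K z -> K z^*) ->
  forall z, cstr z -> K z.
Proof.
move=> hK sK cK z; elim=> {z}.
- exact: subfield0.
- exact: subfield1.
- move=> p q r s z _ hp _ hq _ hr _ hs npq nrs nd /on_lineP[t tr e] /on_lineP[u ur e'].
  apply: (@line_line_closed _ K hK cK p q r s z t u) => // -[/on_lineP h1 /on_lineP h2].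
  exact: nd.
- move=> p q c r s z _ hp _ hq _ hc _ hr _ hs npq /on_lineP[t tr e] h.
  exact: (@line_circle_closed _ K hK sK cK p q c r s z t).
- move=> c p q d r s z _ hc _ hp _ hq _ hd _ hr _ hs ncd h h'.
  exact: (@circle_circle_closed _ K hK sK cK c p q d r s z).
Qed.

(** * Straightedge and compass constructions *)

Local Notation i := ('i : C).

Lemma constructibleN z : cstr z -> cstr (- z).
Proof.
move=> hz; have [->|z0] := eqVneq z 0; first by rewrite oppr0; apply: constructible0.
apply: (@constructible_line_circle R 0 z 0 0 z) => //.
- exact: constructible0.
- exact: constructible0.
- exact: constructible0.
- by rewrite eq_sym.
- by apply/on_lineP; exists (-1); [rewrite rpredN rpred1 | ring].
- by rewrite /on_circle subr0 sub0r.
Qed.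

(** The parallelogram on 0, z and w, cut out by two circles; it degenerates when
    z = w. *)
Lemma constructibleD z w : cstr z -> cstr w -> cstr (z + w).
Proof.
move=> hz hw; have [<-|zw] := eqVneq z w.
  have [->|z0] := eqVneq z 0; first by rewrite addr0; apply: constructible0.
  apply: (@constructible_line_circle R 0 z z 0 z) => //; rewrite 1?eq_sym //.
  - exact: constructible0.
  - exact: constructible0.
  - by apply/on_lineP; exists 2; [apply: rpred_nat | ring].
  - by rewrite /on_circle addrK sub0r normrN.
apply: (@constructible_circle_circle R z w 0 w z 0) => //.
- exact: constructible0.
- exact: constructible0.
- by rewrite /on_circle addrC addKr subr0.
- by rewrite /on_circle addrK subr0.
Qed.

Lemma constructibleB z w : cstr z -> cstr w -> cstr (z - w).
Proof. by move=> hz /constructibleN; apply: constructibleD. Qed.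

(** The reflection of z is the other intersection of the circles through z
    around 0 and 1. *)
Lemma constructible_conj z : cstr z -> cstr z^*.
Proof.
move=> hz; apply: (@constructible_circle_circle R 0 z 0 1 z 1) => //.
- exact: constructible0.
- exact: constructible0.
- exact: constructible1.
- exact: constructible1.
- by rewrite eq_sym oner_eq0.
- by rewrite /on_circle !subr0 norm_conjC.
- by rewrite /on_circle -[in RHS]norm_conjC rmorphB rmorph1.
Qed.

Lemma norm_sqr_eq (z w : C) : z * z^* = w * w^* -> `|z| = `|w|.
Proof. by rewrite -!normCK => /eqP; rewrite eqrXn2 // => /eqP. Qed.

(** The circles of radius 2 around 1 and -1 meet at a multiple of i. *)
Lemma constructible_i : cstr i.
Proof.
have h1 := constructible1 R; have h0 := constructible0 R.
pose s := sqrtC (3 : C).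
have sr : s \is Num.real by rewrite realE sqrtC_ge0 ler0n.
have s0 : s != 0 by rewrite sqrtC_eq0 pnatr_eq0.
have ss : s ^+ 2 = 3 by apply: sqrtCK.
have his : cstr (i * s).
  apply: (@constructible_circle_circle R 1 1 (-1) (-1) 1 (-1)) => //; try exact: constructibleN.
  - by rewrite -subr_eq0 opprK -mulr2n pnatr_eq0.
  - apply: norm_sqr_eq; rewrite !rmorphB rmorphM rmorphN /= rmorph1 conjCi (CrealP sr).
    by ring: (sqrCi C) ss.
  - apply: norm_sqr_eq; rewrite !rmorphB rmorphM !rmorphN /= rmorph1 conjCi (CrealP sr).
    by ring: (sqrCi C) ss.
apply: (@constructible_line_circle R 0 (i * s) 0 1 0) => //.
- by rewrite eq_sym mulf_neq0 ?neq0Ci.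
- by apply/on_lineP; exists s^-1; [rewrite rpredV | field].
- by apply: norm_sqr_eq; rewrite !subr0 conjCi rmorph1; ring: (sqrCi C).
Qed.

(** Products are first built on the real axis, where similar triangles apply. *)
Definition creal (z : C) := cstr z /\ z \is Num.real.

Lemma constructible_abs (x w : C) : x \is Num.real -> cstr w -> `|x| = `|w| -> cstr x.
Proof.
have h1 := constructible1 R; have h0 := constructible0 R.
move=> xr hw e; apply: (@constructible_line_circle R 0 1 0 w 0) => //.
- by rewrite eq_sym oner_eq0.
- by apply/on_lineP; exists x => //; ring.
- by rewrite /on_circle !subr0.
Qed.

Lemma constructible_iM x : creal x -> cstr (i * x).
Proof.
have h0 := constructible0 R.
move=> [hx xr]; apply: (@constructible_line_circle R 0 i 0 x 0) => //.
- exact: constructible_i.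
- by rewrite eq_sym neq0Ci.
- by apply/on_lineP; exists x => //; ring.
- by rewrite /on_circle !subr0 normrM normCi mul1r.
Qed.

(** Intersection of the real axis with the line through u and v.  With the
    parallel through b i to the line joining i and a it produces a b, and with the
    parallel through i to the line joining a i and 1 it produces 1 / a. *)
Lemma creal_secant (u v t : C) : cstr u -> cstr v -> u != v ->
  ~ (u \is Num.real /\ v \is Num.real) ->
  t \is Num.real -> u + t * (v - u) \is Num.real -> cstr (u + t * (v - u)).
Proof.
have h1 := constructible1 R; have h0 := constructible0 R.
move=> hu hv nuv nr tr zr; apply: (@constructible_line_line R 0 1 u v) => //.
- by rewrite eq_sym oner_eq0.
- case=> /on_lineP[x xr ex] /on_lineP[y yr ey]; apply: nr.
  by rewrite ex ey !subr0 !mulr1 !add0r.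
- by apply/on_lineP; exists (u + t * (v - u)) => //; ring.
- by apply/on_lineP; exists t.
Qed.

Lemma i_notreal : i \isn't Num.real.
Proof.
apply/negP => /CrealP; rewrite conjCi => /eqP; rewrite eq_sym -subr_eq0 opprK.
by rewrite -mulr2n mulrn_eq0 /= (negPf (neq0Ci C)).
Qed.

Lemma crealM a b : creal a -> creal b -> creal (a * b).
Proof.
move=> [ha ra] [hb rb]; split; last exact: rpredM.
have e : a * b = i * b + b * (i * b + (a - i) - i * b) by ring.
have nai : a - i != 0 by apply: contraNneq i_notreal => /subr0_eq <-.
rewrite e; apply: creal_secant => //; last by rewrite -e rpredM.
- exact: constructible_iM.
- apply: constructibleD; first exact: constructible_iM.
  by apply: constructibleB => //; apply: constructible_i.
- by rewrite -subr_eq0 opprD addrA subrr sub0r oppr_eq0.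
- case=> h1 h2; move/negP: i_notreal; apply.
  rewrite (_ : 'i = a - (i * b + (a - i) - i * b)); last by ring.
  by apply: rpredB => //; apply: rpredB.
Qed.

Lemma crealV a : creal a -> creal a^-1.
Proof.
move=> [ha ra]; split; last by rewrite rpredV.
have [->|a0] := eqVneq a 0; first by rewrite invr0; apply: constructible0.
have hi := constructible_i; have h1 := constructible1 R.
have e : a^-1 = i + a^-1 * (i + (1 - i * a) - i) by field.
rewrite e; apply: creal_secant => //; last by rewrite -e rpredV.
- by apply: constructibleD => //; apply: constructibleB => //; apply: constructible_iM.
- rewrite -subr_eq0 opprD addrA subrr sub0r oppr_eq0 subr_eq0.
  apply: contraNneq i_notreal => e1.
  by rewrite (_ : 'i = a^-1) ?rpredV // -[RHS]mul1r e1 mulfK.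
- by case=> h _; move: i_notreal; rewrite h.
- by rewrite rpredV.
Qed.

Lemma crealD a b : creal a -> creal b -> creal (a + b).
Proof. by move=> [? ?] [? ?]; split; [apply: constructibleD | apply: rpredD]. Qed.

Lemma creal_nat n : creal n%:R.
Proof.
elim: n => [|n IHn]; first by split; [apply: constructible0 | apply: rpred0].
rewrite -natr1; apply: crealD => //; split; [exact: constructible1 | exact: rpred1].
Qed.

Lemma creal_half a : creal (2 * a) -> creal a.
Proof.
move=> h; have -> : a = 2^-1 * (2 * a) by field.
by apply: crealM => //; apply/crealV/(creal_nat 2).
Qed.

Lemma constructibleP z : cstr z <-> exists a b, [/\ creal a, creal b & z = a + i * b].
Proof.
split=> [hz|[a [b [[ha ra] hb ->]]]]; last by apply: constructibleD => //; apply: constructible_iM.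
have hc := constructible_conj hz.
have h2 : 2 != 0 :> C by rewrite pnatr_eq0.
exists ('Re z), ('Im z); split; last exact: Crect.
- apply: creal_half; split; last by rewrite rpredM ?rpred_nat ?Creal_Re.
  have -> : 2 * 'Re z = z + z^* by rewrite ReE; field.
  exact: constructibleD.
- apply: creal_half; have r2 : 2 * 'Im z \is Num.real by rewrite rpredM ?rpred_nat ?Creal_Im.
  split=> //; apply: (constructible_abs r2 (constructibleB hc hz)).
  have -> : 2 * 'Im z = 'i * (z^* - z) by rewrite ImE; field.
  by rewrite normrM normCi mul1r.
Qed.

Lemma constructibleM z w : cstr z -> cstr w -> cstr (z * w).
Proof.
move=> /constructibleP[a [b [ha hb ->]]] /constructibleP[c [d [hc hd ->]]].
apply/constructibleP; exists (a * c + - 1%:R * (b * d)), (a * d + b * c); split.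
- apply: crealD; first exact: crealM.
  rewrite mulNr -mulrN mul1r -[_ * d]mulrC; have [h r] := crealM hb hd.
  by rewrite -mulNr mulrC; split; [rewrite mulrN; apply: constructibleN | rewrite mulrN rpredN].
- by apply: crealD; apply: crealM.
- by ring: (sqrCi C).
Qed.

Lemma constructibleV z : cstr z -> cstr z^-1.
Proof.
move=> hz; have [->|z0] := eqVneq z 0; first by rewrite invr0; apply: constructible0.
have hc := constructible_conj hz; rewrite invC_norm.
apply: constructibleM => //.
have : creal (`|z| ^+ 2) by rewrite normCK; split; [apply: constructibleM | rewrite -normCK rpredX ?normr_real].
by case/crealV.
Qed.

(** The circle with diameter from -1 to a meets the imaginary axis at the
    square root of a. *)
Lemma creal_sqrt x : x \is Num.real -> cstr (x ^+ 2) -> creal x.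
Proof.
have h1 := constructible1 R; have h0 := constructible0 R.
move=> xr hx; split=> //; have [->|x0] := eqVneq x 0 => //.
have hc : cstr ((x ^+ 2 - 1) / 2).
  apply: constructibleM; first exact: constructibleB.
  by apply: constructibleV; case: (creal_nat 2).
have hix : cstr (i * x).
  apply: (@constructible_line_circle R 0 i ((x ^+ 2 - 1) / 2) (x ^+ 2) ((x ^+ 2 - 1) / 2)) => //.
  - exact: constructible_i.
  - by rewrite eq_sym neq0Ci.
  - by apply/on_lineP; exists x => //; ring.
  - apply: norm_sqr_eq.
    rewrite !(rmorphB, rmorphM, fmorphV, rmorphXn) /= !rmorph1 conjCi (CrealP xr) conjC_nat.
    by field: (sqrCi C).
by apply: (constructible_abs xr hix); rewrite normrM normCi mul1r.
Qed.

Lemma constructible_subfield : is_subfield cstr.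
Proof.
split; [exact: constructible1 | exact: constructibleB |].
by move=> x y hx /constructibleV; apply: constructibleM.
Qed.

Lemma constructible_sqrt : sqrt_closed cstr.
Proof.
have hK := constructible_subfield => z hz.
have hn : cstr (`|z| ^+ 2).
  have : creal (`|z| ^+ 2 ) .
    apply: creal_sqrt; first by rewrite rpredX ?normr_real.
    rewrite -normrX normCK; apply: constructibleM => //; exact: constructible_conj.
  by case.
have eR : ('Re z) ^+ 2 + ('Im z) ^+ 2 = `|z| ^+ 2 by rewrite normC2_Re_Im.
have eI : ('Re z) ^+ 2 - ('Im z) ^+ 2 = 'Re (z ^+ 2) by rewrite [z ^+ 2]expr2 ReM -!expr2.
have hr : cstr ('Re (z ^+ 2)).
  rewrite ReE; have hc := constructible_conj hz.
  subfield_closed hK.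
apply/constructibleP; exists ('Re z), ('Im z); split; last exact: Crect.
- apply: creal_sqrt; first exact: Creal_Re.
  have -> : 'Re z ^+ 2 = (`|z| ^+ 2 + 'Re (z ^+ 2)) / 2 by rewrite -eR -eI; field.
  subfield_closed hK.
- apply: creal_sqrt; first exact: Creal_Im.
  have -> : 'Im z ^+ 2 = (`|z| ^+ 2 - 'Re (z ^+ 2)) / 2 by rewrite -eR -eI; field.
  subfield_closed hK.
Qed.
End Geometry.

(** * The group law of a plane cubic *)

Definition ec_opp (K : fieldType) (P : point K) : point K :=
  if P is Affine x y then Affine x (- y) else Infinity.

Section GroupLaw.
Variables (F : numClosedFieldType) (a b : F).
Hypothesis nonsingular :
  forall x : F, x ^+ 3 + a * x + b = 0 -> 3 * x ^+ 2 + a != 0.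

Local Notation on := (on_curve a b).
Local Notation add := (ec_add a).
Local Notation opp := (@ec_opp F).


Lemma on_curve_opp P : on P -> on (opp P).
Proof. by case: P => //= x y <-; rewrite sqrrN. Qed.

Lemma ec_oppK : involutive opp.
Proof. by case=> //= x y; rewrite opprK. Qed.

Lemma ec_add_opp P : add (opp P) P = Infinity.
Proof. by case: P => //= x y; rewrite !eqxx. Qed.

Lemma same_abscissa x y z : on (Affine x y) -> on (Affine x z) -> y = z \/ y = - z.
Proof.
move=> /= h1 h2; have /eqP : y ^+ 2 = z ^+ 2 by rewrite h1 h2.
by rewrite eqf_sqr => /orP[] /eqP; [left | right].
Qed.

(** Writing the line through P and Q as y = l x + m, the cubic minus the square of
    the line is (x - x1) (x - x2) (x - x3), which determines a and b.  Chords and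
    tangents then obey the same formulas. *)
Lemma ec_add_line x1 y1 x2 y2 :
  on (Affine x1 y1) -> on (Affine x2 y2) -> (x1 = x2 -> y1 <> - y2) ->
  exists l m, [/\ y1 = l * x1 + m /\ y2 = l * x2 + m,
    a = x1 * x2 + (x1 + x2) * (l ^+ 2 - x1 - x2) + 2 * l * m,
    b = m ^+ 2 - x1 * x2 * (l ^+ 2 - x1 - x2)
    & add (Affine x1 y1) (Affine x2 y2)
      = Affine (l ^+ 2 - x1 - x2) (- (l * (l ^+ 2 - x1 - x2) + m))].
Proof.
move=> h1 h2 h12; rewrite /=; case: eqVneq => [ex|nx].
  subst x2; have := h12 erefl; move/eqP/negPf->.
  have ey : y1 = y2 by case: (same_abscissa h1 h2) => // /h12.
  have y0 : y2 != 0.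
    by apply/eqP => y0; apply: h12 => //; rewrite ey y0 oppr0.
  subst y1; move: h1 => /= h1; rewrite /chord_point.
  set l := (_ / _).
  have hl : 2 * y2 * l = 3 * x1 ^+ 2 + a by rewrite /l; field; rewrite y0.
  exists l, (y2 - l * x1); split.
  - by split; ring.
  - apply/eqP; rewrite -subr_eq0; apply/eqP.
    transitivity (3 * x1 ^+ 2 + a - 2 * y2 * l); first by ring.
    by rewrite hl subrr.
  - apply/eqP; rewrite -subr_eq0; apply/eqP.
    transitivity ((x1 ^+ 3 + a * x1 + b - y2 ^+ 2)
                  - x1 * (3 * x1 ^+ 2 + a - 2 * y2 * l)); first by ring.
    by rewrite hl h1 !subrr mulr0 subrr.
  - by congr Affine; ring.
have d0 : x2 - x1 != 0 by rewrite subr_eq0 eq_sym.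
move: h1 h2 => /= h1 h2.
have ha : a = (y2 ^+ 2 - y1 ^+ 2 - (x2 ^+ 3 - x1 ^+ 3)) / (x2 - x1).
  by rewrite h1 h2; field.
have hb : b = y1 ^+ 2 - x1 ^+ 3 - a * x1 by rewrite h1; ring.
exists ((y2 - y1) / (x2 - x1)), (y1 - (y2 - y1) / (x2 - x1) * x1); split.
- by split; field.
- by rewrite {1}ha; field.
- by rewrite {1}hb ha; field.
- by rewrite /chord_point; congr Affine; ring.
Qed.

Lemma on_curve_add P Q : on P -> on Q -> on (add P Q).
Proof.
case: P => // x1 y1; case: Q => // x2 y2 h1 h2.
have [/andP[/eqP e1 /eqP e2]|ne] := boolP ((x1 == x2) && (y1 == - y2)).
  by rewrite /= e1 e2 !eqxx.
have [|l [m [_ ha hb ->]]] := ec_add_line h1 h2.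
  by move=> e1 e2; move: ne; rewrite e1 e2 !eqxx.
by rewrite /= {1}ha {1}hb; ring.
Qed.

Lemma ec_addC P Q : on P -> on Q -> add P Q = add Q P.
Proof.
case: P => [|x1 y1]; case: Q => [|x2 y2] // h1 h2 /=.
rewrite [x2 == x1]eq_sym; case: eqVneq => [ex|nx]; last first.
  have d1 : x2 - x1 != 0 by rewrite subr_eq0 eq_sym.
  have d2 : x1 - x2 != 0 by rewrite subr_eq0.
  by rewrite /chord_point; congr Affine; field; rewrite ?d1 ?d2.
subst x2; rewrite -[y2 == _]eqr_oppLR [- y2 == _]eq_sym.
case: eqVneq => // ny; case: (same_abscissa h1 h2) => [-> //|ey].
by rewrite ey eqxx in ny.
Qed.

(** Associativity is first proved for a third point T whose abscissa avoids a
    finite list, where every sum with T is a genuine chord. *)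
Definition far (s : seq F) (T : point F) : Prop :=
  if T is Affine u v then on T /\ u \notin s else False.

Lemma far_on s T : far s T -> on T.
Proof. by case: T => // u v []. Qed.

Lemma far_sub s t T : {subset s <= t} -> far t T -> far s T.
Proof. by case: T => // u v st [h ut]; split=> //; apply: contra ut; apply: st. Qed.

Lemma far_exists s : exists T, far s T.
Proof.
have [u us] : exists u : F, u \notin s.
  apply: contrapT => h.
  have {}h u : u \in s by apply/negPn/negP => us; apply: h; exists u.
  pose t : seq F := [seq i%:R | i <- iota 0 (size s).+1].
  have ut : uniq t by rewrite map_inj_uniq ?iota_uniq // => i j /eqP; rewrite eqr_nat => /eqP.
  have := uniq_leq_size ut (fun x _ => h x).
  by rewrite size_map size_iota ltnn.
exists (Affine u (sqrtC (u ^+ 3 + a * u + b))); split=> //=; exact: sqrtCK.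
Qed.

(** The sum Q + T has the abscissa of Q only when T is on the tangent at Q; this is
    where nonsingularity enters, for Q of order 2. *)
Lemma far_addKr Q : on Q ->
  exists s, forall T, far s T -> add (opp Q) (add Q T) = T.
Proof.
case: Q => [|x y] hQ; first by exists [::].
exists [:: x; ((3 * x ^+ 2 + a) / (2 * y)) ^+ 2 - x - x] => -[|u v] // [hT].
rewrite !inE !negb_or => /andP[ux ul] /=.
rewrite eq_sym (negPf ux) /chord_point /=.
have d0 : u - x != 0 by rewrite subr_eq0.
set l := (v - y) / (u - x); have hl : v = y + l * (u - x) by rewrite /l; field.
case: eqVneq => [ex|nx]; last first.
  have d : l ^+ 2 - x - u - x != 0 by rewrite subr_eq0 eq_sym.
  have -> : (l * (x - (l ^+ 2 - x - u)) - y - - y) / (l ^+ 2 - x - u - x) = - l by field.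
  by congr Affine; rewrite ?hl; ring.
exfalso; move: hT hQ => /= hT hQ.
have hd : 2 * y * l = 3 * x ^+ 2 + a.
  apply: (mulIf d0); apply/eqP; rewrite -subr_eq0; apply/eqP.
  have eu : u = l ^+ 2 - x - x by rewrite {1}ex; ring.
  transitivity (v ^+ 2 - (u ^+ 3 + a * u + b) - (y ^+ 2 - (x ^+ 3 + a * x + b))
     + (u - x) ^+ 2 * (u + x + x - l ^+ 2)); first by rewrite hl; ring.
  have -> : u + x + x - l ^+ 2 = 0 by rewrite {1}eu; ring.
  by rewrite hT hQ !subrr mulr0 addr0.
have [y0|y0] := eqVneq y 0.
  have := nonsingular (x := x).
  by rewrite -hd -hQ y0 mulr0 mul0r expr0n /= => /(_ erefl); rewrite eqxx.
move/eqP: ul; apply; rewrite -hd.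
have -> : 2 * y * l / (2 * y) = l by field; rewrite y0.
by rewrite {1}ex; ring.
Qed.

Let abscissa (P : point F) : F := if P is Affine x _ then x else 0.

(** If the abscissa of R + T is in the list, then R + T is one of finitely many
    points, and so is T by cancellation. *)
Lemma far_translate R s : on R -> exists t, forall T, far t T -> far s (add R T).
Proof.
move=> hR; have [s0 hs0] := far_addKr hR.
pose rt x := sqrtC (x ^+ 3 + a * x + b).
exists (abscissa (opp R) :: s0 ++ [seq abscissa (add (opp R) (Affine x (rt x))) | x <- s]
  ++ [seq abscissa (add (opp R) (Affine x (- rt x))) | x <- s]) => T hT.
have hc : add (opp R) (add R T) = T.
  by apply: hs0; apply: far_sub hT => x xs; rewrite in_cons mem_cat xs orbT.
have hRT : on (add R T) by apply: on_curve_add => //; apply: far_on hT.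
case: (add R T) hc hRT => [|x y] hc hRT.
  move: hT; rewrite -hc; case: R {hR hs0 hc} => //= x y [_].
  by rewrite inE eqxx.
split=> //; apply/negP => xs; move: hT; rewrite -hc.
set A := add _ _ => hA.
have : abscissa A \in abscissa (opp R) :: s0 ++ [seq abscissa (add (opp R) (Affine x (rt x))) | x <- s]
  ++ [seq abscissa (add (opp R) (Affine x (- rt x))) | x <- s].
  rewrite in_cons !mem_cat.
  have hr : on (Affine x (rt x)) by rewrite /= sqrtCK.
  case: (same_abscissa hRT hr) => ey; rewrite /A ey.
    by rewrite (map_f (fun x => abscissa (add (opp R) (Affine x (rt x)))) xs) !orbT.
  by rewrite (map_f (fun x => abscissa (add (opp R) (Affine x (- rt x)))) xs) !orbT.
by case: A hA => // u v [_] /negP.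
Qed.

(** With the parameters of [ec_add_line], and w the height of T = (u, v) above the
    line, the curve equation at T is linear in m.  Solving it for m turns both
    sides into rational functions of the independent x1, x2, l, u and w. *)
Lemma far_addA_chord x1 y1 x2 y2 :
  on (Affine x1 y1) -> on (Affine x2 y2) -> (x1 = x2 -> y1 <> - y2) ->
  exists s, forall T, far s T ->
  add (add (Affine x1 y1) (Affine x2 y2)) T = add (Affine x1 y1) (add (Affine x2 y2) T).
Proof.
move=> h1 h2 h12.
have [l [m [[e1 e2] ha hb eadd]]] := ec_add_line h1 h2 h12.
have [t ht] := far_translate [:: x1] h2.
exists [:: x1, x2, l ^+ 2 - x1 - x2 & t] => -[|u v] hT //.
have : far [:: x1] (add (Affine x2 y2) (Affine u v)).
  by apply: ht; apply: far_sub hT => x xt; rewrite !inE xt !orbT.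
case: hT => hT; rewrite !inE !negb_or => /and4P[ux1 ux2 ux3 _] /=.
have n2 : (x2 == u) = false by rewrite eq_sym; apply: negPf.
have n3 : (l ^+ 2 - x1 - x2 == u) = false by rewrite eq_sym; apply: negPf.
rewrite -/(add (Affine x1 y1) (Affine x2 y2)) eadd /= n2 n3 /chord_point /= => -[_].
rewrite inE => nq; rewrite eq_sym (negPf nq).
move: hT => /= hT; move: ux1 ux2 ux3 nq; rewrite -![u == _]subr_eq0 -![_ == x1]subr_eq0.
set w := v - (l * u + m).
have ev : v = w + (l * u + m) by rewrite /w; ring.
have hw : w * (w + 2 * (l * u + m)) = (u - x1) * (u - x2) * (u - (l ^+ 2 - x1 - x2)).
  transitivity (v ^+ 2 - (l * u + m) ^+ 2); first by rewrite ev; ring.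
  by rewrite hT {1}ha {1}hb; ring.
move=> ux1 ux2 ux3 nq.
have w0 : w != 0.
  apply/eqP => w0; move: hw; rewrite w0 mul0r => /esym/eqP.
  by rewrite !mulf_eq0 (negPf ux1) (negPf ux2) (negPf ux3).
have em : m = ((u - x1) * (u - x2) * (u - (l ^+ 2 - x1 - x2)) / w - w) / 2 - l * u.
  by rewrite -hw; field; rewrite w0.
move: nq; rewrite {}e1 {}e2 {}ev; clearbody w; rewrite {}em => nq.
clear - ux2 ux3 w0 nq.
move: nq; set d := (d in d != 0) => nq.
have num_neq0 A : A = d * (w ^+ 2 * 4 * (u - x2) ^+ 2) -> A != 0.
  by move->; rewrite !mulf_neq0 ?expf_neq0 ?pnatr_eq0.
congr Affine; field; rewrite ux2 w0 ux3 /= andbT.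
  by apply: num_neq0; rewrite /d; field; rewrite ux2 w0.
by apply: num_neq0; rewrite /d; field; rewrite ux2 w0.
Qed.

Lemma far_addA P Q : on P -> on Q ->
  exists s, forall T, far s T -> add (add P Q) T = add P (add Q T).
Proof.
case: P => [|x1 y1] hP; first by exists [::].
case: Q => [|x2 y2] hQ; first by exists [::].
have [/andP[/eqP e1 /eqP e2]|ne] := boolP ((x1 == x2) && (y1 == - y2)).
  have [s hs] := far_addKr hQ; exists s => T hT.
  rewrite (_ : Affine x1 y1 = opp (Affine x2 y2)) ?e1 ?e2 //.
  by rewrite ec_add_opp hs.
apply: far_addA_chord => // e1 e2; move: ne; rewrite e1 e2 !eqxx; exact/negP.
Qed.

Lemma far_cat s t T : far (s ++ t) T -> far s T /\ far t T.
Proof. by move=> h; split; apply: far_sub h => x xs; rewrite mem_cat xs ?orbT. Qed.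

Lemma ec_add_eq0 P Q : add P Q = Infinity -> Q = opp P.
Proof.
case: P => [|x1 y1]; case: Q => [|x2 y2] //=.
case: eqVneq => [->|//]; case: eqVneq => // -> _; by rewrite opprK.
Qed.

(** For an affine C and T = (u, v), the chord formulas turn C + T = T into v = 0,
    which fails once the roots of the cubic are excluded. *)
Lemma far_fixed C : exists s, forall T, far s T -> add C T = T -> C = Infinity.
Proof.
case: C => [|x y]; first by exists [::].
have [r hr] := closed_field_poly_normal ('X^3 + a *: 'X + b%:P).
exists (x :: r) => -[|u v] // [hT]; rewrite inE negb_or => /andP[ux ur] /=.
rewrite eq_sym (negPf ux) /chord_point => -[].
have d0 : u - x != 0 by rewrite subr_eq0.
set l := (v - y) / (u - x) => eu ev.
have hv : v = 0.
  have : l * (u - x) = v - y by rewrite /l; field.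
  move: ev; rewrite eu => ev el.
  have : v + v = 0 by rewrite -{1}ev -(subrK y v) -el; ring.
  by move/eqP; rewrite -mulr2n mulrn_eq0 /= => /eqP.
exfalso; move/negP: ur; apply.
have : root ('X^3 + a *: 'X + b%:P) u.
  by rewrite /root !hornerE -[_ ^+ 3 + _ + _]hT hv expr0n.
rewrite hr rootZ ?root_prod_XsubC // lead_coef_eq0; apply/eqP => p0.
have : ('X^3 + a *: 'X + b%:P)`_3 = 0 by rewrite p0 coef0.
by rewrite !coefE /= mulr0 !addr0 => /eqP; rewrite oner_eq0.
Qed.

(** Adding a far point T to both sides reduces the claim to four instances of
    [far_addA]; T is then cancelled by [far_fixed]. *)
Lemma ec_addA P Q R : on P -> on Q -> on R -> add P (add Q R) = add (add P Q) R.
Proof.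
move=> hP hQ hR.
have hPQ := on_curve_add hP hQ; have hQR := on_curve_add hQ hR.
have hA := on_curve_add hP hQR; have hB := on_curve_add hPQ hR.
set A := add P (add Q R) in hA *; set B := add _ R in hB *.
have hA' := on_curve_opp hA.
have [s1 a1] := far_addA hPQ hR; have [s2 a2] := far_addA hP hQ.
have [s3 a3] := far_addA hQ hR; have [s4 a4] := far_addA hP hQR.
have [s5 a5] := far_translate s2 hR; have [s6 a6] := far_addKr hA.
have [s7 a7] := far_addA hA' hB; have [s8 a8] := far_fixed (add (opp A) B).
have [T] := far_exists (s1 ++ s3 ++ s4 ++ s5 ++ s6 ++ s7 ++ s8).
do 6![case/far_cat => ?]; move=> h8.
have AB : add A T = add B T by rewrite a4 // a3 // -a2 ?a1 //; apply: a5.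
suff /ec_add_eq0 -> : add (opp A) B = Infinity by rewrite ec_oppK.
by apply: (a8 T) => //; rewrite a7 // -AB a6.
Qed.

End GroupLaw.

(** * The group of the curve y^2 = x^3 - x *)

Lemma lemniscatic_nonsingular (F : numClosedFieldType) (x : F) :
  x ^+ 3 + -1 * x + 0 = 0 -> 3 * x ^+ 2 + -1 != 0.
Proof.
move=> h; have : x * (x ^+ 2 - 1) = 0 by rewrite -[RHS]h; ring.
move/eqP; rewrite mulf_eq0 => /orP[/eqP->|].
  by rewrite expr0n mulr0 add0r oppr_eq0 oner_eq0.
rewrite subr_eq0 => /eqP->; rewrite mulr1 (_ : 3 + -1 = 2%:R) ?pnatr_eq0 //; ring.
Qed.

HB.instance Definition _ (K : Type) := gen_eqMixin (point K).
HB.instance Definition _ (K : Type) := gen_choiceMixin (point K).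

Record lem_point (F : numClosedFieldType) := LemPoint {
  lem_val :> point F;
  lem_valP : `[< on_curve (-1) 0 lem_val >] }.

HB.instance Definition _ (F : numClosedFieldType) := [isSub for @lem_val F].
HB.instance Definition _ (F : numClosedFieldType) := [Equality of lem_point F by <:].
HB.instance Definition _ (F : numClosedFieldType) := [Choice of lem_point F by <:].

Section LemGroup.
Variable F : numClosedFieldType.
Implicit Types P Q R : lem_point F.

Lemma on_lem P : on_curve (-1) 0 (P : point F).
Proof. exact/asboolP/lem_valP. Qed.

Definition lem_of (P : point F) (h : on_curve (-1) 0 P) : lem_point F :=
  LemPoint (introT (asboolP _) h).

Definition lem_zero : lem_point F := @lem_of Infinity I.
Definition lem_opp P : lem_point F := lem_of (on_curve_opp (on_lem P)).
Definition lem_add P Q : lem_point F := lem_of (on_curve_add (on_lem P) (on_lem Q)).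

Fact lem_addA : associative lem_add.
Proof.
move=> P Q R; apply/val_inj/ec_addA; try exact: on_lem.
exact: lemniscatic_nonsingular.
Qed.
Fact lem_addC : commutative lem_add.
Proof. move=> P Q; apply/val_inj/ec_addC; exact: on_lem. Qed.
Fact lem_add0 : left_id lem_zero lem_add.
Proof. by move=> P; apply: val_inj. Qed.
Fact lem_addN : left_inverse lem_zero lem_opp lem_add.
Proof. by move=> P; apply/val_inj/ec_add_opp. Qed.

HB.instance Definition _ :=
  GRing.isZmodule.Build (lem_point F) lem_addA lem_addC lem_add0 lem_addN.

Lemma lem_valD P Q : P + Q = ec_add (-1) P Q :> point F. Proof. by []. Qed.
Lemma lem_valN P : - P = ec_opp P :> point F. Proof. by []. Qed.

Lemma lem_valMn P n : P *+ n = ec_mul (-1) n P :> point F.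
Proof.
by elim: n => [|n IHn]; rewrite ?mulr0n // mulrS lem_valD IHn.
Qed.

End LemGroup.

Definition map_point (K K' : Type) (f : K -> K') (P : point K) : point K' :=
  if P is Affine x y then Affine (f x) (f y) else Infinity.

Section Morphisms.
Variables (K K' : fieldType) (f : {rmorphism K -> K'}).

Lemma map_ec_add a P Q :
  map_point f (ec_add a P Q) = ec_add (f a) (map_point f P) (map_point f Q).
Proof.
case: P => [|x1 y1] //; case: Q => [|x2 y2] //=.
rewrite -rmorphN !(inj_eq (fmorph_inj f)).
have fE := (rmorphB f, rmorphD f, rmorphM f, fmorphV f, rmorphXn f, rmorph_nat f).
case: (x1 == x2); last by rewrite /= !fE.
by case: (y1 == _); rewrite //= !fE.
Qed.

Lemma map_ec_mul a n P :
  map_point f (ec_mul a n P) = ec_mul (f a) n (map_point f P).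
Proof. by elim: n => //= n IHn; rewrite map_ec_add IHn. Qed.

Lemma map_on_curve a b P :
  on_curve (f a) (f b) (map_point f P) <-> on_curve a b P.
Proof.
case: P => //= x y; rewrite -!(rmorphXn, rmorphM, rmorphD).
by split=> [/fmorph_inj | ->].
Qed.

Lemma map_point_inj : injective (map_point f).
Proof. by case=> [|x y] [|x' y'] //= [/fmorph_inj-> /fmorph_inj->]. Qed.

End Morphisms.

(** The automorphism of order 4 of y^2 = x^3 - x, whose square is - 1. *)
Definition cm_point (K : fieldType) (i : K) (P : point K) : point K :=
  if P is Affine x y then Affine (- x) (i * y) else Infinity.

Lemma cm_ec_add (K : fieldType) (i : K) P Q : i ^+ 2 = -1 -> 2 != 0 :> K ->
  cm_point i (ec_add (-1) P Q) = ec_add (-1) (cm_point i P) (cm_point i Q).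
Proof.
move=> hi n2; have i0 : i != 0.
  by apply: contra_eq_neq hi => ->; rewrite expr0n /= eq_sym oppr_eq0 oner_eq0.
case: P => [|x1 y1] //; case: Q => [|x2 y2] //=.
rewrite eqr_opp -mulrN (inj_eq (mulfI i0)); case: eqVneq => [<-|nx].
  case: eqVneq => // _.
  have [-> | ny] := eqVneq y1 0.
    by rewrite /chord_point !mulr0 invr0 !mulr0 /=; congr Affine; ring.
  by rewrite /chord_point /=; congr Affine; field: hi => //; rewrite ny i0 n2.
have d : x2 - x1 != 0 by rewrite subr_eq0 eq_sym.
have d' : - x2 + x1 != 0 by rewrite addrC subr_eq0.
by rewrite /chord_point /=; congr Affine; field: hi => //; rewrite d andbT opprK.
Qed.

Lemma cm_on_curve (K : fieldType) (i : K) P : i ^+ 2 = -1 ->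
  on_curve (-1) 0 P -> on_curve (-1) 0 (cm_point i P).
Proof. by move=> hi; case: P => //= x y; rewrite exprMn hi => ->; ring. Qed.

(** * Existence of valuation rings *)

Record valuation_ring (F : fieldType) (A : F -> Prop) : Prop := ValuationRing {
  val_ring1 : A 1;
  val_ringB : forall x y, A x -> A y -> A (x - y);
  val_ringM : forall x y, A x -> A y -> A (x * y);
  val_ring_total : forall x, A x \/ A x^-1 }.

Section Existence.
Variables (F : fieldType) (p : F).
Implicit Types A : F -> Prop.

Let subring A := [/\ A 1, forall x y, A x -> A y -> A (x - y)
  & forall x y, A x -> A y -> A (x * y)].

Section Subring.
Variable A : F -> Prop.
Hypothesis hA : subring A.
Let A0 : A 0. Proof. by case: hA => h1 hB _; rewrite -(subrr 1); apply: hB. Qed.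
Let AN x : A x -> A (- x). Proof. by case: hA => h1 hB _ ?; rewrite -sub0r; apply: hB. Qed.
Let AD x y : A x -> A y -> A (x + y).
Proof. by case: hA => h1 hB _ ? /AN ?; rewrite -[y]opprK; apply: hB. Qed.
Let AM x y : A x -> A y -> A (x * y). Proof. by case: hA => _ _; apply. Qed.
Let A1 : A 1. Proof. by case: hA. Qed.
Let Asum n (f : 'I_n -> F) : (forall i, A (f i)) -> A (\sum_i f i).
Proof. by move=> hf; apply: (big_ind A) => // i _. Qed.
Let AX x n : A x -> A (x ^+ n).
Proof. by move=> hx; elim: n => // n IHn; rewrite exprS; apply: AM. Qed.

Definition adjoin A (x z : F) := exists2 q : {poly F}, (forall i, A q`_i) & z = q.[x].

Lemma adjoin_subring x : subring (adjoin A x).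
Proof.
split.
- by exists 1; rewrite ?hornerC // => i; rewrite coef1; case: eqP.
- move=> _ _ [q hq ->] [r hr ->]; exists (q - r); last by rewrite hornerD hornerN.
  by move=> i; rewrite coefB; apply: AD => //; apply: AN.
- move=> _ _ [q hq ->] [r hr ->]; exists (q * r); last by rewrite hornerM.
  by move=> i; rewrite coefM; apply: Asum => j; apply: AM.
Qed.

Lemma adjoin_sub x z : A z -> adjoin A x z.
Proof. by move=> hz; exists z%:P; rewrite ?hornerC // => i; rewrite coefC; case: eqP. Qed.

Lemma adjoin_gen x : adjoin A x x.
Proof. by exists 'X; rewrite ?hornerX // => i; rewrite coefX; case: eqP. Qed.

Hypotheses (p0 : p != 0) (hp : A p) (npV : ~ A p^-1).
Hypothesis hmax : forall x, ~ A x -> adjoin A x p^-1.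

Let one_sub_neq0 a : A a -> 1 - p * a != 0.
Proof.
move=> ha; apply/eqP => /subr0_eq e; apply: npV.
by rewrite -[p^-1]mulr1 e mulKf.
Qed.

(** Otherwise maximality gives an equation 1 / p = q(1 / u) for u = 1 - p a;
    multiplying by a power of u, which is 1 modulo p, puts 1 / p in A. *)
Let one_sub_unit a : A a -> A (1 - p * a)^-1.
Proof.
move=> ha; apply: contrapT => /hmax[q hq e]; apply: npV.
set u := 1 - p * a in e; have u0 : u != 0 by apply: one_sub_neq0.
have Au : A u by apply: AD => //; apply/AN/AM.
have hu n : exists2 b, A b & u ^+ n = 1 - p * b.
  elim: n => [|n [b hb IHn]]; first by exists 0; rewrite // mulr0 subr0.
  exists (a + b - p * a * b); last by rewrite exprS IHn /u; ring.
  by apply: AD; [apply: AD | apply/AN/AM => //; apply: AM].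
have [b hb eb] := hu (size q).
suff : A (p^-1 * u ^+ size q).
  by rewrite eb mulrBr mulr1 mulKf // => /AD/(_ hb); rewrite subrK.
rewrite e horner_coef mulr_suml.
rewrite (eq_bigr (fun i : 'I_(size q) => q`_i * u ^+ (size q - i))).
  by apply: Asum => i; apply/AM/AX.
move=> i _; rewrite -mulrA; congr (_ * _).
by rewrite exprVn mulrC expfB.
Qed.

Let reach x n := exists q : {poly F},
  [/\ forall i, A q`_i, (size q <= n.+1)%N & q.[x] = p^-1].

(** Multiplied by x^(n + 1), the relation in 1 / x expresses x^(n + 1) by lower
    powers of x. *)
Let reach_step x m n : x != 0 -> (m <= n.+1)%N ->
  reach x n.+1 -> reach x^-1 m -> reach x n.
Proof.
move=> x0 mn [q [hq sq eq]] [r [hr sr er]].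
pose u := 1 - p * r`_0; have u0 : u != 0 by apply: one_sub_neq0.
have hu : A u^-1 by apply: one_sub_unit.
pose s := \sum_(j < m) (p * u^-1 * r`_j.+1) *: 'X^(n - j).
have es : s.[x] = x ^+ n.+1.
  have : u * p^-1 = \sum_(j < m) r`_j.+1 * x ^- j.+1.
    rewrite mulrBl mul1r mulrAC mulfV // mul1r -{1}er.
    rewrite (horner_coef_wide _ sr) big_ord_recl expr0 mulr1 addrC addKr.
    by apply: eq_bigr => j _; rewrite exprVn.
  move=> e; transitivity (p * u^-1 * (u * p^-1) * x ^+ n.+1); last by field; rewrite p0 u0.
  rewrite e mulr_sumr mulr_suml horner_sum; apply: eq_bigr => j _.
  rewrite hornerZ hornerXn -!mulrA; do 3!congr (_ * _).
  have jn : (j < n.+1)%N by apply: leq_trans mn.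
  by rewrite -subSS expfB_cond ?(negPf x0) ?add0n // mulrC.
have ss : (size s <= n.+1)%N.
  apply: leq_trans (size_sum _ _ _) _; apply/bigmax_leqP => j _.
  apply: leq_trans (size_scale_leq _ _) _.
  by rewrite size_polyXn ltnS leq_subr.
have hs i : A s`_i.
  rewrite coef_sum; apply: Asum => j.
  by rewrite coefZ coefXn; apply: AM; [apply/AM => //; apply: AM | case: eqP].
exists (take_poly n.+1 q + q`_n.+1 *: s); split.
- move=> i; rewrite coefD coef_take_poly coefZ.
  by apply: AD; [case: ifP | apply: AM].
- rewrite (leq_trans (size_polyD _ _)) // geq_max size_take_poly /=.
  exact: leq_trans (size_scale_leq _ _) ss.
- rewrite hornerD hornerZ es -eq (horner_coef_wide _ sq) big_ord_recr /=; congr (_ + _).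
  rewrite (horner_coef_wide _ (size_take_poly _ _)); apply: eq_bigr => i _.
  by rewrite coef_take_poly ltn_ord.
Qed.

(** If neither x nor 1 / x is in A, then 1 / p is a polynomial in x and one in
    1 / x, by maximality.  Taking the degrees minimal, the relation in 1 / x, whose
    constant part is a unit, lowers the degree of the one in x, or conversely. *)
Lemma maximal_valuation_ring : valuation_ring A.
Proof.
split=> //; try by case: hA.
move=> x; apply: contrapT => /not_orP[/hmax[q hq eq] /hmax[r hr er]].
have x0 : x != 0.
  by apply/eqP => x0; apply: npV; rewrite eq x0 horner_coef0.
have base y : ~ reach y 0.
  case=> s [hs ss es]; apply: npV; rewrite -es (size1_polyC ss) hornerC; exact: hs.
have key N : forall n m y, y != 0 -> (n + m <= N)%N -> reach y n -> reach y^-1 m -> False.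
  elim: N => [|N IHN] n m y y0.
    by rewrite leqn0 addn_eq0 => /andP[/eqP-> _] /base.
  move=> nmN hn hm; have y0' : y^-1 != 0 by rewrite invr_eq0.
  have [mn|/ltnW nm] := leqP m n.
    case: n mn nmN hn => [|n] mn nmN hn; first exact: base hn.
    by apply: (IHN n m y) => //; apply: reach_step hm.
  case: m nm nmN hm => [|m] nm nmN hm; first exact: base hm.
  apply: (IHN n m y) => //; first by rewrite addnS in nmN.
  by apply: (reach_step y0' nm hm); rewrite invrK.
apply: (key (size q + size r)%N (size q) (size r) x) => //.
- by exists q; split.
- by exists r; split.
Qed.
End Subring.

Import classical_sets.
Local Open Scope classical_set_scope.

(** The ring is a maximal subring in which p is not invertible.  The condition
    that 1 belongs to A is imposed on nonempty sets only, so that Zorn's lemma also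
    applies to the empty chain. *)
Lemma valuation_ring_exists : p != 0 -> (forall m : int, m%:~R != p^-1) ->
  (exists m : int, p = m%:~R) ->
  exists2 A, valuation_ring A & ~ A p^-1.
Proof.
move=> p0 hp [m em].
pose P (A : set F) := [/\ forall x y, A x -> A y -> A (x - y) /\ A (x * y),
  forall x, A x -> A 1 & ~ A p^-1].
have [|A [[AB A1 nA] hmax]] := @Zorn_bigcup F P.
  move=> G GP Gtot; split.
  - move=> x y [X GX Xx] [Y GY Yy].
    have [XY|YX] := Gtot _ _ GX GY.
      by have [h _ _] := GP _ GY; have [? ?] := h _ _ (XY _ Xx) Yy; split; exists Y.
    by have [h _ _] := GP _ GX; have [? ?] := h _ _ Xx (YX _ Yy); split; exists X.
  - by move=> x [X GX Xx]; have [_ h _] := GP _ GX; exists X => //; apply: h Xx.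
  - by case=> X GX; have [_ _] := GP _ GX.
have A1' : A 1.
  apply: contrapT => n1; pose Z : set F := fun x => exists k : int, x = k%:~R.
  apply: (hmax Z).
    split; last by move=> h; apply: n1; apply: h; exists 1.
    by move=> x /A1.
  split; last by case=> k /esym/eqP; rewrite (negPf (hp k)).
    move=> _ _ [k ->] [l ->]; split; first by exists (k - l); rewrite rmorphB.
    by exists (k * l); rewrite rmorphM.
  by move=> _ _; exists 1.
have hA : subring A by split=> // x y hx hy; case: (AB x y hx hy).
have hi k : A k%:~R.
  have [_ AB' _] := hA; have A0 : A 0 by rewrite -(subrr 1); apply: AB'.
  have AN x : A x -> A (- x) by rewrite -sub0r; apply: AB'.
  have Ann n : A n%:R.
    elim: n => // n IHn; rewrite -natr1 (_ : _ + 1 = n%:R - - 1); last by rewrite opprK.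
    by apply: AB' => //; apply: AN.
  by case: k => n; rewrite ?NegzE ?mulrNz; [|apply: AN]; apply: Ann.
exists A => //; apply: maximal_valuation_ring => //; first by rewrite em.
move=> x nx; apply: contrapT => np; have [B1 BB BM] := adjoin_subring hA x.
apply: (hmax (adjoin A x)).
  split; first by move=> z; apply: adjoin_sub.
  by move=> h; apply/nx/h/adjoin_gen.
by split=> // y z hy hz; split; [apply: BB | apply: BM].
Qed.
End Existence.

(** * Valuation rings *)

Section ValuationTheory.
Variables (F : fieldType) (A : F -> Prop).
Hypothesis hA : valuation_ring A.

(** Writing the valuation as membership in A avoids the value group: x and y have
    the same valuation when x / y is a [vunit]. *)
Definition vunit x := [/\ x != 0, A x & A x^-1].
Definition vmax x := x = 0 \/ ~ A x^-1.

Lemma val_ring0 : A 0.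
Proof. by rewrite -(subrr 1); apply: val_ringB => //; apply: val_ring1. Qed.
Lemma val_ringN x : A x -> A (- x).
Proof. by rewrite -sub0r => hx; apply: val_ringB => //; apply: val_ring0. Qed.
Lemma val_ringD x y : A x -> A y -> A (x + y).
Proof. by move=> hx /val_ringN hy; rewrite -[y]opprK; apply: val_ringB. Qed.
Lemma val_ringX x n : A x -> A (x ^+ n).
Proof.
move=> hx; elim: n => [|n IHn]; first exact: val_ring1.
by rewrite exprS; apply: val_ringM.
Qed.
Lemma val_ring_nat n : A n%:R.
Proof.
elim: n => [|n IHn]; first exact: val_ring0.
by rewrite -natr1; apply: val_ringD => //; apply: val_ring1.
Qed.
Lemma val_ring_int (k : int) : A k%:~R.
Proof.
by case: k => n; rewrite ?NegzE ?mulrNz; [|apply: val_ringN]; apply: val_ring_nat.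
Qed.
Lemma val_ring_sum (I : Type) (r : seq I) (P : pred I) (f : I -> F) :
  (forall i, P i -> A (f i)) -> A (\sum_(i <- r | P i) f i).
Proof. by move=> hf; apply: (big_ind A) => //; [apply: val_ring0 | apply: val_ringD]. Qed.

Lemma vunit1 : vunit 1.
Proof. by split; rewrite ?oner_eq0 ?invr1 //; apply: val_ring1. Qed.
Lemma vunitV x : vunit x -> vunit x^-1.
Proof. by case=> ? ? ?; split; rewrite ?invr_eq0 ?invrK. Qed.
Lemma vunitM x y : vunit x -> vunit y -> vunit (x * y).
Proof.
by case=> ? ? ? [? ? ?]; split; rewrite ?mulf_neq0 ?invfM //; apply: val_ringM.
Qed.
Lemma vunitX x n : vunit x -> vunit (x ^+ n).
Proof.
move=> hx; elim: n => [|n IHn]; first exact: vunit1.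
by rewrite exprS; apply: vunitM.
Qed.
Lemma vunitN x : vunit x -> vunit (- x).
Proof. by case=> ? ? ?; split; rewrite ?oppr_eq0 ?invrN //; apply: val_ringN. Qed.
Lemma vunitXz x (j : int) : vunit x -> vunit (x ^ j).
Proof.
by move=> hx; case: j => n; rewrite ?NegzE -?exprnN -?exprnP; [|apply: vunitV]; apply: vunitX.
Qed.

Lemma vmax_A x : vmax x -> A x.
Proof. by case=> [-> | nx]; [apply: val_ring0 | case: (val_ring_total hA x)]. Qed.
Lemma vmax0 : vmax 0. Proof. by left. Qed.
Lemma vmaxMl a x : A a -> vmax x -> vmax (a * x).
Proof.
move=> ha [->|nx]; first by rewrite mulr0; left.
have [->|a0] := eqVneq a 0; first by rewrite mul0r; left.
right=> h; apply: nx; have -> : x^-1 = a * (a * x)^-1 by rewrite invfM mulVKf.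
exact: val_ringM.
Qed.
Lemma vmaxMr a x : A a -> vmax x -> vmax (x * a).
Proof. by rewrite mulrC; apply: vmaxMl. Qed.
Lemma vmaxN x : vmax x -> vmax (- x).
Proof. by rewrite -mulN1r => h; apply: vmaxMl h; exact/val_ringN/(val_ring1 hA). Qed.
Lemma vmaxD x y : vmax x -> vmax y -> vmax (x + y).
Proof.
move=> hx hy; have [->|x0] := eqVneq x 0; first by rewrite add0r.
have [->|y0] := eqVneq y 0; first by rewrite addr0.
have [h|] := val_ring_total hA (x / y).
  have -> : x + y = (x / y + 1) * y by field.
  by apply: vmaxMl => //; apply: val_ringD => //; apply: val_ring1.
rewrite invf_div => h; have -> : x + y = (1 + y / x) * x by field.
by apply: vmaxMl => //; apply: val_ringD => //; apply: val_ring1.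
Qed.
Lemma vmaxB x y : vmax x -> vmax y -> vmax (x - y).
Proof. by move=> hx /vmaxN; apply: vmaxD. Qed.
Lemma vmaxX x n : (0 < n)%N -> vmax x -> vmax (x ^+ n).
Proof.
case: n => // n _ hx; rewrite exprS; apply: vmaxMr => //; apply: val_ringX; exact: vmax_A.
Qed.
Lemma vmax_root x n : vmax (x ^+ n) -> vmax x.
Proof.
case=> [/eqP|nx]; first by rewrite expf_eq0 => /andP[_ /eqP->]; left.
by right=> h; apply: nx; rewrite -exprVn; apply: val_ringX.
Qed.
Lemma vmax_sum (I : Type) (r : seq I) (P : pred I) (f : I -> F) :
  (forall i, P i -> vmax (f i)) -> vmax (\sum_(i <- r | P i) f i).
Proof. by move=> hf; apply: (big_ind vmax) => //; [apply: vmax0 | apply: vmaxD]. Qed.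
Lemma vunit_not_vmax x : vunit x -> ~ vmax x.
Proof. by case=> x0 _ hx [e|//]; rewrite e eqxx in x0. Qed.
Lemma val_ring_cases x : A x -> vmax x \/ vunit x.
Proof.
move=> hx; have [->|x0] := eqVneq x 0; first by do 2 left.
by have [h|h] := EM (A x^-1); [right | left; right].
Qed.
Lemma vunitDmax u m : vunit u -> vmax m -> vunit (u + m).
Proof.
move=> hu hm; have [h|//] : vmax (u + m) \/ vunit (u + m).
  by apply: val_ring_cases; apply: val_ringD; [case: hu | apply: vmax_A].
by case: (vunit_not_vmax hu); rewrite -(addrK m u); apply: vmaxB.
Qed.

(** The smallest valuation is attained twice: if x / y is in the maximal ideal, then
    z / y = - 1 - x / y is a unit. *)
Lemma sum0_vunit x y z : x + y + z = 0 -> x != 0 -> y != 0 -> z != 0 ->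
  [\/ vunit (x / y), vunit (x / z) | vunit (y / z)].
Proof.
move=> e x0 y0 z0.
have [h|] := val_ring_total hA (x / y).
  have [h'|h'] := val_ring_cases h; last by constructor 1.
  constructor 3; rewrite -[y / z]invf_div; apply: vunitV.
  have -> : z / y = - (1 + x / y).
    by apply/eqP; rewrite -subr_eq0; apply/eqP; transitivity ((x + y + z) / y); [field | rewrite e mul0r].
  exact/vunitN/vunitDmax/h'/vunit1.
rewrite invf_div => h; have [h'|h'] := val_ring_cases h; last first.
  by constructor 1; rewrite -[x / y]invf_div; apply: vunitV.
constructor 2; rewrite -[x / z]invf_div; apply: vunitV.
have -> : z / x = - (1 + y / x).
  by apply/eqP; rewrite -subr_eq0; apply/eqP; transitivity ((x + y + z) / x); [field | rewrite e mul0r].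
exact/vunitN/vunitDmax/h'/vunit1.
Qed.

End ValuationTheory.

(** * Quadratic towers *)

Section Towers.
Variable F : numFieldType.

(** The field obtained by adjoining successively the entries of l, the last one
    first; each entry is a square root of an element of the field before it when
    [tower_valid] holds. *)
Fixpoint tower (l : seq F) : F -> Prop :=
  if l is r :: l' then fun z => exists a b, [/\ tower l' a, tower l' b & z = a + b * r]
  else fun z => exists q : rat, z = ratr q.

Fixpoint tower_valid (l : seq F) : Prop :=
  if l is r :: l' then tower l' (r ^+ 2) /\ tower_valid l' else True.

Lemma tower_sub r l z : is_subfield (tower l) -> tower l z -> tower (r :: l) z.
Proof. by move=> h hz; exists z, 0; split; rewrite ?mul0r ?addr0 //; apply: subfield0. Qed.

(** For inverses: if the norm c^2 - d^2 r^2 vanishes and d does not, then r = c / d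
    up to sign is already in the smaller field. *)
Lemma tower_subfield l : tower_valid l -> is_subfield (tower l).
Proof.
elim: l => [_|r l IHl [hr /IHl hK]] /=.
  split; first by exists 1; rewrite rmorph1.
    by move=> _ _ [q ->] [s ->]; exists (q - s); rewrite rmorphB.
  by move=> _ _ [q ->] [s ->]; exists (q / s); rewrite fmorph_div.
have [rl|rl] := EM (tower l r).
  have e z : tower (r :: l) z <-> tower l z.
    split; last exact: tower_sub.
    by case=> a [b [ha hb ->]]; subfield_closed hK.
  split; first by apply/e/(subfield1 hK).
    by move=> x y /e hx /e hy; apply/e/(subfieldB hK).
  by move=> x y /e hx /e hy; apply/e/(subfield_div hK).
split; first by exists 1, 0; split; rewrite ?mul0r ?addr0 //; [apply: subfield1 | apply: subfield0].
  move=> _ _ [a [b [ha hb ->]]] [c [d [hc hd ->]]].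
  by exists (a - c), (b - d); split; [subfield_closed hK | subfield_closed hK | ring].
move=> _ _ [a [b [ha hb ->]]] [c [d [hc hd ->]]].
pose N := c ^+ 2 - d ^+ 2 * r ^+ 2.
have hN : tower l N by rewrite /N; subfield_closed hK.
have [N0|N0] := eqVneq N 0.
  have [d0|d0] := eqVneq d 0.
    have c0 : c = 0.
      by move/eqP: N0; rewrite /N d0 expr0n mul0r subr0 sqrf_eq0 => /eqP.
    exists 0, 0; rewrite c0 d0 !mul0r addr0 invr0 mulr0.
    by split => //; apply: subfield0.
  have hcd : tower l (c / d) by subfield_closed hK.
  have : (r - c / d) * (r + c / d) = 0.
    by rewrite -subr_sqr expr_div_n (subr0_eq N0); field.
  move/eqP; rewrite mulf_eq0 => /orP[]; rewrite ?subr_eq0 ?addr_eq0 => /eqP er; case: rl; rewrite er //.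
  exact: subfieldN.
exists ((a * c - b * d * r ^+ 2) / N), ((b * c - a * d) / N).
split; try by subfield_closed hK.
have cd0 : c + d * r != 0.
  by apply: contraNneq N0 => e; rewrite /N -exprMn subr_sqr e mulr0.
by move: N0; rewrite /N => N0; field; rewrite exprMn N0.
Qed.

Lemma tower_catr l l' z :
  tower_valid l' -> tower_valid (l ++ l') -> tower l' z -> tower (l ++ l') z.
Proof.
move=> vl'; elim: l => //= r l IHl [_ vl] hz.
by apply: tower_sub; [apply: tower_subfield | apply: IHl].
Qed.

Lemma tower_catl l l' : tower_valid l -> tower_valid l' ->
  tower_valid (l ++ l') /\ forall z, tower l z -> tower (l ++ l') z.
Proof.
move=> + vl'; elim: l => [_|r l IHl /= [hr vl]].
  by split=> // _ [q ->]; elim: l' vl' => [|r l' IHl' [_ vl]] /=;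
    [exists q | apply: tower_sub; [apply: tower_subfield | apply: IHl']].
have [vll sll] := IHl vl; split; first by split=> //; apply: sll.
by move=> _ [a [b [ha hb ->]]]; exists a, b; split=> //; apply: sll.
Qed.

Definition in_tower z := exists2 l, tower_valid l & tower l z.

Lemma in_tower_common x y : in_tower x -> in_tower y ->
  exists l, [/\ tower_valid l, tower l x & tower l y].
Proof.
move=> [l vl hx] [l' vl' hy]; have [v h] := tower_catl vl vl'.
by exists (l ++ l'); split => //; [apply: h | apply: tower_catr].
Qed.

Lemma in_tower_subfield : is_subfield in_tower.
Proof.
split; first by exists [::] => //; exists 1; rewrite rmorph1.
  move=> x y hx /(in_tower_common hx)[l [vl lx ly]]; exists l => //.
  exact: (subfieldB (tower_subfield vl)).
move=> x y hx /(in_tower_common hx)[l [vl lx ly]]; exists l => //.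
exact: (subfield_div (tower_subfield vl)).
Qed.

Lemma in_tower_sqrt : sqrt_closed in_tower.
Proof.
move=> z [l vl hz]; exists (z :: l) => //; have hK := tower_subfield vl.
by exists 0, 1; split; [apply: subfield0 | apply: subfield1 | rewrite mul1r add0r].
Qed.

Lemma in_tower_map (f : {rmorphism F -> F}) z : in_tower z -> in_tower (f z).
Proof.
have h l y : tower l y -> tower (map f l) (f y).
  elim: l y => [|r l IHl] y /=; first by case=> q ->; exists q; rewrite fmorph_rat.
  case=> a [b [ha hb ->]]; exists (f a), (f b).
  by split; [apply: IHl | apply: IHl | rewrite rmorphD rmorphM].
case=> l vl hz; exists (map f l); last exact: h.
by elim: l vl {hz} => //= r l IHl [hr vl]; split; [rewrite -rmorphXn; apply: h | apply: IHl].
Qed.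

End Towers.

Lemma constructible_in_tower (R : realType) (z : R[i]) :
  constructible z -> in_tower (z : R[i] : numFieldType).
Proof.
apply: (@constructible_sub R (@in_tower (R[i] : numClosedFieldType))).
- exact: in_tower_subfield.
- exact: in_tower_sqrt.
- by move=> x; apply: (in_tower_map Num.conj).
Qed.

(** * Ramification in quadratic towers *)

Section Ramification.
Variables (F : numFieldType) (A : F -> Prop) (p : nat).
Hypotheses (hA : valuation_ring A) (p_pr : prime p) (npV : ~ A p%:R^-1).

Local Notation vunit := (vunit A).
Local Notation vmax := (vmax A).

Lemma vmax_p : vmax p%:R. Proof. by right. Qed.

Lemma p_neq0 : p%:R != 0 :> F.
Proof. by rewrite pnatr_eq0 -lt0n prime_gt0. Qed.

(** By Bezout, n has an inverse modulo p, and 1 + b p is a unit. *)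
Lemma vunit_coprime n : coprime n p -> vunit n%:R.
Proof.
have [->|n0] := posnP n.
  by rewrite /coprime gcd0n => /eqP p1; have := p_pr; rewrite p1.
move=> /(coprimeP p n0)[[a b] /= e].
have hu : vunit (n%:R * a%:R).
  rewrite -natrM mulnC (_ : a * n = 1 + b * p)%N; last first.
    by rewrite -e subnK // ltnW // -subn_gt0 e.
  rewrite natrD natrM; apply: (vunitDmax hA (vunit1 hA)).
  exact: (vmaxMl hA (val_ring_nat hA b) vmax_p).
have nz : n%:R != 0 :> F by rewrite pnatr_eq0 -lt0n.
split=> //; first exact: val_ring_nat.
have [h _ h'] := hu; have -> : n%:R^-1 = a%:R * (n%:R * a%:R)^-1 :> F.
  rewrite invfM mulrCA mulfV ?mulr1 //; apply: contraNneq h => ->; by rewrite mulr0.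
by apply: (val_ringM hA) => //; apply: val_ring_nat.
Qed.

Lemma vmax_int (k : int) : vmax k%:~R -> (p %| `|k|)%N.
Proof.
move=> h; apply/negPn/negP; rewrite -prime_coprime // coprime_sym => /vunit_coprime hu.
apply: (vunit_not_vmax hu); case: k h {hu} => n //=.
by rewrite NegzE mulrNz => /(vmaxN hA); rewrite opprK.
Qed.

Lemma vunit_int (k : int) : ~~ (p %| `|k|)%N -> vunit k%:~R.
Proof.
by move=> /negP nk; case: (val_ring_cases (val_ring_int hA k)) => // /vmax_int.
Qed.

Lemma int_valuation (k : int) : k != 0 -> exists j : int, vunit (k%:~R * p%:R ^ j).
Proof.
have hn n : (0 < n)%N -> exists j : int, vunit (n%:R * p%:R ^ j).
  move=> n0; have [m cpm e] := pfactor_coprime p_pr n0.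
  exists (- (logn p n)%:Z); rewrite {1}e natrM natrX -exprnN -mulrA mulfV ?mulr1.
    by apply: vunit_coprime; rewrite coprime_sym.
  by rewrite expf_neq0 // p_neq0.
case: k => n n0; first by apply: hn; rewrite lt0n.
have [j hj] := hn n.+1 isT; exists j; rewrite NegzE mulrNz mulNr; exact: (vunitN hA).
Qed.

Lemma rat_valuation (q : rat) : q != 0 -> exists j : int, vunit (ratr q * p%:R ^ j).
Proof.
move=> q0; have [j hj] : exists j : int, vunit ((numq q)%:~R * p%:R ^ j).
  by apply: int_valuation; rewrite numq_eq0.
have [k hk] := int_valuation (denq_neq0 q).
exists (j - k); rewrite expfzDr ?p_neq0 // -invr_expz.
have := vunitM hA hj (vunitV hk).
by rewrite /ratr invfM mulrACA.
Qed.

(** Each b is a root of some X^2 + u X + v over the previous field, and two of the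
    three terms have the same valuation, so that 2 v(b) is the valuation of an
    element of that field. *)
Lemma tower_valuation l b : tower_valid l -> tower l b -> b != 0 ->
  exists j : int, vunit (b ^+ (2 ^ size l) * p%:R ^ j).
Proof.
elim: l b => [|r l IHl] b; first by move=> _ [q ->]; rewrite fmorph_eq0 expr1; apply: rat_valuation.
move=> /= [hr vl] [c [d [hc hd eb]]] b0; have hK := tower_subfield vl.
suff [g [hg g0 hu]] : exists g, [/\ tower l g, g != 0 & vunit (b ^+ 2 / g)].
  have [j hj] := IHl g vl hg g0; exists j.
  rewrite expnS exprM; have := vunitM hA (vunitX hA (2 ^ size l) hu) hj.
  rewrite expr_div_n mulrA divfK // expf_neq0 //.
pose u := - 2 * c; pose v := c ^+ 2 - d ^+ 2 * r ^+ 2.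
have hu : tower l u by rewrite /u; subfield_closed hK.
have hv : tower l v by rewrite /v; subfield_closed hK.
have e : b ^+ 2 + u * b + v = 0 by rewrite eb /u /v; ring.
have b20 : b ^+ 2 != 0 by rewrite expf_neq0.
have [u0|u0] := eqVneq u 0.
  exists (- v); have ev : - v = b ^+ 2 by move: e; rewrite u0 mul0r addr0 => /eqP; rewrite addr_eq0 => /eqP.
  by rewrite ev mulfV //; split; [rewrite -ev; apply: subfieldN | | apply: vunit1].
have [v0|v0] := eqVneq v 0.
  exists (u ^+ 2); rewrite expf_neq0 // -expr_div_n.
  have -> : b = - u.
    apply/eqP; rewrite -addr_eq0; apply/eqP/(mulIf b0).
    by rewrite mul0r mulrDl -expr2 -[RHS]e v0 addr0.
  by rewrite mulNr mulfV // sqrrN expr1n; split; [apply: subfieldX | | apply: vunit1].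
have ub0 : u * b != 0 by rewrite mulf_neq0.
case: (sum0_vunit hA e b20 ub0 v0) => h.
- exists (u ^+ 2); split; [exact: subfieldX | by rewrite expf_neq0 |].
  by rewrite -expr_div_n; apply: (vunitX hA); move: h; congr vunit; field; rewrite u0 b0.
- by exists v.
- exists ((v / u) ^+ 2); split; [by subfield_closed hK | by rewrite expf_neq0 // mulf_neq0 // invr_eq0|].
  by rewrite -expr_div_n; apply: (vunitX hA); move: h; congr vunit; field; rewrite u0 v0.
Qed.
End Ramification.

(** * Edwards coordinates near the origin *)

Section Edwards.
Variable F : numClosedFieldType.
Implicit Types P Q : lem_point F.
Local Notation i := ('i : F).

Definition lem_s P : F := if lem_val P is Affine x y then (1 + i) * x / y else 0.
Definition lem_c P : F := if lem_val P is Affine x y then (x - i) / (x + i) else 1.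

Let sqri : i ^+ 2 = -1. Proof. exact: sqrCi. Qed.

Lemma lem_eq x y : on_curve (-1) 0 (Affine x y) -> y ^+ 2 = x ^+ 3 - x :> F.
Proof. by move=> /= ->; ring. Qed.

(** The Edwards addition law, with denominators cleared so as to ask nothing of the
    third point. *)
Lemma edwards_chord (x1 y1 x2 y2 : F) :
  y1 ^+ 2 = x1 ^+ 3 - x1 -> y2 ^+ 2 = x2 ^+ 3 - x2 ->
  y1 != 0 -> y2 != 0 -> x1 + i != 0 -> x2 + i != 0 -> x2 - x1 != 0 ->
  let s1 := (1 + i) * x1 / y1 in let c1 := (x1 - i) / (x1 + i) in
  let s2 := (1 + i) * x2 / y2 in let c2 := (x2 - i) / (x2 + i) in
  let l := (y2 - y1) / (x2 - x1) in let x3 := l ^+ 2 - x1 - x2 in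
  let y3 := l * (x1 - x3) - y1 in
  (c1 * c2 - s1 * s2) * (x3 + i) = (x3 - i) * (1 + s1 * s2 * c1 * c2) /\
  (s1 * c2 + c1 * s2) * y3 = (1 + i) * x3 * (1 - s1 * s2 * c1 * c2).
Proof.
move=> h1 h2 y10 y20 x10 x20 d /=; split; by field: sqri h1 h2; rewrite ?y10 ?y20 ?x10 ?x20 ?d.
Qed.

Lemma edwards_tangent (x1 y1 : F) : y1 ^+ 2 = x1 ^+ 3 - x1 -> y1 != 0 -> x1 + i != 0 ->
  let s1 := (1 + i) * x1 / y1 in let c1 := (x1 - i) / (x1 + i) in
  let l := (3 * x1 ^+ 2 + -1) / (2 * y1) in let x3 := l ^+ 2 - x1 - x1 in
  let y3 := l * (x1 - x3) - y1 in
  (c1 * c1 - s1 * s1) * (x3 + i) = (x3 - i) * (1 + s1 * s1 * c1 * c1) /\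
  (s1 * c1 + c1 * s1) * y3 = (1 + i) * x3 * (1 - s1 * s1 * c1 * c1).
Proof. move=> h1 y10 x10 /=; split; by field: sqri h1; rewrite ?y10 ?x10. Qed.

Lemma edwards_curve (x y : F) : y ^+ 2 = x ^+ 3 - x -> y != 0 -> x + i != 0 ->
  let s := (1 + i) * x / y in let c := (x - i) / (x + i) in
  s ^+ 2 + c ^+ 2 + s ^+ 2 * c ^+ 2 = 1.
Proof. by move=> h y0 x0 /=; field: sqri h; rewrite y0 x0. Qed.

Variable A : F -> Prop.
Hypotheses (hA : valuation_ring A) (u2 : vunit A 2).
Local Notation vmax := (vmax A).
Local Notation vunit := (vunit A).

(** The kernel of reduction modulo the maximal ideal of A. *)
Definition formal_point P := if lem_val P is Affine x y then ~ A x else True.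
Local Notation formal := formal_point.

Lemma val_ring_i : A i.
Proof.
have : A i \/ A i^-1 by apply: val_ring_total.
by rewrite invCi => -[//|/(val_ringN hA)]; rewrite opprK.
Qed.

Lemma vunit_i : vunit i.
Proof.
by split; [apply: neq0Ci | apply: val_ring_i | rewrite invCi; apply/(val_ringN hA)/val_ring_i].
Qed.

(** As 1 / x is in the maximal ideal, y^2 = x^3 (1 - x^-2) makes s^2 equal to
    2 i / x up to a unit, while x + i is x up to a unit. *)
Lemma formal_affine (x y : F) : y ^+ 2 = x ^+ 3 - x -> ~ A x ->
  [/\ y != 0, x + i != 0, vmax ((1 + i) * x / y) & vmax ((x - i) / (x + i) - 1)].
Proof.
move=> h nx; have x0 : x != 0.
  by apply/eqP => x0; apply: nx; rewrite x0; apply: (val_ring0 hA).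
have mx : vmax x^-1 by right; rewrite invrK.
have hu : vunit (1 + i * x^-1).
  by apply: (vunitDmax hA (vunit1 hA)); apply: (vmaxMl hA val_ring_i mx).
have hv : vunit (1 - x^-1 ^+ 2).
  by apply: (vunitDmax hA (vunit1 hA)); apply/(vmaxN hA)/(vmaxX hA).
have [u0 _ uV] := hu; have [v0 _ vV] := hv.
have ey : y ^+ 2 = x ^+ 3 * (1 - x^-1 ^+ 2) by rewrite h; field.
have y0 : y != 0 by rewrite -sqrf_eq0 ey mulf_neq0 ?expf_neq0.
have ex : x + i = x * (1 + i * x^-1) by field.
have xi0 : x + i != 0 by rewrite ex mulf_neq0.
split=> //.
- set s := _ / y; have es : s ^+ 2 = 2 * i * (1 - x^-1 ^+ 2)^-1 * x^-1.
    have -> : s ^+ 2 = (1 + i) ^+ 2 * x ^+ 2 / y ^+ 2 by rewrite /s; field.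
    rewrite ey; move: v0; set w := 1 - _ => v0.
    by clearbody w; field: sqri; rewrite x0 v0.
  apply: (vmax_root hA (n := 2)); rewrite es; apply: (vmaxMl hA _ mx); apply: (val_ringM hA) => //.
  by apply: (val_ringM hA); [apply: (val_ring_nat hA 2) | apply: val_ring_i].
- have -> : (x - i) / (x + i) - 1 = - (2 * i * (1 + i * x^-1)^-1 * x^-1).
    by rewrite ex; field; rewrite x0.
  apply/(vmaxN hA)/(vmaxMl hA _ mx)/(val_ringM hA) => //.
  by apply: (val_ringM hA); [apply: (val_ring_nat hA 2) | apply: val_ring_i].
Qed.

Lemma lem_val_eq P x y : lem_val P = Affine x y -> y ^+ 2 = x ^+ 3 - x.
Proof. by move=> e; apply: lem_eq; rewrite -e; apply: on_lem. Qed.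

Lemma formal_spec P : formal P ->
  [/\ vmax (lem_s P), vmax (lem_c P - 1)
    & lem_s P ^+ 2 + lem_c P ^+ 2 + lem_s P ^+ 2 * lem_c P ^+ 2 = 1].
Proof.
rewrite /formal_point /lem_s /lem_c; case e: (lem_val P) => [|x y].
  by rewrite subrr expr0n mul0r expr1n addr0 add0r => _; split=> //; apply: vmax0.
have h := lem_val_eq e; move=> nx; have [y0 x0 hs hc] := formal_affine h nx.
by split=> //; apply: edwards_curve.
Qed.

Lemma vunit_c P : formal P -> vunit (lem_c P).
Proof.
by case/formal_spec => _ hc _; rewrite -(subrK 1 (lem_c P)) addrC; apply: (vunitDmax hA (vunit1 hA)).
Qed.

Lemma vmax_prod P Q : formal P -> formal Q -> vmax (lem_s P * lem_s Q * lem_c P * lem_c Q).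
Proof.
move=> hP hQ; have [_ cP _] := vunit_c hP; have [_ cQ _] := vunit_c hQ.
have [sP _ _] := formal_spec hP; have [/vmax_A sQ _ _] := formal_spec hQ.
by do 3![apply: (vmaxMr hA) => //]; apply: sQ.
Qed.

Lemma vunit_den P Q : formal P -> formal Q ->
  vunit (1 - lem_s P * lem_s Q * lem_c P * lem_c Q) /\
  vunit (1 + lem_s P * lem_s Q * lem_c P * lem_c Q).
Proof.
move=> hP hQ; have h := vmax_prod hP hQ.
by split; apply: (vunitDmax hA (vunit1 hA)) => //; apply: vmaxN.
Qed.

(** If x were integral, c (x + i) = x - i would put the unit i (c + 1) in the
    maximal ideal. *)
Lemma formal_coords R (s c : F) : vmax (c - 1) ->
  (forall x y, lem_val R = Affine x y -> c * (x + i) = x - i /\ s * y = (1 + i) * x) ->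
  (lem_val R = Infinity -> s = 0 /\ c = 1) -> [/\ formal R, lem_s R = s & lem_c R = c].
Proof.
rewrite /formal_point /lem_s /lem_c => hc; case e: (lem_val R) => [|x y] h h0.
  by have [-> ->] := h0 erefl.
have [h1 h2] := h _ _ erefl; have hxy := lem_val_eq e.
have nx : ~ A x.
  move=> hx; have uc : vunit (i * (c + 1)).
    apply: (vunitM hA vunit_i); rewrite (_ : c + 1 = 2 + (c - 1)); last by ring.
    exact: vunitDmax.
  apply: (vunit_not_vmax uc); rewrite (_ : i * _ = - (c - 1) * x).
    by apply: (vmaxMr hA hx); apply: (vmaxN hA hc).
  apply/eqP; rewrite -subr_eq0; apply/eqP; transitivity (c * (x + i) - (x - i)); first by ring.
  by rewrite h1 subrr.
have [y0 x0 _ _] := formal_affine hxy nx.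
by split=> //; [rewrite -h2 mulfK | rewrite -h1 mulfK].
Qed.

(** The Edwards addition law has no exceptional case here, as its denominators are
    units. *)
Lemma formal_add P Q : formal P -> formal Q ->
  [/\ formal (P + Q),
    lem_s (P + Q) = (lem_s P * lem_c Q + lem_c P * lem_s Q)
      / (1 - lem_s P * lem_s Q * lem_c P * lem_c Q)
  & lem_c (P + Q) = (lem_c P * lem_c Q - lem_s P * lem_s Q)
      / (1 + lem_s P * lem_s Q * lem_c P * lem_c Q)].
Proof.
move=> hP hQ; have [[D1 _ _] [D2 _ D2V]] := vunit_den hP hQ.
have [sP cP eP] := formal_spec hP; have [sQ cQ eQ] := formal_spec hQ.
have [_ AcQ _] := vunit_c hQ; have hm := vmax_prod hP hQ.
have hc3 : vmax ((lem_c P * lem_c Q - lem_s P * lem_s Q)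
                 / (1 + lem_s P * lem_s Q * lem_c P * lem_c Q) - 1).
  rewrite -[1 in X in _ - X](mulfV D2) -mulrBl; apply: (vmaxMr hA) => //.
  rewrite opprD addrA; apply: (vmaxB hA) => //.
  rewrite addrAC; apply: (vmaxB hA); last by apply: (vmaxMr hA) => //; apply: vmax_A.
  rewrite (_ : _ - 1 = (lem_c P - 1) * lem_c Q + (lem_c Q - 1)); last by ring.
  by apply: (vmaxD hA) => //; apply: (vmaxMr hA).
apply: formal_coords => // [x y e|e].
  suff [h1 h2] : (lem_c P * lem_c Q - lem_s P * lem_s Q) * (x + i)
      = (x - i) * (1 + lem_s P * lem_s Q * lem_c P * lem_c Q) /\
    (lem_s P * lem_c Q + lem_c P * lem_s Q) * y
      = (1 + i) * x * (1 - lem_s P * lem_s Q * lem_c P * lem_c Q).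
    by split; rewrite mulrAC ?h1 ?h2 mulfK.
  move: hP hQ e; rewrite lem_valD /formal_point /lem_s /lem_c.
  case vP: (lem_val P) => [|x1 y1]; case vQ: (lem_val Q) => [|x2 y2] //=.
  - move=> _ nx [<- <-]; have [y0 x0 _ _] := formal_affine (lem_val_eq vQ) nx.
    by split; field; rewrite ?x0 ?y0.
  - move=> nx _ [<- <-]; have [y0 x0 _ _] := formal_affine (lem_val_eq vP) nx.
    by split; field; rewrite ?x0 ?y0.
  move=> nx1 nx2; have hx1 := lem_val_eq vP; have hx2 := lem_val_eq vQ.
  have [y10 x10 _ _] := formal_affine hx1 nx1.
  have [y20 x20 _ _] := formal_affine hx2 nx2.
  case: eqVneq => [ex|nx].
    subst x2; case: eqVneq => // ny.
    have ey : y2 = y1.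
      have /eqP : y1 ^+ 2 = y2 ^+ 2 by rewrite hx1 hx2.
      by rewrite eqf_sqr (negPf ny) orbF => /eqP.
    by subst y2; case=> <- <-; apply: edwards_tangent.
  case=> <- <-; apply: edwards_chord => //.
  by rewrite subr_eq0 eq_sym.
have -> : Q = - P by apply/eqP; rewrite -addr_eq0 addrC; apply/eqP/val_inj.
have -> : lem_s (- P) = - lem_s P.
  rewrite /lem_s lem_valN; case: (lem_val P) => [|x y] /=; first by rewrite oppr0.
  by rewrite invrN mulrN.
have -> : lem_c (- P) = lem_c P by rewrite /lem_c lem_valN; case: (lem_val P).
split; first by rewrite (_ : _ + _ = 0) ?mul0r //; ring.
have hden : 1 + lem_s P * - lem_s P * lem_c P * lem_c P != 0.
  have hN : formal (- P).
    by move: hP; rewrite /formal_point lem_valN; case: (lem_val P).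
  have [_ []] := vunit_den hP hN.
  by rewrite /lem_s /lem_c lem_valN; case: (lem_val P) => [|x y] /=;
    rewrite ?oppr0 // invrN mulrN.
rewrite -[RHS](mulfV hden); congr (_ / _).
by rewrite -[X in _ = X + _]eP; ring.
Qed.
End Edwards.

(** * Roots in the maximal ideal *)

Section Congruence.
Variables (F : fieldType) (A : F -> Prop).
Hypothesis hA : valuation_ring A.
Local Notation vmax := (vmax A).
Local Notation vunit := (vunit A).

Definition val_cong x y := vmax (x - y).
Local Notation vcong := val_cong.

Lemma vcong_refl x : vcong x x.
Proof. by rewrite /val_cong subrr; apply: vmax0. Qed.
Lemma vcong_sym x y : vcong x y -> vcong y x.
Proof. by rewrite /val_cong -[x - y]opprB => /(vmaxN hA); rewrite opprK. Qed.
Lemma vcong_trans y x z : vcong x y -> vcong y z -> vcong x z.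
Proof. by move=> h /(vmaxD hA h); rewrite addrA subrK. Qed.
Lemma vcong_A x y : vcong x y -> A y -> A x.
Proof. by move=> /(vmax_A hA) h hy; rewrite -(subrK y x); apply: (val_ringD hA). Qed.
Lemma vcongD x y x' y' : vcong x y -> vcong x' y' -> vcong (x + x') (y + y').
Proof. by move=> h /(vmaxD hA h); rewrite /val_cong opprD addrACA. Qed.
Lemma vcongM x y x' y' : A y -> A y' -> vcong x y -> vcong x' y' -> vcong (x * x') (y * y').
Proof.
move=> hy hy' h h'; have hx' := vcong_A h' hy'.
rewrite /val_cong (_ : _ - _ = (x - y) * x' + y * (x' - y')); last by ring.
by apply: (vmaxD hA); [apply: (vmaxMr hA) | apply: (vmaxMl hA)].
Qed.
Lemma vcongX x y n : A y -> vcong x y -> vcong (x ^+ n) (y ^+ n).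
Proof.
move=> hy h; elim: n => [|n IHn]; first exact: vcong_refl.
by rewrite !exprS; apply: vcongM => //; apply: val_ringX.
Qed.
Lemma vcong_unit x y : vcong x y -> vunit y -> vunit x.
Proof. by move=> h hy; rewrite -(subrK y x) addrC; apply: (vunitDmax hA). Qed.
Lemma vcong_div1 x y b : A y -> vcong x y -> vcong b 1 -> vcong (x / b) y.
Proof.
move=> hy h hb; have [b0 hbA hbV] := vcong_unit hb (vunit1 hA).
rewrite /val_cong (_ : _ - _ = (x - y - y * (b - 1)) * b^-1); last by field.
by apply: (vmaxMr hA) => //; apply: (vmaxB hA) => //; apply: (vmaxMl hA).
Qed.

Implicit Types f g : {poly F}.

Lemma horner_vcong f x : (forall j, A f`_j) -> vmax x -> vcong f.[x] f`_0.
Proof.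
move=> hf hx; rewrite /val_cong (horner_coef_wide _ (leqnSn _)) big_ord_recl expr0 mulr1 addrC addKr.
apply: (vmax_sum hA) => i _; apply: (vmaxMl hA) => //.
by apply: (vmaxX hA).
Qed.

Lemma horner_take_drop f q x : f.[x] = (take_poly q f).[x] + (drop_poly q f).[x] * x ^+ q.
Proof. by rewrite -{1}(poly_take_drop q f) hornerD hornerM hornerXn. Qed.
End Congruence.

Section SmallRoot.
Variables (F : closedFieldType) (A : F -> Prop).
Hypothesis hA : valuation_ring A.
Local Notation vmax := (vmax A).
Local Notation vunit := (vunit A).

(** A corner of the Newton polygon.  If no root were in the maximal ideal, f would
    be its constant term times a product of factors 1 - X / r with integral
    coefficients, and its q-th coefficient would not be a unit.  At a root r in the
    maximal ideal, the terms of degree 0 and q dominate and must cancel. *)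
Lemma small_root (f : {poly F}) (q : nat) : f`_0 != 0 -> vmax f`_0 ->
  (forall j, A f`_j) -> (forall j, (j < q)%N -> A (f`_j / f`_0)) -> vunit f`_q ->
  exists r, [/\ root f r, vmax r & vunit (r ^+ q / f`_0)].
Proof.
move=> f0 mf0 hf hlow hq.
have [r rf mr] : exists2 r, root f r & vmax r.
  apply: contrapT => nor.
  have [rs ef] := closed_field_poly_normal f.
  have lf0 : lead_coef f != 0.
    by rewrite lead_coef_eq0; apply: contraNneq f0 => ->; rewrite coef0.
  have hrs r : r \in rs -> r != 0 /\ A r^-1.
    move=> hr; have rr : root f r by rewrite ef rootZ // root_prod_XsubC.
    have nm : ~ vmax r by move=> mr; apply: nor; exists r.
    split; first by apply/eqP => r0; apply: nm; left.
    by apply: contrapT => nr; apply: nm; right.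
  have [g hg eg] : exists2 g : {poly F}, (forall j, A g`_j) &
     \prod_(r <- rs) ('X - r%:P) = (\prod_(r <- rs) ('X - r%:P))`_0 *: g.
    elim: rs hrs {ef} => [_|r rs IHrs hrs].
      exists 1; last by rewrite big_nil coef1 scale1r.
      by move=> j; rewrite coef1; case: eqP => _; [apply: val_ring1 | apply: val_ring0].
    have [g hg eg] := IHrs (fun x hx => hrs x (mem_behead (s := r :: rs) hx)).
    have [r0 hr] := hrs r (mem_head _ _).
    exists ((1 - r^-1 *: 'X) * g).
      move=> j; rewrite coefM; apply: (val_ring_sum hA) => k _; apply: (val_ringM hA) => //.
      rewrite coefB coefZ coefX coef1; apply: (val_ringB hA).
        by case: eqP => _; [apply: val_ring1 | apply: val_ring0].
      by case: eqP => _; rewrite ?mulr1 ?mulr0 //; apply: val_ring0.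
    have er : 'X - r%:P = - r *: (1 - r^-1 *: 'X).
      rewrite scalerBr scalerA mulNr mulfV // scaleN1r opprK addrC; congr (_ + _).
      by rewrite scaleNr alg_polyC.
    rewrite big_cons {1}eg; set c := _`_0.
    rewrite coefM big_ord1 coefB coefX coefC /= sub0r -/c er.
    by rewrite -scalerAl -scalerAr scalerA.
  apply: (vunit_not_vmax hq); have e0 : f`_0 = lead_coef f * (\prod_(r <- rs) ('X - r%:P))`_0.
    by rewrite {1}ef coefZ.
  have -> : f`_q = f`_0 * g`_q by rewrite e0 {1}ef coefZ {1}eg coefZ mulrA.
  exact: (vmaxMr hA).
exists r; split=> //; have hr := vmax_A hA mr.
have r0 : r != 0.
  by apply: contraNneq f0 => r0; move: rf; rewrite r0 /root horner_coef0 => /eqP->.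
pose t := (f`_0)^-1 *: take_poly q f.
have [q0|q0] := posnP q; first by case: (vunit_not_vmax hq); rewrite q0.
have ut : vunit t.[r].
  apply: (vcong_unit hA) (vunit1 hA); have -> : 1 = t`_0.
    by rewrite coefZ coef_take_poly q0 mulVf.
  apply: (horner_vcong hA) => // j; rewrite coefZ coef_take_poly mulrC.
  by case: ifP => [/hlow //|_]; rewrite mul0r; apply: val_ring0.
have ud : vunit (drop_poly q f).[r].
  apply: (vcong_unit hA) hq; have -> : f`_q = (drop_poly q f)`_0 by rewrite coef_drop_poly.
  by apply: (horner_vcong hA) => // j; rewrite coef_drop_poly.
have e : r ^+ q / f`_0 = - t.[r] / (drop_poly q f).[r].
  move/eqP: rf; rewrite (horner_take_drop f q) /t hornerZ => e.
  have [d0 _ _] := ud; apply: (mulIf d0); rewrite divfK //.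
  apply: (mulfI f0); rewrite mulrN mulVKf // mulrA mulrCA mulfV // mulr1 mulrC.
  by apply/eqP; rewrite -addr_eq0 addrC e.
by rewrite e; apply: (vunitM hA); [apply: (vunitN hA) | apply: vunitV].
Qed.
End SmallRoot.

(** * Odd multiples in Edwards coordinates *)

Section OddMultiples.

(** One step adds 2 P, where s(2 P) = 2 s c (1 + u) / (1 + u^2) and
    c(2 P) = (1 - 2 u - u^2) / (1 + 2 u - u^2) for u = s^2; the factors c^2 that
    appear are replaced by (1 - u) / (1 + u). *)
Definition odd_step (t : {poly int} * {poly int} * {poly int} * {poly int}) :=
  let: (a, b, e, g) := t in
  let al := 1 + 'X ^+ 2 in
  let be := 1 + 2 *: 'X - 'X ^+ 2 in
  let be' := 1 - 2 *: 'X - 'X ^+ 2 in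
  (al * be' * a * g + 2 *: (1 - 'X) * be * e * b,
   al * be * b * g - 2 *: 'X * (1 - 'X) * be' * a * e,
   al * be' * e * b - 2 *: 'X * (1 + 'X) * be * a * g,
   al * be * b * g + 2 *: 'X * (1 - 'X) * be' * a * e).

(** For m = 2 k + 1 and u = s^2, the four components (a, b, e, g) satisfy
    s(m P) = s(P) a(u) / b(u) and c(m P) = c(P) e(u) / g(u). *)
Definition odd_mult k := iter k odd_step (1, 1, 1, 1).
Definition mult_a k := (odd_mult k).1.1.1.
Definition mult_b k := (odd_mult k).1.1.2.
Definition mult_e k := (odd_mult k).1.2.
Definition mult_g k := (odd_mult k).2.

Lemma odd_mult_at0 k : [/\ (mult_a k).[0] = k.*2.+1%:Z, (mult_b k).[0] = 1,
  (mult_e k).[0] = 1 & (mult_g k).[0] = 1].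
Proof.
rewrite /mult_a /mult_b /mult_e /mult_g; elim: k => [|k] /=; first by rewrite !hornerC.
case: (odd_mult k) => [[[a b] e] g] /= [ha hb he hg].
have -> : (k.+1).*2.+1%:Z = k.*2.+1%:Z + 2 by lia.
by rewrite !hornerE !(ha, hb, he, hg) /=; split; ring.
Qed.

(** The value at u = 1 is taken at the point (s, c) = (1, 0) of order 4, whose odd
    multiples are (1, 0) and (-1, 0): only powers of 2 occur, up to sign, in a(1),
    b(1) and g(1).  So multiplication by p does not vanish modulo p. *)
Lemma odd_mult_at1 p k : prime p -> odd p -> ~~ (p %| `|(mult_a k).[1]|)%N.
Proof.
move=> p_pr p_odd.
suff [] : [/\ ~~ (p %| `|(mult_a k).[1]|)%N, ~~ (p %| `|(mult_b k).[1]|)%N &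
  ~~ (p %| `|(mult_g k).[1]|)%N] by [].
have p1 : ~~ (p %| 1)%N by rewrite dvdn1; apply: contraTneq p_pr => ->.
have p4 : ~~ (p %| 4)%N.
  by rewrite -[4%N]/(2 ^ 2)%N Euclid_dvdX // dvdn_prime2 // andbT; apply: contraTneq p_odd => ->.
rewrite /mult_a /mult_b /mult_g; elim: k => [|k] /=; first by rewrite !hornerC.
case: (odd_mult k) => [[[a b] e] g] /= [ha hb hg].
have [v1 v2 v3] : [/\ (1 + 'X ^+ 2).[1] = 2 :> int, (1 + 2 *: 'X - 'X ^+ 2).[1] = 2 :> int
  & (1 - 2 *: 'X - 'X ^+ 2).[1] = -2 :> int] by rewrite !hornerE.
have v4 : (1 - 'X).[1] = 0 :> int by rewrite !hornerE subrr.
move: (1 + 'X ^+ 2) (1 + 2 *: 'X - 'X ^+ 2) (1 - 2 *: 'X - 'X ^+ 2) (1 - 'X)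
  v1 v2 v3 v4 => al be be' om v1 v2 v3 v4.
rewrite !hornerE v1 v2 v3 v4 !(mulr0, mul0r, addr0, subr0).
have d2 : ~~ (p %| 2)%N by apply: contra p4 => h; rewrite -[4%N]/(2 * 2)%N dvdn_mulr.
by rewrite !abszM !Euclid_dvdM // !negb_or d2 ha hb hg.
Qed.

End OddMultiples.

Section Formal.
Variables (F : numClosedFieldType) (A : F -> Prop).
Hypotheses (hA : valuation_ring A) (u2 : vunit A 2).
Local Notation vmax := (vmax A).
Local Notation vunit := (vunit A).
Local Notation vcong := (val_cong A).
Local Notation formal := (formal_point A).
Implicit Types P Q : lem_point F.
Local Notation i := ('i : F).

Definition ev (f : {poly int}) (x : F) : F := (map_poly intr f).[x].

Lemma evD f g x : ev (f + g) x = ev f x + ev g x.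
Proof. by rewrite /ev rmorphD hornerD. Qed.
Lemma evN f x : ev (- f) x = - ev f x.
Proof. by rewrite /ev rmorphN hornerN. Qed.
Lemma evM f g x : ev (f * g) x = ev f x * ev g x.
Proof. by rewrite /ev rmorphM hornerM. Qed.
Lemma ev1 x : ev 1 x = 1. Proof. by rewrite /ev rmorph1 hornerC. Qed.
Lemma evX x : ev 'X x = x. Proof. by rewrite /ev map_polyX hornerX. Qed.
Lemma ev2Z f x : ev (2 *: f) x = 2 * ev f x.
Proof. by rewrite /ev map_polyZ hornerZ /=. Qed.
Lemma evX2 x : ev ('X ^+ 2) x = x ^+ 2. Proof. by rewrite expr2 evM evX expr2. Qed.
Definition evE := (evD, evN, ev2Z, evM, ev1, evX2, evX).

Lemma coef_A f j : A (map_poly intr f : {poly F})`_j.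
Proof. by rewrite coef_map; apply: val_ring_int. Qed.

Lemma ev_vcong f x : vmax x -> vcong (ev f x) (f.[0])%:~R.
Proof.
move=> hx; have -> : (f.[0])%:~R = (map_poly intr f : {poly F})`_0 by rewrite coef_map horner_coef0.
by apply: (horner_vcong hA) => // j; apply: coef_A.
Qed.

Lemma formal_mulrn P n : formal P -> formal (P *+ n).
Proof.
move=> hP; elim: n => // n IHn; rewrite mulrS.
by have [] := formal_add hA u2 hP IHn.
Qed.

Lemma formal_s0 P : formal P -> lem_s P = 0 -> P = 0.
Proof.
rewrite /formal_point /lem_s; case e: (lem_val P) => [|x y]; first by move=> _ _; apply: val_inj.
move=> nx; have [y0 _ _ _] := formal_affine hA (lem_val_eq e) nx.
move/eqP; rewrite !mulf_eq0 invr_eq0 (negPf y0) orbF => /orP[|/eqP x0].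
  rewrite addr_eq0 -eqr_oppLR => /eqP h; have := sqrCi F.
  by rewrite -h sqrrN expr1n => /eqP; rewrite -subr_eq0 opprK -mulr2n pnatr_eq0.
by case: nx; rewrite x0; apply: val_ring0.
Qed.

(** Multiplication by k acts on the tangent space as k. *)
Lemma formal_mulrn_s P k : formal P ->
  exists2 m, vcong m k%:R & lem_s (P *+ k) = lem_s P * m.
Proof.
move=> hP; elim: k => [|k [m hm IHk]].
  by exists 0; rewrite ?mulr0 //; apply: vcong_refl.
have hk := formal_mulrn k hP; have [_ hs _] := formal_add hA u2 hP hk.
have [_ cP _] := formal_spec hA hP; have [_ ck _] := formal_spec hA hk.
rewrite [P *+ _]mulrS hs; set d := 1 - _; rewrite IHk.
exists ((lem_c (P *+ k) + lem_c P * m) / d); last by ring.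
have hA1 := val_ring1 hA; have hAk := val_ring_nat hA k.
apply: (vcong_div1 hA); first exact: val_ring_nat.
  rewrite -natr1 addrC -[X in vcong _ (X + _)]mul1r.
  by apply: (vcongD hA) => //; apply: (vcongM hA).
rewrite /val_cong /d addrAC subrr add0r; apply/(vmaxN hA)/(vmax_prod hA) => //.
Qed.

(** The coordinate s determines c^2, and exactly one of the two square roots is
    congruent to 1. *)
Lemma formal_lift s : vmax s -> exists2 P, formal P & lem_s P = s.
Proof.
move=> ms; have [->|s0] := eqVneq s 0; first by exists 0; rewrite // /lem_s.
have A1 := val_ring1 hA; have As := vmax_A hA ms.
have ms2 : vmax (s ^+ 2) by apply: (vmaxX hA).
have ud : vunit (1 + s ^+ 2) by apply: (vunitDmax hA (vunit1 hA)).
have [d0 _ dV] := ud.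
have [c ec mc] : exists2 c, c ^+ 2 = (1 - s ^+ 2) / (1 + s ^+ 2) & vmax (c - 1).
  pose c := sqrtC ((1 - s ^+ 2) / (1 + s ^+ 2)); have ec := sqrtCK ((1 - s ^+ 2) / (1 + s ^+ 2)).
  have mp : vmax ((c - 1) * (c + 1)).
    rewrite (_ : _ * _ = c ^+ 2 - 1); last by ring.
    rewrite ec (_ : _ - _ = - (2 * (1 + s ^+ 2)^-1) * s ^+ 2); last by field.
    apply: (vmaxMl hA) => //; apply/(val_ringN hA)/(val_ringM hA) => //.
    exact: (val_ring_nat hA 2).
  have Ac : A c.
    case: (val_ring_total hA c) => // hc; apply: contrapT => nc.
    have c0 : c != 0 by apply/eqP => c0; apply: nc; rewrite c0; apply: val_ring0.
    have m1 : vmax c^-1 by right; rewrite invrK.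
    have := vmaxMl hA (val_ringM hA hc hc) mp.
    rewrite (_ : _ * _ = 1 - c^-1 ^+ 2); last by field.
    apply: (vunit_not_vmax (A := A)); apply: (vunitDmax hA (vunit1 hA)).
    exact/(vmaxN hA)/(vmaxX hA).
  have [h|h] := val_ring_cases (val_ringB hA Ac A1); first by exists c.
  exists (- c); first by rewrite sqrrN.
  have -> : - c - 1 = - ((c - 1)^-1 * ((c - 1) * (c + 1))) by case: h => h _ _; field.
  by apply/(vmaxN hA)/(vmaxMl hA) => //; case: h.
have up : vunit (c + 1).
  by rewrite (_ : c + 1 = 2 + (c - 1)); [apply: (vunitDmax hA) | ring].
have es : s ^+ 2 * (1 + c ^+ 2) = 1 - c ^+ 2 by rewrite ec; field.
have uq : vunit (1 + c ^+ 2).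
  rewrite (_ : 1 + c ^+ 2 = 2 + (c - 1) * (c + 1)); last by ring.
  by apply: (vunitDmax hA) => //; apply: (vmaxMr hA) => //; case: up.
have [p0 _ _] := up; have [q0 _ _] := uq.
have c1 : 1 - c != 0.
  apply: contraNneq s0 => c1; rewrite -sqrf_eq0; apply/eqP/(mulIf q0).
  by rewrite mul0r es -(subr0_eq c1) expr1n subrr.
have m0 : c - 1 != 0 by rewrite -opprB oppr_eq0.
have i0 := neq0Ci F; have si := sqrCi F.
pose x := i * (1 + c) / (1 - c); pose y := (1 + i) * x / s.
have i1 : 1 + i != 0.
  rewrite addrC -[1]opprK subr_eq0; apply/eqP => e; move: si; rewrite e sqrrN expr1n.
  by move/eqP; rewrite -subr_eq0 opprK -mulr2n pnatr_eq0.
have x0 : x != 0 by rewrite /x !mulf_neq0 ?invr_eq0 // addrC.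
have xy : on_curve (-1) 0 (Affine x y).
  rewrite /=; apply: (mulIf (expf_neq0 2 s0)); apply: (mulIf q0).
  have -> : y ^+ 2 * s ^+ 2 = (1 + i) ^+ 2 * x ^+ 2 by rewrite /y; field.
  rewrite -[RHS]mulrA es /x; field: si; exact: c1.
exists (lem_of xy); last by rewrite /lem_s /= -/x /y; field; rewrite s0 x0 i1.
suff [] : [/\ formal (lem_of xy), lem_s (lem_of xy) = s & lem_c (lem_of xy) = c] by [].
apply: (formal_coords hA) => // _ _ [<- <-]; split; last by rewrite /y; field.
by rewrite /x; field.
Qed.

(** Induction on k, clearing the denominators in the Edwards formulas for the sum
    of (2 k + 1) P and 2 P. *)
Lemma formal_odd P k : formal P ->
  lem_s (P *+ k.*2.+1) * ev (mult_b k) (lem_s P ^+ 2) = lem_s P * ev (mult_a k) (lem_s P ^+ 2) /\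
  lem_c (P *+ k.*2.+1) * ev (mult_g k) (lem_s P ^+ 2) = lem_c P * ev (mult_e k) (lem_s P ^+ 2).
Proof.
move=> hP; have h2 := formal_mulrn 2 hP.
have [sP cP eP] := formal_spec hA hP.
have [[n1 _ _] [n2 _ _]] := vunit_den hA hP hP.
have [_ s2 c2] := formal_add hA u2 hP hP.
set s := lem_s P in sP eP n1 n2 s2 c2 *; set c := lem_c P in cP eP n1 n2 s2 c2 *.
have ud : 1 + s ^+ 2 != 0.
  by have [] : vunit (1 + s ^+ 2) by apply: (vunitDmax hA (vunit1 hA)); apply: (vmaxX hA).
have cc : c ^+ 2 * (1 + s ^+ 2) = 1 - s ^+ 2 by rewrite -[X in _ = X - _]eP; ring.
have e1 : (1 - s * s * c * c) * (1 + s ^+ 2) = 1 + (s ^+ 2) ^+ 2.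
  transitivity (1 + s ^+ 2 - s ^+ 2 * (c ^+ 2 * (1 + s ^+ 2))); first by ring.
  by rewrite cc; ring.
have e2 : (1 + s * s * c * c) * (1 + s ^+ 2) = 1 + 2 * s ^+ 2 - (s ^+ 2) ^+ 2.
  transitivity (1 + s ^+ 2 + s ^+ 2 * (c ^+ 2 * (1 + s ^+ 2))); first by ring.
  by rewrite cc; ring.
set u := s ^+ 2 in ud cc e1 e2 *.
have hs2 : lem_s (P *+ 2) * (1 + u ^+ 2) = 2 * s * c * (1 + u).
  by rewrite mulr2n s2 -e1 mulrA divfK //; ring.
have hc2 : lem_c (P *+ 2) * (1 + 2 * u - u ^+ 2) = 1 - 2 * u - u ^+ 2.
  rewrite mulr2n c2 -e2 mulrA divfK //.
  transitivity (c ^+ 2 * (1 + u) - u * (1 + u)); first by rewrite /u; ring.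
  by rewrite cc; ring.
have al0 : 1 + u ^+ 2 != 0 by rewrite -e1 mulf_neq0.
have be0 : 1 + 2 * u - u ^+ 2 != 0 by rewrite -e2 mulf_neq0.
elim: k => [|k]; first by rewrite /mult_a /mult_b /mult_e /mult_g /= !ev1.
have hk := formal_mulrn k.*2.+1 hP; have [[D1 _ _] [D2 _ _]] := vunit_den hA hk h2.
have [_ hs hc] := formal_add hA u2 hk h2.
rewrite (_ : P *+ (k.+1).*2.+1 = P *+ k.*2.+1 + P *+ 2); last first.
  by rewrite -mulrnDr; congr (_ *+ _); lia.
rewrite hs hc {hs hc}.
move: D1 D2 hs2 hc2; set sk := lem_s (P *+ k.*2.+1); set ck := lem_c (P *+ k.*2.+1).
set S := lem_s (P *+ 2); set T := lem_c (P *+ 2) => D1 D2 hs2 hc2.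
rewrite /mult_a /mult_b /mult_e /mult_g /=.
case: (odd_mult k) => [[[a b] e] g] /=; rewrite !evE.
set va := ev a u; set vb := ev b u; set ve := ev e u; set vg := ev g u => -[ha he].
set al := 1 + u ^+ 2 in al0 hs2 *; set be := 1 + 2 * u - u ^+ 2 in be0 hc2 *.
set be' := 1 - 2 * u - u ^+ 2 in hc2 *.
have hd : al * be * vb * vg * (sk * S * ck * T) = 2 * u * (1 - u) * be' * va * ve.
  transitivity ((sk * vb) * (S * al) * (ck * vg) * (T * be)); first by ring.
  rewrite ha he hs2 hc2 -cc /u; ring.
split.
- rewrite (_ : _ - _ * ve = al * be * vb * vg * (1 - sk * S * ck * T)); last first.
    by rewrite [RHS]mulrBr hd mulr1.
  transitivity ((sk * vb) * (T * be) * al * vg + (ck * vg) * (S * al) * be * vb).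
    by field; exact: D1.
  by rewrite ha he hs2 hc2 -cc; ring.
- rewrite (_ : _ + _ * ve = al * be * vb * vg * (1 + sk * S * ck * T)); last first.
    by rewrite [RHS]mulrDr hd mulr1.
  transitivity ((ck * vg) * (T * be) * al * vb - (sk * vb) * (S * al) * be * vg).
    by field; exact: D2.
  by rewrite ha he hs2 hc2 /u; ring.
Qed.

Lemma mult_b_vcong P k : formal P -> vcong (ev (mult_b k) (lem_s P ^+ 2)) 1.
Proof.
move=> hP; have [sP _ _] := formal_spec hA hP; have [_ e _ _] := odd_mult_at0 k.
by have := ev_vcong (mult_b k) (vmaxX hA (n := 2) isT sP); rewrite e.
Qed.

Lemma mult_b_neq0 P k : formal P -> ev (mult_b k) (lem_s P ^+ 2) != 0.
Proof.
by move=> hP; have [] := vcong_unit hA (mult_b_vcong k hP) (vunit1 hA).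
Qed.

End Formal.

(** * Multiplication by p modulo p *)

(** The numerator of s((2 k + 1) P), as a polynomial in s(P). *)
Definition mult_num k : {poly int} := 'X * (mult_a k \Po 'X^2).

Lemma coef_mult_num k j :
  (mult_num k)`_j = if odd j then (mult_a k)`_j./2 else 0.
Proof.
rewrite /mult_num coefXM; case: j => [|j] //=; rewrite coef_comp_poly_Xn // dvdn2 divn2 uphalf_half.
by case: (odd j).
Qed.

Lemma ev_mult_num (F : numClosedFieldType) k (s : F) :
  ev (mult_num k) s = s * ev (mult_a k) (s ^+ 2).
Proof.
rewrite /mult_num evM evX; congr (_ * _).
by rewrite /ev map_comp_poly /= map_polyXn horner_comp hornerXn.
Qed.

(** Multiplication by p is not 0 modulo p by [odd_mult_at1], its coefficients of
    even degree vanish, and the one of degree 1 is p. *)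
Lemma mult_num_index p : prime p -> odd p -> exists q,
  [/\ odd q, (1 < q)%N, ~~ (p %| (mult_num p./2)`_q)%Z
    & forall j, (j < q)%N -> (p %| (mult_num p./2)`_j)%Z].
Proof.
move=> p_pr p_odd; set k := p./2.
have ek : k.*2.+1 = p by rewrite -[RHS]odd_double_half p_odd.
have ex : exists q, ~~ (p %| (mult_num k)`_q)%Z.
  apply: contrapT => nex; have := odd_mult_at1 k p_pr p_odd; apply/negP; rewrite negbK.
  suff : (p %| (mult_a k).[1])%Z by rewrite dvdzE.
  rewrite horner_coef; apply: rpred_sum => j _; rewrite expr1n mulr1.
  have := coef_mult_num k (j.*2.+1); rewrite /= odd_double /= uphalf_double => <-.
  by apply/negPn/negP => h; apply: nex; exists (j.*2.+1).
case: (ex_minnP ex) => q hq qmin; exists q.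
have hodd : odd q by apply: contraNT hq => /negPf nq; rewrite coef_mult_num nq dvdz0.
split=> //; last first.
  by move=> j jq; apply/negPn/negP => /qmin; rewrite leqNgt jq.
rewrite ltn_neqAle odd_gt0 // andbT; apply: contraNneq hq => <-.
rewrite coef_mult_num /= -horner_coef0; have [-> _ _ _] := odd_mult_at0 k.
by rewrite ek dvdzz.
Qed.

(** Otherwise all nonzero elements of F_p are roots of X^d - 1, where d is the
    remainder of q - 1 modulo p - 1. *)
Lemma pred_prime_dvd p q : prime p -> (0 < q)%N ->
  (forall k, ~~ (p %| k)%N -> k ^ q = k %[mod p]) -> (p.-1 %| q.-1)%N.
Proof.
move=> p_pr q0 h; apply/negPn/negP; rewrite /dvdn -lt0n => d0.
set d := (_ %% _)%N in d0.
have p1 : (0 < p.-1)%N by rewrite -subn1 subn_gt0 prime_gt1.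
have dp : (d < p.-1)%N by rewrite ltn_mod.
have xd (x : 'F_p) : x != 0 -> x ^+ d = 1.
  move=> x0; have xq : x ^+ q.-1 = 1.
    apply: (mulfI x0); rewrite -exprS prednK // mulr1 -[x]natr_Zp -natrX.
    rewrite -(Fp_nat_mod p_pr (x ^ q)) h ?Fp_nat_mod //.
    apply: contraNN x0 => /dvdnP[m e]; rewrite -[x]natr_Zp e natrM.
    by rewrite pchar_Fp_0 // mulr0.
  have xp : x ^+ p.-1 = 1.
    apply: (mulfI x0); rewrite -exprS prednK ?prime_gt0 // mulr1.
    by rewrite -[RHS]expf_card card_Fp.
  by rewrite -xq (divn_eq q.-1 p.-1) exprD mulnC exprM xp expr1n mul1r.
pose xs : seq 'F_p := enum (predC1 0).
have : (size xs < size ('X^d - 1%:P : {poly 'F_p})%R)%N.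
  apply: max_poly_roots.
  - by rewrite -size_poly_eq0 size_XnsubC.
  - by apply/allP => x; rewrite mem_enum => /xd e; rewrite /root !hornerE e subrr.
  - exact: enum_uniq.
by rewrite size_XnsubC // ltnS /xs -cardE cardC1 card_Fp // leqNgt dp.
Qed.

Section OddPrime.
Variables (F : numClosedFieldType) (A : F -> Prop) (p : nat).
Hypotheses (hA : valuation_ring A) (p_pr : prime p) (p_odd : odd p).
Hypothesis npV : ~ A p%:R^-1.
Local Notation vmax := (vmax A).
Local Notation vunit := (vunit A).
Local Notation vcong := (val_cong A).
Local Notation formal := (formal_point A).
Implicit Types P Q : lem_point F.

Lemma vunit2 : vunit 2.
Proof.
apply: (vunit_coprime hA p_pr npV); rewrite prime_coprime // dvdn_prime2 //.
by apply: contraTneq p_odd => <-.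
Qed.
Let u2 := vunit2.

Let k := p./2.
Let ek : k.*2.+1 = p. Proof. by rewrite /k -[RHS]odd_double_half p_odd. Qed.

Variable q : nat.
Hypotheses (q_odd : odd q) (q_gt1 : (1 < q)%N)
  (hq : ~~ (p %| (mult_num k)`_q)%Z)
  (hlow : forall j, (j < q)%N -> (p %| (mult_num k)`_j)%Z).

Let N : {poly F} := map_poly intr (mult_num k).
Let c : F := N`_q.

Let uc : vunit c.
Proof. by rewrite /c /N coef_map; apply: (vunit_int hA p_pr npV); rewrite -[(_ %| _)%N]/(p %| _)%Z. Qed.

Let s_mulp P : formal P ->
  lem_s (P *+ p) = ev (mult_num k) (lem_s P) / ev (mult_b k) (lem_s P ^+ 2).
Proof.
move=> hP; have b0 := mult_b_neq0 hA k hP.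
by rewrite ev_mult_num -(formal_odd hA u2 k hP).1 ek mulfK.
Qed.

Let N_low j : (j < q)%N -> exists2 n : int, N`_j = p%:R * n%:~R & (j = 0%N -> n = 0).
Proof.
move=> jq; case: (eqVneq j 0%N) => [->|j0].
  by exists 0 => //; rewrite /N coef_map coef_mult_num /= mulr0.
have /dvdzP[n e] := hlow jq; exists n; [| by move/eqP: j0].
by rewrite /N coef_map e /= intrM mulrC.
Qed.

(** The terms below degree q carry a factor p = s^q and are negligible. *)
Let N_leading s t : s ^+ q = p%:R -> vunit t ->
  exists2 m, vcong m c & ev (mult_num k) (s * t) = (s * t) ^+ q * m.
Proof.
move=> hs ut; have [t0 At AtV] := ut.
have p0 := p_neq0 F p_pr.
have s0 : s != 0 by apply: contraNneq p0 => s0; rewrite -hs s0 expr0n; case: q q_gt1.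
have ms : vmax s by apply: (vmax_root hA (n := q)); rewrite hs; apply: vmax_p.
have mst : vmax (s * t) by apply: (vmaxMr hA).
have st0 : s * t != 0 by rewrite mulf_neq0.
rewrite /ev -/N (horner_take_drop N q).
have [m mm em] : exists2 m, vmax m & (take_poly q N).[s * t] = (s * t) ^+ q * m.
  exists ((take_poly q N).[s * t] / (s * t) ^+ q); last by rewrite mulrCA mulfV ?mulr1 ?expf_neq0.
  rewrite (horner_coef_wide _ (size_take_poly _ _)) mulr_suml.
  apply: (vmax_sum hA) => j _; rewrite coef_take_poly ltn_ord.
  have [n -> n0] := N_low (ltn_ord j).
  case: (posnP j) => [j0|j0].
    by rewrite n0 ?j0 // mulr0 !mul0r; apply: vmax0.
  rewrite -hs (_ : _ / _ = n%:~R * (t^-1) ^+ q * (s * t) ^+ j); last first.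
    by rewrite [(s * t) ^+ q]exprMn exprVn; field; rewrite !expf_neq0.
  apply: (vmaxMl hA); last exact: (vmaxX hA).
  by apply: (val_ringM hA); [apply: val_ring_int | apply: (val_ringX hA)].
exists (m + (drop_poly q N).[s * t]); last by rewrite em mulrDr [_ * _.[_]]mulrC.
rewrite -[c]add0r; apply: (vcongD hA); first by rewrite /val_cong subr0.
have -> : c = (drop_poly q N)`_0 by rewrite coef_drop_poly.
by apply: (horner_vcong hA) => // j; rewrite coef_drop_poly; apply: (coef_A hA).
Qed.

(** Compare s(p (j P)) and s(j (p P)) for a point with s^q = p: their leading terms
    are c (j s)^q and j c s^q. *)
Lemma index_congruence j : ~~ (p %| j)%N -> j ^ q = j %[mod p].
Proof.
move=> pj; have q0 : (0 < q)%N by apply: ltnW.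
pose s : F := q.-root p%:R; have hs : s ^+ q = p%:R by apply: rootCK.
have p0 := p_neq0 F p_pr.
have s0 : s != 0 by apply: contraNneq p0 => s0; rewrite -hs s0 expr0n; case: q q_gt1.
have ms : vmax s by apply: (vmax_root hA (n := q)); rewrite hs; apply: vmax_p.
have [P hP sP] := formal_lift hA u2 ms.
have hpP := formal_mulrn hA u2 p hP; have hjP := formal_mulrn hA u2 j hP.
have [t1 t1c e1] := formal_mulrn_s hA u2 j hP.
have [t2 t2c e2] := formal_mulrn_s hA u2 j hpP.
have uj : vunit j%:R by apply: (vunit_coprime hA p_pr npV); rewrite coprime_sym prime_coprime.
have ut1 := vcong_unit hA t1c uj.
have [m1 m1c f1] := N_leading hs (vunit1 hA); have [m2 m2c f2] := N_leading hs ut1.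
have Ac : A c by case: uc.
have Aj : A j%:R by apply: val_ring_nat.
have g1 := vcong_div1 hA Ac m1c (mult_b_vcong hA k hP); have g2 := vcong_div1 hA Ac m2c (mult_b_vcong hA k hjP).
have sq0 : s ^+ q != 0 by rewrite expf_neq0.
have h1 : lem_s (P *+ p) = s ^+ q * (m1 / ev (mult_b k) (lem_s P ^+ 2)).
  by rewrite (s_mulp hP) sP -[in ev (mult_num _) s](mulr1 s) f1 mulr1 mulrA.
have h2 : lem_s (P *+ j *+ p) = s ^+ q * (t1 ^+ q * (m2 / ev (mult_b k) (lem_s (P *+ j) ^+ 2))).
  by rewrite (s_mulp hjP) e1 sP f2 exprMn -!mulrA.
have h3 : lem_s (P *+ p *+ j) = s ^+ q * ((m1 / ev (mult_b k) (lem_s P ^+ 2)) * t2).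
  by rewrite e2 h1 -!mulrA.
have /(mulfI sq0) e : s ^+ q * (t1 ^+ q * (m2 / ev (mult_b k) (lem_s (P *+ j) ^+ 2))) =
  s ^+ q * ((m1 / ev (mult_b k) (lem_s P ^+ 2)) * t2).
  by rewrite -h2 -h3 -!mulrnA mulnC.
have c1 : vcong (t1 ^+ q * (m2 / ev (mult_b k) (lem_s (P *+ j) ^+ 2))) (j%:R ^+ q * c).
  by apply: (vcongM hA) => //; [apply: (val_ringX hA) | apply: (vcongX hA)].
have c2 : vcong ((m1 / ev (mult_b k) (lem_s P ^+ 2)) * t2) (c * j%:R).
  by apply: (vcongM hA).
have := vcong_trans hA (vcong_sym hA c1) _; rewrite e => /(_ _ c2).
rewrite /val_cong [c * _]mulrC -mulrBl => h.
have : vmax (j%:R ^+ q - j%:R).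
  by have [c0 _ cV] := uc; have := vmaxMr hA cV h; rewrite mulfK.
have -> : j%:R ^+ q - j%:R = ((j ^ q)%N%:Z - j%:Z)%:~R :> F by rewrite intrB -!pmulrn natrX.
move/(vmax_int hA p_pr npV); rewrite -[(p %| _)%N]/(p %| (_ : int))%Z => h'.
by apply/eqP; rewrite -eqz_nat -!modz_nat; rewrite eqz_mod_dvd.
Qed.

Lemma pred_index_dvd : (p.-1 %| q.-1)%N.
Proof. by apply: pred_prime_dvd => //; [apply: ltnW | apply: index_congruence]. Qed.

End OddPrime.

(** * Torsion points of small valuation *)

Section TorsionPoints.
Variables (F : numClosedFieldType) (A : F -> Prop) (p : nat).
Hypotheses (hA : valuation_ring A) (p_pr : prime p) (p_odd : odd p).
Hypothesis npV : ~ A p%:R^-1.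
Local Notation vmax := (vmax A).
Local Notation vunit := (vunit A).
Local Notation formal := (formal_point A).
Implicit Types P Q : lem_point F.

Let u2 : vunit 2 := vunit2 hA p_pr p_odd npV.

Let k := p./2.
Let ek : k.*2.+1 = p. Proof. by rewrite /k -[RHS]odd_double_half p_odd. Qed.

Variable q : nat.
Hypotheses (q_odd : odd q) (q_gt1 : (1 < q)%N)
  (hq : ~~ (p %| (mult_num k)`_q)%Z)
  (hlow : forall j, (j < q)%N -> (p %| (mult_num k)`_j)%Z).

Let p0 : p%:R != 0 :> F := p_neq0 F p_pr.

(** The corner of the Newton polygon of N(s) / s joins the constant term p to the
    unit coefficient of degree q - 1. *)
Lemma torsion_first : exists P, [/\ formal P, P *+ p = 0, lem_s P != 0 &
  vunit (lem_s P ^+ q.-1 / p%:R)].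
Proof.
pose f : {poly F} := map_poly intr (mult_a k \Po 'X^2).
have fE j : f`_j = ((mult_num k)`_j.+1)%:~R.
  by rewrite coef_map /mult_num coefXM.
have f0E : f`_0 = p%:R.
  rewrite fE coef_mult_num /= -horner_coef0; have [-> _ _ _] := odd_mult_at0 k.
  by rewrite ek.
have [|||||r [rr mr ur]] := @small_root F A hA f q.-1; rewrite ?f0E //.
- by right.
- by move=> j; apply: (coef_A hA).
- move=> j jq; have /dvdzP[n e] : (p %| (mult_num k)`_j.+1)%Z by apply: hlow; lia.
  by rewrite fE e intrM mulfK //; apply: val_ring_int.
- rewrite fE prednK; last exact: ltnW.
  by apply: (vunit_int hA p_pr npV); rewrite -[(_ %| _)%N]/(p %| _)%Z.
have [P hP sP] := formal_lift hA u2 mr.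
exists P; rewrite sP -f0E; split=> //; last first.
  by apply: contraTneq rr => ->; rewrite /root horner_coef0 f0E.
have hp := formal_mulrn hA u2 p hP; apply: (formal_s0 hA hp).
have [h _] := formal_odd hA u2 k hP; move: h; rewrite ek.
have b0 := mult_b_neq0 hA k hP.
have -> : ev (mult_a k) (lem_s P ^+ 2) = 0.
  move/eqP: rr; rewrite sP /ev /f map_comp_poly /= map_polyXn horner_comp hornerXn.
  by [].
by rewrite mulr0 => /eqP; rewrite mulf_eq0 (negPf b0) orbF => /eqP.
Qed.

(** The equation N(s) = r B(s^2) expresses that p Q has the coordinate r of a point
    of order p.  Its constant term - r divides the coefficients below degree q,
    since r divides p. *)
Lemma torsion_second : exists Q, [/\ formal Q, Q *+ (p * p) = 0, lem_s Q != 0 &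
  vunit (lem_s Q ^+ (q * q.-1) / p%:R)].
Proof.
have [P [hP pP s0 us]] := torsion_first; set r := lem_s P in s0 us.
have [mr _ _] := formal_spec hA hP; rewrite -/r in mr.
pose N : {poly F} := map_poly intr (mult_num k).
pose B : {poly F} := map_poly intr (mult_b k \Po 'X^2).
pose f := N - r *: B.
have B0 : B`_0 = 1.
  rewrite coef_map coef_comp_poly_Xn //= -horner_coef0; by have [_ -> _ _] := odd_mult_at0 k.
have BA j : A B`_j by apply: (coef_A hA).
have NA j : A N`_j by apply: (coef_A hA).
have f0E : f`_0 = - r.
  by rewrite coefB coefZ B0 mulr1 coef_map coef_mult_num /= sub0r.
have Ar := vmax_A hA mr.
have pr : A (p%:R / r).
  have [_ _ hV] := us; move: hV; rewrite invf_div => hV.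
  have -> : p%:R / r = p%:R / r ^+ q.-1 * r ^+ q.-2.
    have -> : q.-1 = q.-2.+1 by lia.
    by rewrite exprS; field; rewrite s0 expf_neq0.
  by apply: (val_ringM hA) => //; apply: (val_ringX hA).
have [|||||t [rt mt ut]] := @small_root F A hA f q; rewrite ?f0E ?oppr_eq0 //.
- exact: vmaxN.
- by move=> j; rewrite coefB coefZ; apply: (val_ringB hA) => //; apply: (val_ringM hA).
- move=> j jq; rewrite coefB coefZ coef_map.
  have /dvdzP[n e] := hlow jq.
  rewrite e /= intrM (_ : _ / _ = - (n%:~R * (p%:R / r)) + B`_j); last first.
    by rewrite invrN; field.
  by apply: (val_ringD hA) => //; apply/(val_ringN hA)/(val_ringM hA) => //; apply: val_ring_int.
- rewrite coefB; apply: (vunitDmax hA).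
    rewrite coef_map; apply: (vunit_int hA p_pr npV); by rewrite -[(_ %| _)%N]/(p %| _)%Z.
  by rewrite coefZ; apply/(vmaxN hA)/(vmaxMr hA).
have [Q hQ sQ] := formal_lift hA u2 mt.
have hpQ := formal_mulrn hA u2 p hQ.
have t0 : t != 0.
  by apply: contraTneq rt => ->; rewrite /root horner_coef0 f0E oppr_eq0.
rewrite f0E in ut; exists Q; rewrite sQ; split=> //; last first.
  rewrite exprM (_ : _ / _ = ((t ^+ q / - r) ^+ q.-1) * (-1) ^+ q.-1 * (r ^+ q.-1 / p%:R)).
    apply: (vunitM hA) => //; apply: (vunitM hA); first exact: (vunitX hA).
    by apply/(vunitX hA)/(vunitN hA)/(vunit1 hA).
  have -> : (t ^+ q / - r) ^+ q.-1 * (-1) ^+ q.-1 = (t ^+ q / r) ^+ q.-1.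
    by rewrite -exprMn invrN !mulrN mulr1 opprK.
  by rewrite expr_div_n; field; rewrite p0 expf_neq0.
have spQ : lem_s (Q *+ p) = r.
  have [h _] := formal_odd hA u2 k hQ; move: h; rewrite ek => h; apply: (mulIf (mult_b_neq0 hA k hQ)).
  rewrite h -ev_mult_num sQ; apply/eqP; rewrite -subr_eq0; move: rt.
  rewrite /root /f /B /N hornerD hornerN hornerZ /ev map_comp_poly /= map_polyXn horner_comp hornerXn.
  by [].
rewrite mulrnA; have hpp := formal_mulrn hA u2 p hpQ; apply: (formal_s0 hA hpp).
have [h _] := formal_odd hA u2 k hpQ; have [h' _] := formal_odd hA u2 k hP.
move: h h'; rewrite ek pP spQ => h h'; apply: (mulIf (mult_b_neq0 hA k hpQ)); rewrite mul0r spQ h -h'.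
by rewrite /lem_s mul0r.
Qed.

(** If 2^size l v(r) = j v(p) and v(p) = e v(r) with v(r) > 0, then 2^size l = j e. *)
Lemma ramification_dvd l r e : tower_valid l -> tower l r -> vmax r -> r != 0 ->
  vunit (r ^+ e / p%:R) -> (e %| 2 ^ size l)%N.
Proof.
move=> vl hr mr r0 ue; have [j hj] := tower_valuation hA p_pr npV vl hr r0.
have nu n : vunit (r ^+ n) -> n = 0%N.
  by case: n => // n hn; case: (vunit_not_vmax hn); apply: (vmaxX hA).
have := vunitM hA hj (vunitXz hA j ue); rewrite -mulrA -expfzMl mulrCA mulfV // mulr1.
case: j {hj} => n.
  rewrite -exprnP -exprM -exprD => /nu/eqP.
  by rewrite addn_eq0 expn_eq0.
rewrite NegzE -exprnN -exprM => h.
have [ab|ba] := leqP (2 ^ size l) (e * n.+1).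
  have : vunit (r ^+ (e * n.+1 - 2 ^ size l)).
    move/vunitV: h; rewrite invf_div; congr vunit.
    by rewrite expfB_cond // (negPf r0).
  by move/nu => e0; apply/dvdnP; exists n.+1; rewrite mulnC; apply/eqP; rewrite eqn_leq ab -subn_eq0 e0.
have : vunit (r ^+ (2 ^ size l - e * n.+1)) by rewrite expfB.
by move/nu => e0; move: ba; rewrite -subn_gt0 e0.
Qed.

End TorsionPoints.

Lemma torsion_algebraic (F : numClosedFieldType) (A : F -> Prop) (P : lem_point F) m :
  valuation_ring A -> vunit A 2 -> formal_point A P -> odd m -> P *+ m = 0 ->
  algebraicOver (ratr : rat -> F) (lem_s P).
Proof.
move=> hA u2 hP m_odd mP; have em : m./2.*2.+1 = m by rewrite -[RHS]odd_double_half m_odd.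
exists (map_poly intr (mult_num m./2)).
  apply/eqP => /(congr1 (fun g : {poly rat} => g`_1)).
  rewrite coef0 coef_map coef_mult_num /= -horner_coef0; have [-> _ _ _] := odd_mult_at0 m./2.
  by rewrite em => /eqP; rewrite intr_eq0 => /eqP [m0]; move: m_odd; rewrite m0.
rewrite -map_poly_comp (eq_map_poly (g := intr)); last by move=> z /=; rewrite rmorph_int.
rewrite /root -/(ev _ _) ev_mult_num.
have [h _] := formal_odd hA u2 m./2 hP; rewrite -h em mP.
by rewrite {1}/lem_s mul0r.
Qed.

(** * Constructible torsion forces Fermat primes *)

Lemma algebraic_subfield (F : numFieldType) :
  is_subfield (algebraicOver (ratr : rat -> F)).
Proof.
split; [exact: algebraic1 | exact: algebraic_sub | exact: algebraic_div].
Qed.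

Lemma algebraic_sqrt (F : numFieldType) : sqrt_closed (algebraicOver (ratr : rat -> F)).
Proof.
move=> z [p p0 rp]; exists (p \Po 'X^2).
  by rewrite comp_poly_eq0 // size_polyXn.
by rewrite /root map_comp_poly map_polyXn horner_comp hornerXn.
Qed.

Section Torsion.
Variable R : realType.
Local Notation C := (R[i] : numClosedFieldType).
Implicit Types P Q : lem_point C.

Lemma ratrN1 : ratr (-1) = -1 :> C. Proof. by rewrite rmorphN1. Qed.

Lemma torsionP n (P : point C) :
  torsion (-1) 0 n P <-> exists2 Q : lem_point C, lem_val Q = P & Qbar_point P /\ Q *+ n = 0.
Proof.
rewrite /torsion ratrN1 rmorph0; split.
  case=> h hq hn; exists (lem_of h) => //; split=> //.
  by apply: val_inj; rewrite /= lem_valMn.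
case=> Q <- [hq hn]; split=> //; first exact: on_lem.
by rewrite -lem_valMn hn.
Qed.

(** From s one obtains c by a square root, and x and y rationally over Q(i). *)
Lemma lem_coords_closed (K : C -> Prop) P x y : is_subfield K -> sqrt_closed K ->
  lem_val P = Affine x y -> lem_s P != 0 -> 1 + lem_s P ^+ 2 != 0 -> y != 0 -> x + 'i != 0 ->
  K (lem_s P) -> K x /\ K y.
Proof.
move=> hK sK e s0 d0 y0 x0 hs.
have si := sqrCi C.
have hi : K 'i by apply: sK; rewrite si; subfield_closed hK.
have := edwards_curve (lem_val_eq e) y0 x0.
have sE : lem_s P = (1 + 'i) * x / y by rewrite /lem_s e.
rewrite -sE; set c := (x - 'i) / (x + 'i) => /= hc.
have kc : K c.
  apply: sK; have -> : c ^+ 2 = (1 - lem_s P ^+ 2) / (1 + lem_s P ^+ 2).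
    by apply: (mulIf d0); rewrite divfK // -[X in _ = X - _]hc; ring.
  by subfield_closed hK.
have c1 : 1 - c != 0.
  have -> : 1 - c = 2 * 'i / (x + 'i) by rewrite /c; field.
  by rewrite !mulf_neq0 ?invr_eq0 ?neq0Ci // pnatr_eq0.
have kx : K x.
  have -> : x = 'i * (1 + c) / (1 - c).
    apply: (mulIf c1); rewrite divfK // /c; field: si; exact: x0.
  by subfield_closed hK.
split=> //; have -> : y = (1 + 'i) * x / lem_s P.
  by apply: (mulIf s0); rewrite divfK // sE; field.
by subfield_closed hK.
Qed.

Lemma constructible_lem_s n P (A : C -> Prop) m : valuation_ring A -> vunit A 2 ->
  constructible_field (torsion_field (R := R) (-1) 0 n) ->
  formal_point A P -> odd m -> P *+ m = 0 -> (m %| n)%N -> lem_s P != 0 -> constructible (lem_s P).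
Proof.
move=> hA u2 hcon hP m_odd mP /dvdnP[d en] s0.
have [sP _ _] := formal_spec hA hP.
have alg := torsion_algebraic hA u2 hP m_odd mP.
case e: (lem_val P) => [|x y]; first by rewrite /lem_s e eqxx in s0.
have [d0 _ _] : vunit A (1 + lem_s P ^+ 2) by apply: (vunitDmax hA (vunit1 hA)); apply: (vmaxX hA).
have nx : ~ A x by move: hP; rewrite /formal_point e.
have [y0 x0 _ _] := formal_affine hA (lem_val_eq e) nx.
have [ax ay] := lem_coords_closed (algebraic_subfield _) (@algebraic_sqrt _) e s0 d0 y0 x0 alg.
have tP : torsion (-1) 0 n (Affine x y).
  apply/torsionP; exists P => //; split=> //.
  by rewrite en mulnC mulrnA mP mul0rn.
have cx : constructible x.
  by apply: hcon => K _ hK; apply: hK; exists x, y; split=> //; left.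
have cy : constructible y.
  by apply: hcon => K _ hK; apply: hK; exists x, y; split=> //; right.
have hK := constructible_subfield R; have ci := constructible_i R.
by rewrite /lem_s e; subfield_closed hK.
Qed.

Lemma constructible_torsion_prime n p : prime p -> odd p -> (p %| n)%N ->
  constructible_field (torsion_field (R := R) (-1) 0 n) ->
  (exists j, p.-1 = 2 ^ j)%N /\ ~~ (p ^ 2 %| n)%N.
Proof.
move=> p_pr p_odd pn hcon.
have p0 : p%:R != 0 :> C := p_neq0 _ p_pr.
have [||A hA npV] := @valuation_ring_exists C p%:R p0; last first.
- have [q [q_odd q1 hq hlow]] := mult_num_index p_pr p_odd.
  have u2 := vunit2 hA p_pr p_odd npV.
  have pd := pred_index_dvd hA p_pr p_odd npV q1 hq hlow.
  have dvd_tower (P : lem_point C) m e : formal_point A P -> odd m -> P *+ m = 0 -> (m %| n)%N ->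
    lem_s P != 0 -> vunit A (lem_s P ^+ e / p%:R) -> exists L, (e %| 2 ^ L)%N.
    move=> hP m_odd mP mn s0 us; have [sP _ _] := formal_spec hA hP.
    have cs := constructible_lem_s hA u2 hcon hP m_odd mP mn s0.
    have [l vl hl] := constructible_in_tower cs.
    by exists (size l); apply: (ramification_dvd hA p_pr npV vl hl sP s0 us).
  split.
    have [P [hP mP s0 us]] := torsion_first hA p_pr p_odd npV q_odd q1 hq hlow.
    have [L hL] := dvd_tower P p _ hP p_odd mP pn s0 us.
    have /(dvdn_pfactor _ _ (erefl : prime 2))[j _ ->] := dvdn_trans pd hL.
    by exists j.
  apply/negP => p2n.
  have [Q [hQ mQ s0 us]] := torsion_second hA p_pr p_odd npV q_odd q1 hq hlow.
  rewrite -mulnn in p2n; have pp_odd : odd (p * p) by rewrite oddM p_odd.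
  have [L hL] := dvd_tower Q _ _ hQ pp_odd mQ p2n s0 us.
  have := dvdn_trans (dvdn_mulr _ (dvdnn q)) hL.
  move=> /(dvdn_pfactor _ _ (erefl : prime 2))[[|j] _ eq].
    by rewrite eq in q1.
  by move: q_odd; rewrite eq expnS oddM.
- by exists p%:Z.
- move=> m; apply/eqP => em; have : (m * p%:Z)%:~R = 1%:~R :> C.
    by rewrite intrM em -pmulrn mulVf.
  move/eqP; rewrite eqr_int => /eqP/(congr1 absz); rewrite abszM /= => /eqP.
  rewrite muln_eq1 => /andP[_ /eqP p1]; move: p_pr; by rewrite p1.
Qed.
End Torsion.

Lemma totient_pow2 n : (0 < n)%N ->
  (forall p, prime p -> odd p -> (p %| n)%N ->
    (exists j, p.-1 = 2 ^ j)%N /\ ~~ (p ^ 2 %| n)%N) ->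
  exists k, totient n = (2 ^ k)%N.
Proof.
move=> n0 h; rewrite totientE // big_seq.
apply: (big_ind (fun m => exists k, m = 2 ^ k)%N); first by exists 0%N.
  by move=> _ _ [j ->] [k ->]; exists (j + k)%N; rewrite expnD.
move=> p; rewrite mem_primes => /and3P[p_pr _ pn].
have [->|p_odd] := even_prime p_pr; first by exists (logn 2 n).-1; rewrite mul1n.
have [[j ->] np2] := h p p_pr p_odd pn; exists j.
suff -> : logn p n = 1%N by rewrite muln1.
by apply/eqP; rewrite eqn_leq logn_gt0 mem_primes p_pr n0 pn andbT leqNgt -pfactor_dvdn // np2.
Qed.

Lemma constructible_torsion_totient (R : realType) n : (2 <= n)%N ->
  constructible_field (torsion_field (R := R) (-1) 0 n) ->
  exists k, totient n = (2 ^ k)%N.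
Proof.
move=> n2 hcon; apply: totient_pow2; first exact: ltnW.
by move=> p p_pr p_odd pn; apply: constructible_torsion_prime hcon.
Qed.

(** * Galois groups of 2-power exponent *)

Section NumberField.
Variable F : numClosedFieldType.
Local Notation QF := (map_poly (ratr : rat -> F)).
Local Notation algebraic := (algebraicOver (ratr : rat -> F)).

(** That z lies in every field containing s is what makes Q(z) a splitting field
    when s lists the roots of a polynomial. *)
Lemma primitive_element (s : seq F) : (forall x, x \in s -> algebraic x) ->
  exists z, [/\ algebraic z,
    forall K, is_subfield K -> (forall x, x \in s -> K x) -> K z
    & forall x, x \in s -> exists p, x = (QF p).[z]].
Proof.
elim: s => [|x s IHs] hs.
  by exists 0; split=> // [|K hK _]; [apply: algebraic0 | apply: subfield0].
have [y hy|z [az Kz sz]] := IHs; first by apply: hs; rewrite in_cons hy orbT.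
have [px px0 rx] : algebraic x by apply: hs; rewrite mem_head.
have [pz pz0 rz] := az.
have [n [[qz eqz] [qx eqx]]] := pchar0_PET pz0 rz px0 rx (pchar_num rat).
exists (x *+ n - z); split.
- apply: algebraic_sub az; rewrite -mulr_natr; apply: algebraic_mul; first by exists px.
  by rewrite -(ratr_nat F); apply: algebraic_id.
- move=> K hK hKs; have hz : K z.
    by apply: Kz => // y hy; apply: hKs; rewrite in_cons hy orbT.
  have hx : K x by apply: hKs; rewrite mem_head.
  by rewrite -mulr_natr; apply: (subfieldB hK) => //; subfield_closed hK.
- move=> y; rewrite in_cons => /orP[/eqP->|/sz[p ->]]; first by exists qx.
  by exists (p \Po qz); rewrite map_comp_poly horner_comp eqz.
Qed.

Lemma splitting_number_field (g : {poly rat}) : g != 0 ->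
  exists (L : splittingFieldType rat) (iota : {rmorphism L -> F}),
  forall z, root (QF g) z -> exists w, iota w = z.
Proof.
move=> g0.
have [s es] := closed_field_poly_normal (QF g).
have Qg0 : QF g != 0 by rewrite map_poly_eq0.
have roots_s x : root (QF g) x = (x \in s).
  by rewrite es rootZ ?lead_coef_eq0 // root_prod_XsubC.
have [x|z [[p0 p00 rp0] Kz sz]] := @primitive_element s.
  by rewrite -roots_s => rx; exists g.
have exq : exists m, `[< exists q : {poly rat}, [/\ root (QF q) z, q != 0 & size q = m] >].
  by exists (size p0); apply/asboolP; exists p0.
case: (ex_minnP exq) => m /asboolP[q [rq q0 sq]] qmin.
have irr : irreducible_poly q.
  apply/(subfx_irreducibleP rq q0) => r rr r0; rewrite sq; apply: qmin.
  by apply/asboolP; exists r.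
have [L [iota [w ew genw]]] : exists (L : fieldExtType rat) (iota : {rmorphism L -> F}),
    exists2 w, iota w = z & forall x : L, exists r, x = (map_poly (in_alg L) r).[w].
  exists (SubFieldExtType rq irr), (@subfx_inj _ _ ratr z q).
  exists (subfx_root ratr z q); first exact: subfx_inj_root.
  by move=> x; have [r ->] := subfxEroot rq q0 x; exists r.
have iotaQ r : map_poly iota (map_poly (in_alg L) r) = QF r.
  rewrite -map_poly_comp; apply: eq_map_poly => a /=.
  by rewrite alg_num_field fmorph_rat.
have lift x : x \in s -> exists v, iota v = x.
  move=> /sz[r ->]; exists (map_poly (in_alg L) r).[w].
  by rewrite -horner_map iotaQ ew.
have [t et] : exists t : seq L, map iota t = s.
  elim: s {es roots_s Kz sz} lift => [|x s IHs] h; first by exists [::].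
  have [v <-] := h x (mem_head _ _).
  have [t <-] := IHs (fun y hy => h y (mem_behead (s := x :: s) hy)).
  by exists (v :: t).
have split_ax : splitting_field_axiom L.
  exists (map_poly (in_alg L) g).
    by apply/polyOverP => j; rewrite coef_map /= memvZ ?mem1v.
  exists t.
    have lc0 : lead_coef (QF g) != 0 by rewrite lead_coef_eq0.
    rewrite -(eqp_map iota) iotaQ es rmorph_prod /= -et big_map.
    under eq_bigr do rewrite -map_polyXsubC.
    exact: eqp_scale.
  apply/vspaceP => x; rewrite memvf; have [r ->] := genw x.
  have wt : w \in <<1 & t>>%VS.
    pose K y := exists2 v, v \in <<1 & t>>%VS & iota v = y.
    suff [v vt] : K z by rewrite -ew => /fmorph_inj <-.
    apply: Kz => [|y]; last first.
      by rewrite -et => /mapP[v vt ->]; exists v => //; apply: seqv_sub_adjoin.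
    split; first by exists 1; rewrite ?rmorph1 // rpred1.
      by move=> _ _ [u ut <-] [v vt <-]; exists (u - v); rewrite ?rmorphB // rpredB.
    by move=> _ _ [u ut <-] [v vt <-]; exists (u / v); rewrite ?fmorph_div // rpred_div.
  apply: rpred_horner => //; apply/polyOverP => j.
  by rewrite coef_map /= rpredZ ?rpred1.
pose LS : splittingFieldType rat := HB.pack L (FieldExt_isSplittingField.Build rat L split_ax).
exists LS, iota => y; rewrite roots_s; exact: lift.
Qed.
End NumberField.

Section TwoPowerGalois.
Variables (L : splittingFieldType rat) (F : numClosedFieldType).
Variables (iota : {rmorphism L -> F}) (K : F -> Prop).
Hypotheses (hK : is_subfield K) (sK : sqrt_closed K).

Local Notation G := ('Gal({:L} / 1%AS))%g.

Lemma subfield_rat (q : rat) : K (ratr q).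
Proof.
have hint (m : int) : K m%:~R.
  case: m => n; first exact: (subfield_nat hK).
  by rewrite NegzE mulrNz; apply/(subfieldN hK)/(subfield_nat hK).
by apply: (subfield_div hK); apply: hint.
Qed.

Lemma gal_fixed_rat (v : L) : (forall s, s \in G -> s v = v) -> K (iota v).
Proof.
move=> hv; suff : v \in 1%VS.
  by case/vlineP => q ->; rewrite alg_num_field fmorph_rat; apply: subfield_rat.
have gal1 : galois 1%AS {:L}.
  rewrite /galois sub1v normalFieldf andbT /=; apply/separableP => y _.
  by apply: pcharf0_separable => p; rewrite pchar_lalg pchar_num.
rewrite -(galois_fixedField gal1); apply/fixedFieldP => //; exact: memvf.
Qed.

(** The subgroup N generated by the 2^e-th powers fixes w, and it is normal with a
    2-group as quotient.  A proper subgroup H containing N is therefore normalized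
    by some t outside H with t^2 in H.  For v fixed by H, both v + t v and
    (v - t v)^2 are fixed by the larger group generated by H and t, and v is
    recovered from them by a square root. *)
Lemma gal_two_power (e : nat) (w : L) :
  (forall s, s \in G -> (s ^+ (2 ^ e))%g w = w) -> K (iota w).
Proof.
move=> hw; pose N := <<[set (s ^+ (2 ^ e))%g | s in G]>>%G.
have NG : N \subset G.
  by rewrite gen_subG; apply/subsetP => _ /imsetP[s hs ->]; apply: groupX.
have nN : (N <| G)%g.
  rewrite /normal NG norms_gen //; apply/subsetP => t ht; rewrite inE.
  apply/subsetP => _ /imsetP[_ /imsetP[s hs ->] ->].
  by rewrite conjXg; apply: imset_f; rewrite groupJ.
have p2 : (2.-group (G / N))%g.
  rewrite -pnat_exponent; apply: (@pnat_dvd _ (2 ^ e)); last by rewrite pnatX.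
  apply/exponentP => _ /morphimP[s sN sG ->]; rewrite -morphX //=.
  by apply: coset_id; apply: mem_gen; apply: imset_f.
pose fixer (u : L) := [set s : gal_of {:L} | s u == u].
have gfix u : group_set (fixer u).
  apply/group_setP; split; first by rewrite inE gal_id.
  by move=> s t; rewrite !inE galM ?memvf // => /eqP-> /eqP->.
have gen_fix (u : L) (B : {set gal_of {:L}}) : B \subset fixer u -> <<B>>%g \subset fixer u.
  by move=> h; rewrite -[fixer u]/(gval (Group (gfix u))) gen_subG.
have main m : forall H : {group gal_of {:L}}, N \subset H -> H \subset G ->
    (#|G| - #|H| <= m)%N -> forall v : L, (forall s, s \in H -> s v = v) -> K (iota v).
  elim: m => [|m IHm] H NH HG hm v hv.
    apply: gal_fixed_rat => s sG; apply: hv.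
    have -> : (H = G :> {set _})%g by apply/eqP; rewrite eqEcard HG /= -subn_eq0 -leqn0.
    by [].
  have [GH|nGH] := boolP (G \subset H).
    by apply: gal_fixed_rat => s sG; apply/hv/(subsetP GH).
  have prH : (H \proper G)%g by rewrite properE HG.
  have prq : (H / N \proper G / N)%g by rewrite quotient_proper // (normalS NH HG).
  have := nilpotent_proper_norm (pgroup_nil p2) prq.
  rewrite -quotient_subnormG ?(normalS NH HG) // => /properP[_ [xb /morphimP[x _ + exb] nxH]].
  rewrite inE => /andP[xG xH]; rewrite {}exb in nxH.
  have xnH : x \notin H by apply: contra nxH => hx; apply: mem_quotient.
  have xeH : (x ^+ (2 ^ e))%g \in H.
    by apply: (subsetP NH); apply: mem_gen; apply: imset_f.
  have [t [tG tN tH t2H]] : exists t, [/\ t \in G, t \in 'N(H)%g, t \notin H & (t ^+ 2)%g \in H].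
    elim: (e) xeH => [|f IHf]; first by rewrite expg1 (negPf xnH).
    have [xfH _|xfH h] := boolP ((x ^+ (2 ^ f))%g \in H); first exact: IHf.
    exists (x ^+ (2 ^ f))%g; split=> //; [exact: groupX | exact: groupX |].
    by rewrite -expgM -expnSr.
  pose H' := <<t |: H>>%G.
  have HH' : H \subset H' by apply: subset_trans (subsetUr _ _) (subset_gen _).
  have H'G : H' \subset G by rewrite gen_subG subUset sub1set tG.
  have ltm : (#|G| - #|H'| <= m)%N.
    have : (#|H| < #|H'|)%N.
      apply: proper_card; rewrite properE HH' /=; apply/subsetPn; exists t => //.
      by rewrite mem_gen // setU11.
    have := subset_leq_card H'G; have := hm; clear; lia.
  have NH' := subset_trans NH HH'.
  have ttv : t (t v) = v.
    by have := hv _ t2H; rewrite expgS expg1 galM ?memvf.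
  have htv s : s \in H -> s (t v) = t v.
    move=> sH; have : (t * s * t^-1)%g \in H.
      have -> : (t * s * t^-1 = s ^ t^-1)%g by rewrite conjgE invgK mulgA.
      by rewrite memJ_norm // groupV.
    move=> /hv; rewrite !galM ?memvf // => /(congr1 t).
    by rewrite -[LHS]galM ?memvf // mulVg gal_id.
  have fixH' u : t u = u -> (forall s, s \in H -> s u = u) -> forall s, s \in H' -> s u = u.
    move=> tu Hu s sH'; suff : s \in fixer u by rewrite inE => /eqP.
    apply: (subsetP _ s sH'); apply: gen_fix; rewrite subUset sub1set inE tu eqxx /=.
    by apply/subsetP => r rH; rewrite inE Hu.
  have k1 : K (iota (v + t v)).
    apply: (IHm H') => //; apply: fixH'; first by rewrite rmorphD /= ttv addrC.
    by move=> s sH; rewrite rmorphD /= hv // htv.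
  have k2 : K (iota ((v - t v) ^+ 2)).
    apply: (IHm H') => //; apply: fixH'; first by rewrite rmorphXn rmorphB /= ttv -sqrrN opprB.
    by move=> s sH; rewrite rmorphXn rmorphB /= hv // htv.
  have k3 : K (iota (v - t v)) by apply: sK; rewrite -rmorphXn.
  have -> : iota v = (iota (v + t v) + iota (v - t v)) / 2.
    by rewrite !rmorphD rmorphN; field.
  by subfield_closed hK.
apply: (main _ N _ _ (leqnn _)) => //.
move=> s sN; suff : s \in fixer w by rewrite inE => /eqP.
apply: (subsetP _ s sN); apply: gen_fix; apply/subsetP => _ /imsetP[t tG ->].
by rewrite inE hw.
Qed.
End TwoPowerGalois.

(** * Halving and tripling *)

Definition point_over (F : Type) (K : F -> Prop) (P : point F) : Prop :=
  if P is Affine x y then K x /\ K y else True.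

Section PointOver.
Variables (F : numClosedFieldType) (K : F -> Prop).
Hypothesis hK : is_subfield K.
Implicit Types P Q : lem_point F.

Lemma point_over_ec_add (a : F) P Q : K a -> point_over K P -> point_over K Q ->
  point_over K (ec_add a P Q).
Proof.
move=> ka; case: (lem_val P) => [|x1 y1] //; case: (lem_val Q) => [|x2 y2] //=.
move=> [kx1 ky1] [kx2 ky2].
have chord l : K l -> K (l ^+ 2 - x1 - x2) /\ K (l * (x1 - (l ^+ 2 - x1 - x2)) - y1).
  by move=> kl; split; subfield_closed hK.
by case: ifP => _; [case: ifP => // _|]; apply: chord; subfield_closed hK.
Qed.

Lemma point_overD P Q : point_over K P -> point_over K Q -> point_over K (P + Q).
Proof. by apply: point_over_ec_add; exact/(subfieldN hK)/(subfield1 hK). Qed.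

Lemma point_overN P : point_over K P -> point_over K (- P).
Proof.
rewrite lem_valN; case: (lem_val P) => //= x y [kx ky]; split=> //; exact: subfieldN.
Qed.

Lemma point_overMn P n : point_over K P -> point_over K (P *+ n).
Proof. by move=> h; elim: n => // n IHn; rewrite mulrS; apply: point_overD. Qed.

Hypothesis sK : sqrt_closed K.

(** On this curve x(2 P) = ((x^2 + 1) / (2 y))^2. *)
Lemma dbl_val P x y : lem_val P = Affine x y -> y != 0 ->
  exists y', lem_val (P *+ 2) = Affine ((x ^+ 2 + 1) ^+ 2 / (4 * (x ^+ 3 - x))) y'.
Proof.
move=> e y0; have h := lem_val_eq e; rewrite mulr2n lem_valD e /= eqxx.
have -> : (y == - y) = false.
  by apply/negbTE; rewrite -addr_eq0 -mulr2n mulrn_eq0 negb_or.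
rewrite /chord_point; eexists; congr Affine.
by rewrite -h; field: h; rewrite y0.
Qed.

(** Halving a point solves two quadratic equations, in u = x - 1 / x and x. *)
Lemma halving P : point_over K (P *+ 2) -> point_over K P.
Proof.
case e: (lem_val P) => [|x y] // h2; have h := lem_val_eq e.
have ky : K x -> K x /\ K y.
  by move=> kx; split=> //; apply: sK; rewrite h; apply: (subfieldB hK) => //; apply: subfieldX.
apply: ky; have [y0|y0] := eqVneq y 0.
  have : x * (x ^+ 2 - 1) = 0 by rewrite -[RHS](expr0n _ 2) -y0 h; ring.
  move/eqP; rewrite mulf_eq0 subr_eq0 => /orP[/eqP->|/eqP x1]; first exact: subfield0.
  by apply: sK; rewrite x1; apply: subfield1.
have x0 : x != 0.
  by apply: contraNneq y0 => x0; rewrite -sqrf_eq0 h x0 expr0n subr0.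
have x1 : x ^+ 3 - x != 0 by rewrite -h expf_neq0.
have [y' e2] := dbl_val e y0; move: h2; rewrite e2 /=; set t := _ / _ => -[kt _].
have ht : t * (4 * (x ^+ 3 - x)) = (x ^+ 2 + 1) ^+ 2.
  by rewrite /t divfK // mulf_neq0 // pnatr_eq0.
have ku : K (x - x^-1).
  apply: (@sqrt_closed_quadratic _ K 1 (- 4 * t) 4) => //; rewrite ?pnatr_eq0 ?oner_eq0 //; try subfield_closed hK.
  apply: (mulIf (expf_neq0 2 x0)); rewrite mul0r.
  transitivity ((x ^+ 2 + 1) ^+ 2 - t * (4 * (x ^+ 3 - x))); first by field.
  by rewrite ht subrr.
apply: (@sqrt_closed_quadratic _ K 1 (- (x - x^-1)) (-1)) => //; rewrite ?pnatr_eq0 ?oner_eq0 //; try subfield_closed hK.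
by field.
Qed.

(** The abscissae of the points of order 3 are the roots of 3 x^4 - 6 x^2 - 1. *)
Lemma three_torsion P : P *+ 3 = 0 -> point_over K P.
Proof.
move=> h3; case e: (lem_val P) => [|x y] //; have h := lem_val_eq e.
have ky : K x -> K x /\ K y.
  by move=> kx; split=> //; apply: sK; rewrite h; apply: (subfieldB hK) => //; apply: subfieldX.
apply: ky; have [y0|y0] := eqVneq y 0.
  have : x * (x ^+ 2 - 1) = 0 by rewrite -[RHS](expr0n _ 2) -y0 h; ring.
  move/eqP; rewrite mulf_eq0 subr_eq0 => /orP[/eqP->|/eqP x1]; first exact: subfield0.
  by apply: sK; rewrite x1; apply: subfield1.
have e2 : P *+ 2 = - P by apply/eqP; rewrite -addr_eq0 -mulrSr h3.
have [y' ] := dbl_val e y0; rewrite e2 lem_valN e => -[ex _].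
have x1 : x ^+ 3 - x != 0 by rewrite -h expf_neq0.
have hx : 3 * (x ^+ 2) ^+ 2 + (- 6) * x ^+ 2 + (-1) = 0.
  transitivity (x * (4 * (x ^+ 3 - x)) - (x ^+ 2 + 1) ^+ 2); first by ring.
  by rewrite {1}ex divfK ?subrr // mulf_neq0 // pnatr_eq0.
apply: sK; apply: (sqrt_closed_quadratic _ hK sK _ _ _ _ hx); rewrite ?pnatr_eq0 //; subfield_closed hK.
Qed.

End PointOver.

(** * Torsion and coprime multiples *)

Section ZmodTorsion.
Variable V : zmodType.
Implicit Types P Q : V.

Lemma bezout_mulrn P a b : (0 < a)%N -> coprime a b -> P *+ b = 0 ->
  exists u, P = P *+ (a * u).
Proof.
move=> a0 /(coprimeP b a0)[[u v] /= e] hb; exists u.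
have -> : (a * u = 1 + b * v)%N.
  by rewrite mulnC [(b * v)%N]mulnC -e subnK // ltnW // -subn_gt0 e.
by rewrite mulrnDr mulrnA hb mul0rn addr0.
Qed.

Lemma coprime_torsion P a b : (0 < a)%N -> coprime a b -> P *+ a = 0 -> P *+ b = 0 -> P = 0.
Proof.
by move=> a0 cab ha /(bezout_mulrn a0 cab)[u ->]; rewrite mulrnA ha mul0rn.
Qed.

Lemma prime_torsion_inj p P a b : prime p -> P *+ p = 0 -> P != 0 ->
  (a < p)%N -> (b < p)%N -> P *+ a = P *+ b -> a = b.
Proof.
move=> p_pr hp P0; wlog ab : a b / (a <= b)%N.
  by move=> H ha hb e; case/orP: (leq_total a b) => h; [|apply: esym]; apply: H.
move=> ha hb e; apply/eqP; rewrite eqn_leq ab /= -subn_eq0; apply: contraNT P0.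
rewrite -lt0n => d0; apply/eqP/(@coprime_torsion P (b - a) p) => //.
  rewrite coprime_sym prime_coprime //; apply/negP => /(dvdn_leq d0); lia.
by rewrite mulrnBr // e subrr.
Qed.
End ZmodTorsion.

(** * Iterated doubling *)

Section Doubling.
Variable F : numClosedFieldType.
Implicit Types P Q : lem_point F.

(** Numerator and denominator of x(2^j P) as polynomials in x(P). *)
Fixpoint dbl_poly (j : nat) : {poly F} * {poly F} :=
  if j is j'.+1 then let: (n, d) := dbl_poly j' in
    ((n ^+ 2 + d ^+ 2) ^+ 2, 4 *: (n ^+ 3 * d - n * d ^+ 3))
  else ('X, 1).

Lemma dbl_poly_size j : (size (dbl_poly j).1 <= (4 ^ j).+1)%N /\ (size (dbl_poly j).2 <= 4 ^ j)%N.
Proof.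
elim: j => [|j] /=; first by rewrite size_polyX size_polyC oner_eq0.
case: (dbl_poly j) => n d /= [hn hd].
have hX (f : {poly F}) k m : (0 < m)%N -> (size f <= m.+1)%N -> (size (f ^+ k) <= (k * m).+1)%N.
  move=> m0 hf; apply: leq_trans (size_exp_leq _ _) _; rewrite mulnC ltnS leq_mul2l.
  by apply/orP; right; case: (size f) hf.
have p4 : (0 < 4 ^ j)%N by rewrite expn_gt0.
have hd' : (size d <= (4 ^ j).+1)%N by apply: leq_trans hd _.
split.
  have : (size ((n ^+ 2 + d ^+ 2) ^+ 2) <= (2 * (2 * 4 ^ j)).+1)%N.
    apply: (hX); first by rewrite muln_gt0.
    by apply: leq_trans (size_polyD _ _) _; rewrite geq_max !hX.
  by rewrite expnS mulnA.
apply: leq_trans (size_scale_leq _ _) _.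
apply: leq_trans (size_polyD _ _) _; rewrite size_polyN geq_max; apply/andP; split.
  apply: leq_trans (size_polyMleq _ _) _; have := hX n 3 _ p4 hn; rewrite expnS.
  by move: (size (n ^+ 3)) (size d) (4 ^ j)%N hd => x y z; lia.
apply: leq_trans (size_polyMleq _ _) _; have := hX d 2 _ p4 hd'.
have := size_polyMleq d (d ^+ 2); rewrite -exprS expnS.
move: (size (d ^+ 3)) (size (d ^+ 2)) (size n) (size d) (4 ^ j)%N hn hd => x y z t r; lia.
Qed.

Lemma dbl_polyS j x (n := (dbl_poly j).1.[x]) (d := (dbl_poly j).2.[x]) :
  (dbl_poly j.+1).1.[x] = (n ^+ 2 + d ^+ 2) ^+ 2 /\
  (dbl_poly j.+1).2.[x] = 4 * (n ^+ 3 * d - n * d ^+ 3).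
Proof. by rewrite /n /d /=; case: (dbl_poly j) => f g /=; rewrite !hornerE. Qed.

(** The point (0, 0) has order 2, so its abscissa is sent to infinity; this shows
    that x(2^j P) = x(P) is not an identity. *)
Lemma dbl_poly_at0 j : (dbl_poly j.+1).1.[0] = 1 /\ (dbl_poly j.+1).2.[0] = 0.
Proof.
elim: j => [|j [h1 h2]].
  by have [-> ->] := dbl_polyS 0 0; rewrite !hornerE /=; split; ring.
by have [-> ->] := dbl_polyS j.+1 0; rewrite h1 h2; split; ring.
Qed.

(** As P has odd order, no 2^j P is the origin and no denominator vanishes. *)
Lemma dbl_poly_val P p j : odd p -> P *+ p = 0 -> P != 0 -> exists x xj yj,
  [/\ exists y, lem_val P = Affine x y, lem_val (P *+ 2 ^ j) = Affine xj yj,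
      (dbl_poly j).2.[x] != 0 & xj * (dbl_poly j).2.[x] = (dbl_poly j).1.[x]].
Proof.
move=> p_odd hp P0.
have nz k : P *+ 2 ^ k <> 0.
  move=> h; move/eqP: P0; apply; apply: (@coprime_torsion _ P (2 ^ k) p) => //.
    by rewrite expn_gt0.
  by rewrite coprimeXl // coprime2n.
elim: j => [|j [x [xj [yj [hx ej d0 exj]]]]].
  case e: (lem_val P) => [|x y]; first by case/eqP: P0; apply: val_inj.
  exists x, x, y; rewrite /= !hornerE; split=> //; last exact: oner_neq0.
  by exists y.
have yj0 : yj != 0.
  apply/eqP => yj0; apply: (nz j.+1); rewrite expnSr mulrnA mulr2n; apply: val_inj.
  by rewrite -[LHS]/(lem_val _) lem_valD ej yj0 /= eqxx oppr0 eqxx.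
have [yj' e'] := dbl_val ej yj0.
have hxj : xj ^+ 3 - xj != 0 by rewrite -(lem_val_eq ej) expf_neq0.
have [eN eD] := dbl_polyS j x.
exists x, ((xj ^+ 2 + 1) ^+ 2 / (4 * (xj ^+ 3 - xj))), yj'; split=> //.
- by rewrite expnSr mulrnA.
- rewrite eD -exj (_ : _ - _ = (dbl_poly j).2.[x] ^+ 4 * (xj ^+ 3 - xj)); last by ring.
  by rewrite !mulf_neq0 ?expf_neq0 ?pnatr_eq0.
- by rewrite eN eD -exj; field.
Qed.

(** The points killed by p satisfy 2^m P = - P, so that their abscissae are roots
    of the equation x(2^m P) = x(P), of degree 4^m. *)
Lemma fermat_torsion_card m p (s : seq (lem_point F)) : (0 < m)%N -> p = (2 ^ m).+1 ->
  uniq s -> (forall P, P \in s -> P *+ p = 0) -> (size s <= 2 * 4 ^ m + 1)%N.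
Proof.
move=> m0 ep us hs; have p_odd : odd p by rewrite ep /= oddX orbF; case: m m0 {ep}.
pose G := (dbl_poly m).1 - 'X * (dbl_poly m).2.
have [sN sD] := dbl_poly_size m.
have G0 : G != 0.
  apply/eqP => /(congr1 (fun f : {poly F} => f.[0])); rewrite /G; case: m m0 {ep sN sD G} => // m _.
  have [h1 h2] := dbl_poly_at0 m; rewrite !(hornerD, hornerN, hornerM, hornerX) h1 h2.
  by rewrite horner0 mulr0 subr0 => /eqP; rewrite oner_eq0.
have sG : (size G <= (4 ^ m).+1)%N.
  apply: leq_trans (size_polyD _ _) _; rewrite size_polyN geq_max sN.
  apply: leq_trans (size_polyMleq _ _) _; rewrite size_polyX; move: (size _) (4 ^ m)%N sD => a b; lia.
pose absc (P : lem_point F) := if lem_val P is Affine x _ then x else 0.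
pose xs := undup [seq absc P | P <- s & P != 0].
have sxs : (size xs <= 4 ^ m)%N.
  rewrite -ltnS; apply: leq_trans sG; apply: max_poly_roots => //; last exact: undup_uniq.
  apply/allP => x; rewrite mem_undup => /mapP[P]; rewrite mem_filter => /andP[P0 /hs hp] ->.
  have [x' [xj [yj [[y e] ej d0 exj]]]] := dbl_poly_val m p_odd hp P0.
  have eN : P *+ 2 ^ m = - P by apply/eqP; rewrite -addr_eq0 -mulrSr -ep hp.
  move: ej; rewrite eN lem_valN e => -[ex _].
  by rewrite /root /absc e !hornerE -exj ex subrr.
pose rt (x : F) := sqrtC (x ^+ 3 - x).
pose pts : seq (point F) := Infinity :: [seq Affine x (rt x) | x <- xs] ++ [seq Affine x (- rt x) | x <- xs].
have sub : {subset [seq lem_val P | P <- s] <= pts}.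
  move=> _ /mapP[P Ps ->]; case e: (lem_val P) => [|x y]; first by rewrite mem_head.
  have xxs : x \in xs.
    rewrite mem_undup; apply/mapP; exists P; last by rewrite /absc e.
    by rewrite mem_filter Ps andbT; apply/eqP => P00; move: e; rewrite P00.
  have /eqP : y ^+ 2 = rt x ^+ 2 by rewrite sqrtCK; apply: lem_val_eq e.
  rewrite in_cons mem_cat eqf_sqr => /orP[] /eqP ->.
    by rewrite (map_f (fun x => Affine x (rt x)) xxs) orbT.
  by rewrite (map_f (fun x => Affine x (- rt x)) xxs) !orbT.
have um : uniq [seq lem_val P | P <- s] by rewrite map_inj_uniq //; apply: val_inj.
have := uniq_leq_size um sub; rewrite size_map /= size_cat !size_map.
move: (size s) (size xs) (4 ^ m)%N sxs => a b c; lia.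
Qed.

End Doubling.

(** * Complex multiplication *)

Section ComplexMultiplication.
Variable F : numClosedFieldType.
Implicit Types P Q : lem_point F.
Local Notation i := ('i : F).

Let on_map (f : {rmorphism F -> F}) P : on_curve (-1) 0 (map_point f P).
Proof.
by have /(map_on_curve f) := on_lem P; rewrite rmorphN1 rmorph0.
Qed.

Definition lem_cm P : lem_point F := lem_of (cm_on_curve (sqrCi F) (on_lem P)).
Definition lem_conj P : lem_point F := lem_of (on_map Num.conj P).

Lemma lem_cmD : {morph lem_cm : P Q / P + Q}.
Proof.
by move=> P Q; apply/val_inj/cm_ec_add; rewrite ?sqrCi ?pnatr_eq0.
Qed.

Lemma lem_cmK P : lem_cm (lem_cm P) = - P.
Proof.
apply: val_inj; rewrite -[LHS]/(cm_point i (cm_point i P)) -[RHS]/(ec_opp P).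
by case: (lem_val P) => //= x y; rewrite opprK mulrA -expr2 sqrCi mulN1r.
Qed.

Lemma lem_cmN P : lem_cm (- P) = - lem_cm P.
Proof. by rewrite -lem_cmK -[RHS]lem_cmK. Qed.

Lemma lem_cm0 : lem_cm 0 = 0. Proof. exact: val_inj. Qed.

Lemma lem_cmMn P n : lem_cm (P *+ n) = lem_cm P *+ n.
Proof. by elim: n => [|n IHn]; rewrite ?mulr0n ?lem_cm0 // !mulrS lem_cmD IHn. Qed.

Lemma lem_conjD : {morph lem_conj : P Q / P + Q}.
Proof.
move=> P Q; apply: val_inj; rewrite -[LHS]/(map_point Num.conj (ec_add (-1) P Q)).
by rewrite map_ec_add rmorphN1.
Qed.

Lemma lem_conjK : involutive lem_conj.
Proof.
move=> P; apply: val_inj; rewrite -[LHS]/(map_point Num.conj (map_point Num.conj P)).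
by rewrite -[RHS]/(lem_val P); case: (lem_val P) => //= x y; rewrite !conjCK.
Qed.

Lemma lem_conj0 : lem_conj 0 = 0. Proof. exact: val_inj. Qed.

Lemma lem_conjN P : lem_conj (- P) = - lem_conj P.
Proof.
by apply/eqP; rewrite -addr_eq0 -lem_conjD addNr lem_conj0.
Qed.

Lemma lem_conjMn P n : lem_conj (P *+ n) = lem_conj P *+ n.
Proof. by elim: n => [|n IHn]; rewrite ?mulr0n ?lem_conj0 // !mulrS lem_conjD IHn. Qed.

Lemma lem_cm_conj P : lem_cm (lem_conj P) = - lem_conj (lem_cm P).
Proof.
apply: val_inj; rewrite -[LHS]/(cm_point i (map_point Num.conj P)).
rewrite -[RHS]/(ec_opp (map_point Num.conj (cm_point i P))).
by case: (lem_val P) => //= x y; rewrite rmorphN rmorphM /= conjCi mulNr opprK.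
Qed.

Variables (m j p : nat).
Hypotheses (m0 : (0 < m)%N) (pm : p = (2 ^ m).+1) (pj : p = (j * j).+1) (p_pr : prime p).

(** The kernel of i - j, one of the two eigenspaces of i on the p-torsion. *)
Definition eig P := lem_cm P = P *+ j.

Lemma eigB P Q : eig P -> eig Q -> eig (P - Q).
Proof. by rewrite /eig lem_cmD lem_cmN => -> ->; rewrite mulrnBl. Qed.
Lemma eigMn P n : eig P -> eig (P *+ n).
Proof. by rewrite /eig lem_cmMn => ->; rewrite mulrnAC. Qed.
Lemma eigD P Q : eig P -> eig Q -> eig (P + Q).
Proof. by rewrite /eig lem_cmD => -> ->; rewrite mulrnDl. Qed.

Lemma eig_torsion P : eig P -> P *+ p = 0.
Proof.
move=> h; have := lem_cmK P; rewrite h lem_cmMn h -mulrnA pj => e.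
by rewrite mulrS e subrr.
Qed.

Lemma coprime_2j : coprime (2 * j) p.
Proof.
rewrite coprimeMl; apply/andP; split.
  by rewrite coprime2n pm /= oddX orbF; case: m m0.
by rewrite pj /coprime -addn1 gcdnMDl gcdn1.
Qed.

(** Complex conjugation exchanges the kernels of i - j and i + j.  Two independent
    points of the first would thus give p^4 points of p-torsion, too many for
    [fermat_torsion_card]. *)
Lemma eig_cyclic P Q : eig P -> eig Q -> P != 0 -> exists k, Q = P *+ k.
Proof.
move=> eP eQ P0; apply: contrapT => nk.
have p0 : (0 < p)%N by apply: prime_gt0.
have hP := eig_torsion eP; have hQ := eig_torsion eQ.
have indep_lt a b a' b' : (b < b')%N -> (b' < p)%N -> (a' < p)%N ->
    P *+ a + Q *+ b <> P *+ a' + Q *+ b'.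
  move=> bb b'p a'p e; apply: nk.
  have eQb : Q *+ (b' - b) = P *+ (a + (p - a')).
    rewrite mulrnBr; last exact: ltnW.
    rewrite mulrnDr mulrnBr; last exact: ltnW.
    by rewrite hP sub0r; apply/eqP; rewrite subr_eq addrAC eq_sym subr_eq e addrC.
  have d0 : (0 < b' - b)%N by rewrite subn_gt0.
  have cop : coprime (b' - b) p.
    by rewrite coprime_sym prime_coprime //; apply/negP => /(dvdn_leq d0); lia.
  have [u ->] := bezout_mulrn d0 cop hQ.
  by exists ((a + (p - a')) * u)%N; rewrite mulrnA eQb -mulrnA.
have indep a b a' b' : (a < p)%N -> (b < p)%N -> (a' < p)%N -> (b' < p)%N ->
    P *+ a + Q *+ b = P *+ a' + Q *+ b' -> a = a' /\ b = b'.
  move=> ha hb ha' hb' e; case: (ltngtP b b') => [h|h|eb].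
  - by case: (indep_lt _ _ _ _ h hb' ha' e).
  - by case: (indep_lt _ _ _ _ h hb ha (esym e)).
  subst b'; split=> //; apply: (prime_torsion_inj p_pr hP P0) => //.
  exact: (addIr _ e).
pose phi (t : 'I_p * 'I_p * ('I_p * 'I_p)) : lem_point F :=
  (P *+ t.1.1 + Q *+ t.1.2) + lem_conj (P *+ t.2.1 + Q *+ t.2.2).
have eX (a b : nat) : eig (P *+ a + Q *+ b) by apply: eigD; apply: eigMn.
have phi_inj : injective phi.
  move=> [[a b] [c d]] [[a' b'] [c' d']]; rewrite /phi /=.
  set X := P *+ a + _; set X' := P *+ a' + _; set Y := P *+ c + _; set Y' := P *+ c' + _ => e.
  pose Z := X - X'; have eZ : Z = lem_conj (Y' - Y).
    rewrite lem_conjD lem_conjN; apply/eqP.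
    by rewrite /Z subr_eq addrAC eq_sym subr_eq addrC -e addrC.
  have hZ : eig Z by apply: eigB; apply: eX.
  have hY : eig (Y' - Y) by apply: eigB; apply: eX.
  have Z0 : Z = 0.
    apply: (@coprime_torsion _ Z (2 * j) p) (eig_torsion hZ) => //.
    - by rewrite muln_gt0 /=; case: j pj p_pr => // ->.
    - exact: coprime_2j.
    have : lem_cm Z = - (Z *+ j) by rewrite eZ lem_cm_conj hY lem_conjMn.
    by rewrite hZ => /eqP; rewrite -addr_eq0 -mulrnDr addnn -mul2n => /eqP.
  have eXX : X = X' by apply: subr0_eq.
  have eYY : Y = Y'.
    by apply: (can_inj lem_conjK); apply: (addrI X); rewrite {2}eXX.
  have [e1 e2] := indep _ _ _ _ (ltn_ord a) (ltn_ord b) (ltn_ord a') (ltn_ord b') eXX.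
  have [e3 e4] := indep _ _ _ _ (ltn_ord c) (ltn_ord d) (ltn_ord c') (ltn_ord d') eYY.
  by congr (_, _, (_, _)); apply: val_inj.
pose s := [seq phi t | t <- enum [set: 'I_p * 'I_p * ('I_p * 'I_p)]].
have us : uniq s by rewrite map_inj_uniq ?enum_uniq.
have hs R : R \in s -> R *+ p = 0.
  case/mapP => t _ ->; rewrite /phi mulrnDl -lem_conjMn !mulrnDl ![_ *+ _ *+ p]mulrnAC hP hQ.
  by rewrite !mul0rn addr0 lem_conj0 addr0.
have := fermat_torsion_card m0 pm us hs.
rewrite size_map -cardE cardsT !card_prod card_ord.
apply/negP; rewrite -ltnNge pm (_ : 4 = 2 * 2)%N // expnMn.
have : (0 < 2 ^ m)%N by rewrite expn_gt0.
move: (2 ^ m)%N => x; clear; nia.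
Qed.

End ComplexMultiplication.

(** * Torsion of Fermat order is constructible *)

Section FermatTorsion.
Variables (F : numClosedFieldType) (K : F -> Prop).
Hypotheses (hK : is_subfield K) (sK : sqrt_closed K) (cK : forall z, K z -> K z^*).
Local Notation algebraic := (algebraicOver (ratr : rat -> F)).
Implicit Types P Q : lem_point F.

Section FermatPrime.
Variables (m j p : nat).
Hypotheses (m0 : (0 < m)%N) (pm : p = (2 ^ m).+1) (pj : p = (j * j).+1) (p_pr : prime p).

(** Let t be the square of an automorphism: it fixes i, hence acts on the cyclic
    kernel of i - j as multiplication by some k, so t^(p - 1) is trivial there. *)
Lemma eig_point_over P : eig j P -> point_over algebraic P -> point_over K P.
Proof.
move=> eP; case e: (lem_val P) => [|x y] // [[px px0 rx] [py py0 ry]].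
have P0 : P != 0 by apply/eqP => P0; move: e; rewrite P0.
pose g : {poly rat} := px * py * ('X^2 + 1%:P).
have gi0 : ('X^2 + 1%:P : {poly rat}) != 0.
  by rewrite -size_poly_eq0 -[1%:P]opprK -polyCN size_XnsubC.
have g0 : g != 0 by rewrite !mulf_neq0.
have [L [iota hL]] := splitting_number_field F g0.
have rg z : root (map_poly ratr px) z || root (map_poly ratr py) z || (z ^+ 2 == -1) ->
    root (map_poly (ratr : rat -> F) g) z.
  rewrite !rmorphM !rootM => /orP[->//|/eqP hz].
  rewrite rmorphD /= map_polyXn map_polyC /= rmorph1 [X in _ || X]rootE !hornerE hz addNr eqxx.
  by rewrite orbT.
have [x' ex] : exists x', iota x' = x by apply/hL/rg; rewrite rx.
have [y' ey] : exists y', iota y' = y by apply/hL/rg; rewrite ry orbT.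
have [i' ei] : exists i', iota i' = 'i by apply/hL/rg; rewrite sqrCi eqxx !orbT.
have si : i' ^+ 2 = -1 by apply: (fmorph_inj iota); rewrite rmorphXn /= ei sqrCi rmorphN1.
pose P' : point L := Affine x' y'.
have eP' : map_point iota P' = lem_val P by rewrite /= ex ey e.
have cmP' : cm_point i' P' = ec_mul (-1) j P'.
  apply: (map_point_inj (f := iota)); rewrite map_ec_mul rmorphN1 eP' -lem_valMn -eP.
  by rewrite -[RHS]/(cm_point 'i (lem_val P)) -eP' /= rmorphN rmorphM /= ei.
have onP' : on_curve (-1) 0 P'.
  by apply/(map_on_curve iota); rewrite rmorphN1 rmorph0 eP'; apply: on_lem.
suff gal_fix (s : gal_of {:L}) : s \in ('Gal({:L} / 1%AS))%g ->
    (s ^+ (2 ^ m.+1))%g x' = x' /\ (s ^+ (2 ^ m.+1))%g y' = y'.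
  rewrite /= -ex -ey; split.
    by apply: (@gal_two_power L F iota K hK sK m.+1 x') => s /gal_fix[].
  by apply: (@gal_two_power L F iota K hK sK m.+1 y') => s /gal_fix[].
move=> sG; pose t := (s ^+ 2)%g.
have ti : t i' = i'.
  have si' : (s i' == i') || (s i' == - i').
    by rewrite -eqf_sqr -rmorphXn si rmorphN1.
  rewrite /t expgS expg1 galM ?memvf //.
  by case/orP: si' => /eqP h; rewrite !h ?rmorphN /= ?h ?opprK.
have onC (Q : point L) : on_curve (-1) 0 Q -> on_curve (-1) 0 (map_point iota Q).
  by move/(map_on_curve iota); rewrite rmorphN1 rmorph0.
have onT : on_curve (-1) 0 (map_point t P').
  by move/(map_on_curve t): onP'; rewrite rmorphN1 rmorph0.
pose Q : lem_point F := lem_of (onC _ onT).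
have eQ : eig j Q.
  apply: val_inj; rewrite -[LHS]/(cm_point 'i (map_point iota (map_point t P'))).
  rewrite -[RHS]/(lem_val (Q *+ j)) lem_valMn -[lem_val Q]/(map_point iota (map_point t P')).
  rewrite -(rmorphN1 iota) -map_ec_mul -(rmorphN1 t) -map_ec_mul -cmP' /=.
  by rewrite !rmorphN !rmorphM /= ti ei.
have [k ek] := eig_cyclic m0 pm pj p_pr eP eQ P0.
have tP : map_point iota (map_point t P') = lem_val (P *+ k) by rewrite -ek.
have tnP n : map_point iota (map_point (t ^+ n)%g P') = lem_val (P *+ (k ^ n)).
  elim: n => [|n IHn]; first by rewrite mulr1n /= !gal_id ex ey e.
  have IH' : map_point (t ^+ n)%g P' = ec_mul (-1) (k ^ n) P'.
    apply: (map_point_inj (f := iota)); rewrite IHn map_ec_mul rmorphN1 eP'.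
    by rewrite lem_valMn.
  have -> : map_point (t ^+ n.+1)%g P' = map_point t (map_point (t ^+ n)%g P').
    by rewrite /= expgSr !galM ?memvf.
  rewrite IH' map_ec_mul rmorphN1 map_ec_mul rmorphN1 tP -lem_valMn.
  by rewrite expnS mulrnA.
have hp := eig_torsion pj eP.
have pk : coprime p k.
  rewrite prime_coprime //; apply/negP => /dvdnP[d ed]; move: tP.
  by rewrite ed mulnC mulrnA hp mul0rn.
have pt : lem_val (P *+ (k ^ p.-1)) = lem_val P.
  congr lem_val; have := Euler_exp_totient; move/(_ k p); rewrite coprime_sym pk => /(_ isT).
  rewrite totient_prime // => ekp.
  rewrite (divn_eq (k ^ p.-1) p) ekp modn_small ?prime_gt1 //.
  by rewrite mulrnDr mulnC mulrnA hp mul0rn add0r.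
have : map_point iota (map_point (t ^+ p.-1)%g P') = map_point iota P' by rewrite tnP pt eP'.
move/(map_point_inj (f := iota)) => [fx fy].
by rewrite expnS expgM -/t -[(2 ^ m)%N]/((2 ^ m).+1.-1)%N -pm fx fy.
Qed.

(** 2 j P is the sum of j P + i P, in the kernel of i - j, and of j P - i P, which
    complex conjugation sends there. *)
Lemma fermat_prime_torsion P : P *+ p = 0 -> point_over algebraic P -> point_over K P.
Proof.
move=> hp aP.
have aK := algebraic_subfield F; have asK := @algebraic_sqrt F.
have hjj : P *+ j *+ j = - P.
  by rewrite -mulrnA; apply/eqP; rewrite -addr_eq0 -mulrSr -pj hp.
have acm : point_over algebraic (lem_cm P).
  rewrite -[lem_val (lem_cm P)]/(cm_point 'i (lem_val P)).
  move: aP; case: (lem_val P) => //= x y [ax ay].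
  have ai : algebraic 'i.
    by apply: asK; rewrite sqrCi; apply/(subfieldN aK)/(subfield1 aK).
  by split; [apply: (subfieldN aK) | apply: (subfieldM aK)].
have aPj : point_over algebraic (P *+ j) by apply: point_overMn.
pose P1 := P *+ j + lem_cm P; pose P2 := P *+ j - lem_cm P.
have k1 : point_over K P1.
  apply: eig_point_over; last exact: point_overD.
  by rewrite /eig /P1 lem_cmD lem_cmK lem_cmMn mulrnDl hjj addrC.
have k2 : point_over K P2.
  have conj_over (L : F -> Prop) Q : (forall z, L z -> L z^*) ->
      point_over L Q -> point_over L (lem_conj Q).
    move=> hL; rewrite -[lem_val (lem_conj Q)]/(map_point Num.conj (lem_val Q)).
    by case: (lem_val Q) => //= x y [/hL lx /hL ly].
  rewrite -[P2]lem_conjK; apply: (conj_over) => //; apply: eig_point_over.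
    rewrite /eig lem_cm_conj -lem_conjMn -lem_conjN; congr lem_conj.
    by rewrite /P2 lem_cmD lem_cmN lem_cmK lem_cmMn mulrnBl hjj !opprD !opprK addrC.
  apply: conj_over; last by apply: point_overD => //; apply: point_overN.
  move=> z [q q0 rq]; exists q => //.
  have -> : map_poly ratr q = map_poly Num.conj (map_poly (ratr : rat -> F) q).
    by rewrite -map_poly_comp; apply: eq_map_poly => a /=; rewrite fmorph_rat.
  by rewrite /root horner_map fmorph_eq0.
have e12 : P *+ (2 * j) = P1 + P2.
  by rewrite /P1 /P2 mulnC mulrnA mulr2n addrACA subrr addr0.
have j0 : (0 < 2 * j)%N by rewrite muln_gt0 /=; case: j pj p_pr => // ->.
have [u ->] := bezout_mulrn j0 (coprime_2j m0 pm pj) hp.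
by rewrite mulrnA e12; apply: point_overMn => //; apply: point_overD.
Qed.
End FermatPrime.

(** Split off one prime factor p of n: halving for p = 2, and otherwise Bezout
    between p and the prime-to-p part. *)
Lemma fermat_torsion n P : (0 < n)%N ->
  (forall p, prime p -> odd p -> (p %| n)%N ->
    (exists j, p.-1 = 2 ^ j)%N /\ ~~ (p ^ 2 %| n)%N) ->
  P *+ n = 0 -> point_over algebraic P -> point_over K P.
Proof.
have aK := algebraic_subfield F.
elim/ltn_ind: n P => n IHn P n0 hn hP aP.
have [n1|n1] := eqVneq n 1%N; first by move: hP; rewrite n1 mulr1n => ->.
have hdiv d : (d %| n)%N -> forall p, prime p -> odd p -> (p %| d)%N ->
    (exists j, p.-1 = 2 ^ j)%N /\ ~~ (p ^ 2 %| d)%N.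
  move=> dn p p_pr p_odd pd; have [h1 h2] := hn p p_pr p_odd (dvdn_trans pd dn).
  by split=> //; apply: contra h2 => h; apply: dvdn_trans dn.
have n_gt1 : (1 < n)%N by lia.
set p := pdiv n; have p_pr : prime p by apply: pdiv_prime.
have pn : (p %| n)%N by apply: pdiv_dvd.
have en : n = (p * (n %/ p))%N by rewrite mulnC divnK.
have d0 : (0 < n %/ p)%N by rewrite divn_gt0 ?prime_gt0 // dvdn_leq.
have dlt : (n %/ p < n)%N by rewrite ltn_Pdiv // prime_gt1.
have dn : (n %/ p %| n)%N by rewrite {2}en dvdn_mull.
have kpP : point_over K (P *+ p).
  apply: (IHn _ dlt) => //; first exact: hdiv.
    by rewrite -mulrnA -en.
  exact: point_overMn.
have [p2|p_odd] := even_prime p_pr.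
  by apply: (halving hK sK); rewrite -p2.
have [[a pa] np2] := hn p p_pr p_odd pn.
have cop : coprime p (n %/ p).
  by rewrite prime_coprime //; apply: contra np2 => h; rewrite en -mulnn dvdn_pmul2l ?prime_gt0.
have kmP : point_over K (P *+ (n %/ p)).
  have hmP : P *+ (n %/ p) *+ p = 0 by rewrite -mulrnA mulnC -en.
  have amP : point_over algebraic (P *+ (n %/ p)) by apply: point_overMn.
  have [p3|p3] := eqVneq p 3%N.
    by apply: (three_torsion hK sK); rewrite -p3.
  have pE : p = (2 ^ a).+1 by rewrite -pa prednK ?prime_gt0.
  have a0 : (0 < a)%N by case: a pa pE => // _ pE; rewrite pE in p_odd.
  have ae : odd a = false.
    apply/negP => ao; have : (3 %| p)%N.
      rewrite pE -(odd_double_half a) ao add1n expnS -mul2n expnM.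
      rewrite /dvdn -addn1 -modnDml -modnMmr -modnXm /= exp1n.
      by [].
    by rewrite dvdn_prime2 // eq_sym (negPf p3).
  apply: (@fermat_prime_torsion a (2 ^ a./2) p) => //.
  by rewrite pE -expnD addnn -[in LHS](odd_double_half a) ae.
have /(coprimeP _ (prime_gt0 p_pr))[[u v] /= euv] := cop.
have -> : P = P *+ p *+ u - P *+ (n %/ p) *+ v.
  apply/eqP; rewrite eq_sym subr_eq -!mulrnA -mulrS; apply/eqP; congr (_ *+ _); lia.
by apply: point_overD => //; [|apply: point_overN => //]; apply: point_overMn.
Qed.
End FermatTorsion.

Lemma pow2_totient n k : (0 < n)%N -> totient n = (2 ^ k)%N ->
  forall p, prime p -> odd p -> (p %| n)%N ->
    (exists j, p.-1 = 2 ^ j)%N /\ ~~ (p ^ 2 %| n)%N.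
Proof.
move=> n0 hk p p_pr p_odd pn; have [d cpd en] := pfactor_coprime p_pr n0.
have l0 : (0 < logn p n)%N by rewrite logn_gt0 mem_primes p_pr n0.
have et : totient n = (totient d * (p.-1 * p ^ (logn p n).-1))%N.
  by rewrite {1}en totient_coprime ?totient_pfactor // coprimeXr // coprime_sym.
have p2 := erefl : prime 2.
split.
  have : (p.-1 %| 2 ^ k)%N by rewrite -hk et mulnCA dvdn_mulr.
  by case/(dvdn_pfactor _ _ p2) => j _ ->; exists j.
rewrite pfactor_dvdn // -leqNgt -ltnS ltnNge; apply/negP => l2.
have : (p %| 2 ^ k)%N.
  rewrite -hk et; apply/dvdn_mull/dvdn_mull.
  by rewrite -[X in (X %| _)%N]expn1 dvdn_exp2l //; lia.
rewrite Euclid_dvdX // => /andP[]; rewrite dvdn_prime2 // => /eqP p_2.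
by rewrite p_2 in p_odd.
Qed.

Theorem theorem1p4 (R : realType) (n : nat) (hn : (2 <= n)%N) :
  constructible_field (torsion_field (R := R) (-1)%R 0%R n) <->
  exists k : nat, totient n = (2 ^ k)%N.
Proof.
split; first exact: constructible_torsion_totient.
move=> [k hk] z hz; have n0 : (0 < n)%N by apply: ltnW.
have hK := constructible_subfield R.
pose K : {pred R[i]} := fun x => `[< constructible x >].
suff : z \in K by move/asboolP.
apply: hz; first split.
- by apply/asboolP; apply: subfield1.
- by move=> x y /asboolP hx /asboolP hy; apply/asboolP/(subfieldB hK).
- by move=> x y /asboolP hx /asboolP hy; apply/asboolP/(subfield_div hK).
move=> s [x [y [/torsionP[P eP [aP hP]] hs]]].
have : point_over (@constructible R) (lem_val P).
  apply: (@fermat_torsion _ _ hK (@constructible_sqrt R) (@constructible_conj R) n) => //.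
  - exact: pow2_totient hk.
  - by rewrite eP.
by rewrite eP => -[hx hy]; apply/asboolP; case: hs => ->.
Qed.
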